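(* For any $p\in(1,\infty)$ the semigroup $(T_p(t))_{t\ge0}$ is irreducible, i.e., for any nonnegative and not identically vanishing function $f\in L^p(\mathbb{R}^N)$ and any $t>0$, it holds that $T_p(t)f>0$ in $\mathbb{R}^N$.
   Context: Let $N$ be a positive integer, $\alpha\in[0,2]$ and $\beta\ge 0$ with $\alpha^2+\beta^2\neq 0$. Set $a(x)=1+|x|^\alpha$, $V(x)=|x|^\beta$, $\mathcal{A}u=a\Delta u-Vu$ on $\mathbb{R}^N$. For $p\in(1,\infty)$, $A_p$ is the realization of $\mathcal{A}$ in $L^p(\mathbb{R}^N)$ with domain $D(A_p)=\{u\in W^{2,p}(\mathbb{R}^N): a|D^2u|,\ a^{1/2}|\nabla u|,\ Vu\in L^p(\mathbb{R}^N)\}$. The operator $A_p$ generates a strongly continuous analytic semigroup $(T_p(t))_{t\ge0}$ in $L^p(\mathbb{R}^N)$. For $t>0$ the function $T_p(t)f$ has a continuous representative, to which the pointwise inequality refers. *)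

(* Defs.v *)
From HB Require Import structures.
From mathcomp Require Import all_boot all_order all_algebra.
From mathcomp Require Import all_classical all_reals all_analysis.
Set Implicit Arguments.
Unset Strict Implicit.
Unset Printing Implicit Defensive.
Import Order.TTheory GRing.Theory Num.Theory.
Import numFieldNormedType.Exports.
Local Open Scope classical_set_scope.
Local Open Scope ring_scope.

(* The library has no measurable structure on 'rV[R]_n.  As on tuples, we use
   the sigma-algebra generated by the coordinates, which on R^n is the Borel
   sigma-algebra. *)
Definition rV_coord (R : realType) (n : nat) (i : 'I_n) (v : 'rV[R]_n) :
  measurableTypeR R := v ord0 i.

Section measurable_rV.
Variables (R : realType) (n : nat).
Let M := g_sigma_preimage (@rV_coord R n).

Let M0 : M set0. Proof. exact: sigma_algebra0. Qed.
Let MC A : M A -> M (~` A). Proof. exact: sigma_algebraC. Qed.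
Let MU (F : (set 'rV[R]_n)^nat) : (forall i, M (F i)) -> M (\bigcup_i F i).
Proof. exact: sigma_algebra_bigcup. Qed.

HB.instance Definition _ := @isMeasurable.Build default_measure_display
  'rV[R]_n M M0 MC MU.

End measurable_rV.

Lemma measurable_rV_coord (R : realType) (n : nat) (i : 'I_n) :
  measurable_fun setT (@rV_coord R n i).
Proof.
move=> _ Y mY; rewrite setTI; apply: sub_sigma_algebra => /=.
rewrite -bigcup_seq/=; exists i => /=; first by rewrite mem_index_enum.
by exists Y => //; rewrite setTI.
Qed.

Lemma measurable_fun_rVP (R : realType) d (T : measurableType d) (n : nat)
    (f : T -> 'rV[R]_n) :
  (forall i, measurable_fun setT (rV_coord i \o f)) -> measurable_fun setT f.
Proof.
move=> mf.
have H : g_sigma_preimage (fun i => @rV_coord R n i \o f) `<=` measurable.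
  apply: smallest_sub; first exact: sigma_algebra_measurable.
  case: n => [|n] in f mf *; first by rewrite big_ord0.
  rewrite -bigcup_mkord_ord; apply: bigcup_sub => i Ii.
  by move=> A [B mB <-]; exact: mf.
move=> _ A mA; apply: H; rewrite g_sigma_preimage_comp.
by exists A.
Qed.

Definition rV_cons (R : realType) (n : nat) (z : measurableTypeR R * 'rV[R]_n) :
  'rV[R]_n.+1 := row_mx (const_mx z.1 : 'rV[R]_1) z.2.

Definition rV_uncons (R : realType) (n : nat) (v : 'rV[R]_n.+1) :
  measurableTypeR R * 'rV[R]_n := (v ord0 ord0, rsubmx (v : 'rV[R]_(1 + n))).

Lemma rV_consK (R : realType) (n : nat) : cancel (@rV_cons R n) (@rV_uncons R n).
Proof.
move=> [x v]; rewrite /rV_cons /rV_uncons /= row_mxKr; congr (_, _).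
transitivity (row_mx (const_mx x : 'rV[R]_1) v ord0 (lshift n ord0)).
  by congr (fun_of_matrix _ _ _); apply/val_inj.
by rewrite row_mxEl mxE.
Qed.

Lemma measurable_rV_cons (R : realType) (n : nat) :
  measurable_fun setT (@rV_cons R n).
Proof.
apply: measurable_fun_rVP => i; rewrite -[i]/(i : 'I_(1 + n)).
case: (@split_ordP 1 n i) => j ->.
  rewrite (_ : _ \o _ = fst) ?ord1; first exact: measurable_fst.
  apply/funext => z /=; rewrite /rV_coord /rV_cons.
  by apply: etrans (row_mxEl _ _ _ _) _; rewrite mxE.
rewrite (_ : _ \o _ = @rV_coord R n j \o snd).
  exact: measurableT_comp (@measurable_rV_coord R n j) measurable_snd.
by apply/funext => z /=; exact: row_mxEr.
Qed.

Lemma measurable_rV_uncons (R : realType) (n : nat) :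
  measurable_fun setT (@rV_uncons R n).
Proof.
apply/measurable_fun_pairP; split; first exact: (@measurable_rV_coord R n.+1 ord0).
apply: measurable_fun_rVP => i.
rewrite (_ : _ \o _ = @rV_coord R n.+1 (rshift 1 i)).
  exact: measurable_rV_coord.
by apply/funext => v /=; rewrite /rV_coord mxE.
Qed.

Section lebesgue_rV.
Variable R : realType.

Section step.
Variables (n : nat) (mu : {sigma_finite_measure set 'rV[R]_n -> \bar R}).
Local Open Scope ereal_scope.

Definition lebesgue_rV_step : set 'rV[R]_n.+1 -> \bar R :=
  pushforward (@lebesgue_measure R \x mu) (@rV_cons R n).

Let mcons := @measurable_rV_cons R n.

Let step0 : lebesgue_rV_step set0 = 0. Proof. exact: measure0. Qed.

Let step_ge0 A : 0 <= lebesgue_rV_step A. Proof. exact: measure_ge0. Qed.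

Let step_sigma_additive : semi_sigma_additive lebesgue_rV_step.
Proof. exact: measure_semi_sigma_additive. Qed.

HB.instance Definition _ := isMeasure.Build _ _ _ lebesgue_rV_step
  step0 step_ge0 step_sigma_additive.

Let sigma_finite_step : sigma_finite setT lebesgue_rV_step.
Proof.
have /sigma_finiteP[F [TF ndF Foo]] := sigma_finiteT (@lebesgue_measure R).
have /sigma_finiteP[G [TG ndG Goo]] := sigma_finiteT mu.
exists (fun i => @rV_uncons R n @^-1` (F i `*` G i)).
  apply/esym/seteqP; split => // v _.
  have [i _ Fi] : (\bigcup_i F i) (rV_uncons v).1 by rewrite -TF.
  have [j _ Gj] : (\bigcup_i G i) (rV_uncons v).2 by rewrite -TG.
  exists (maxn i j) => //; split.
    by move: Fi; exact/subsetPset/ndF/leq_maxl.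
  by move: Gj; exact/subsetPset/ndG/leq_maxr.
move=> i; have [mF oF] := Foo i; have [mG oG] := Goo i; split.
  rewrite -[X in measurable X]setTI; apply: measurable_rV_uncons => //.
  exact: measurableX.
rewrite /lebesgue_rV_step /pushforward (_ : _ @^-1` _ = F i `*` G i).
  by rewrite product_measure1E// lte_mul_pinfty// ge0_fin_numE.
rewrite -comp_preimage (_ : _ \o _ = id)//.
by apply/funext => z; exact: rV_consK.
Qed.

HB.instance Definition _ := Measure_isSigmaFinite.Build _ _ _
  lebesgue_rV_step sigma_finite_step.

End step.

(* Lebesgue measure on R^n, by iterating the product with the Lebesgue measure
   of the line. *)
Fixpoint lebesgue_rV (n : nat) : {sigma_finite_measure set 'rV[R]_n -> \bar R} :=
  match n with
  | 0%N => [the {sigma_finite_measure set 'rV[R]_0 -> \bar R} of dirac (0 : 'rV[R]_0)]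
  | m.+1 => [the {sigma_finite_measure set 'rV[R]_m.+1 -> \bar R} of
              lebesgue_rV_step (lebesgue_rV m)]
  end.

End lebesgue_rV.

Section sobolev.
Variables (R : realType) (N : nat).
Local Notation E := 'rV[R]_N.
Local Notation mu := (lebesgue_rV R N).
Implicit Types (u v phi f g : E -> R) (s : seq 'I_N) (p : R).

(* |x| is the Euclidean norm; the library norm on 'rV is the sup norm. *)
Definition enorm (x : E) : R := Num.sqrt (\sum_(i < N) x ord0 i ^+ 2).

Definition Lp p : set (E -> R) := [set f | f \in Lfun mu p%:E].

Definition Lp_norm p f : \bar R := 'N[mu]_(p%:E)[EFin \o f].

Definition locally_integrable_rV v :=
  measurable_fun setT v /\
  forall K : set E, compact K -> mu.-integrable K (EFin \o v).

(* The iterated classical partial derivative along s = [:: i_1; ...; i_k]. *)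
Definition pderiv s phi : E -> R :=
  foldr (fun i g x => 'D_(delta_mx ord0 i) g x) phi s.

Definition test_function phi :=
  (forall s x, differentiable (pderiv s phi) x) /\
  compact (closure [set x | phi x != 0]).

Definition weak_derivative u s v :=
  locally_integrable_rV v /\
  forall phi, test_function phi ->
    \int[mu]_x (u x * pderiv s phi x) =
    (-1) ^+ size s * \int[mu]_x (v x * phi x).

(* A chosen representative of the (a.e. unique) weak derivative; meaningful
   only when a weak derivative exists. *)
Definition weakD s u : E -> R := get (weak_derivative u s).

Definition sobolev (k : nat) p : set (E -> R) :=
  [set u | Lp p u /\
    forall s, (size s <= k)%N -> exists2 v, Lp p v & weak_derivative u s v].

Definition grad_norm u (x : E) : R :=
  Num.sqrt (\sum_(i < N) weakD [:: i] u x ^+ 2).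

Definition hess_norm u (x : E) : R :=
  Num.sqrt (\sum_(i < N) \sum_(j < N) weakD [:: i; j] u x ^+ 2).

Definition laplacian u (x : E) : R := \sum_(i < N) weakD [:: i; i] u x.

End sobolev.

Section schroedinger.
Variables (R : realType) (N : nat) (alpha beta : R).
Local Notation E := 'rV[R]_N.

Definition diffusion (x : E) : R := 1 + enorm x `^ alpha.

Definition potential (x : E) : R := enorm x `^ beta.

Definition opA (u : E -> R) (x : E) : R :=
  diffusion x * laplacian u x - potential x * u x.

Definition domA (p : R) : set (E -> R) :=
  [set u | [/\ sobolev 2 p u,
    Lp p (fun x => diffusion x * hess_norm u x),
    Lp p (fun x => Num.sqrt (diffusion x) * grad_norm u x) &
    Lp p (fun x => potential x * u x)]].

End schroedinger.

(* Operators on L^p(R^N) act on representatives and are compared a.e.; only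
   their values on L^p functions (and at times t >= 0) matter. *)
Section semigroup.
Variables (R : realType) (N : nat) (p : R).
Local Notation E := 'rV[R]_N.
Local Notation mu := (lebesgue_rV R N).
Implicit Types (T : R -> (E -> R) -> (E -> R)) (f g : E -> R).

Record bounded_linear_Lp (S : (E -> R) -> (E -> R)) : Prop := {
  blin_Lp : forall f, Lp p f -> Lp p (S f) ;
  blin_ae : forall f g, Lp p f -> Lp p g ->
    f = g %[ae mu] -> S f = S g %[ae mu] ;
  blin_linear : forall (c : R) f g, Lp p f -> Lp p g ->
    S (fun x => c * f x + g x) = (fun x => c * S f x + S g x) %[ae mu] ;
  blin_bounded : exists M : R, forall f, Lp p f ->
    (Lp_norm p (S f) <= M%:E * Lp_norm p f)%E }.

Record C0_semigroup T : Prop := {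
  C0_bounded_linear : forall t, 0 <= t -> bounded_linear_Lp (T t) ;
  C0_id : forall f, Lp p f -> T 0 f = f %[ae mu] ;
  C0_add : forall s t f, 0 <= s -> 0 <= t -> Lp p f ->
    T (s + t) f = T s (T t f) %[ae mu] ;
  C0_cvg : forall f, Lp p f ->
    Lp_norm p (fun x => T t f x - f x) @[t --> 0^'+] --> 0%E }.

(* The operator A with domain D (a set of representatives) is the infinitesimal
   generator of T: f is in D and A f = g exactly when (T(h)f - f)/h tends to g
   in L^p as h -> 0+. *)
Definition generates (D : set (E -> R)) (A : (E -> R) -> (E -> R)) T :=
  forall f g, Lp p f -> Lp p g ->
    (D f /\ A f = g %[ae mu]) <->
    Lp_norm p (fun x => h^-1 * (T h f x - f x) - g x) @[h --> 0^'+] --> 0%E.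

Definition continuous_representative f g := continuous g /\ g = f %[ae mu].

(* T(t)f > 0 everywhere is understood for the continuous representative. *)
Definition irreducible T :=
  forall f, Lp p f -> (\forall x \ae mu, 0 <= f x) -> ~ (f = cst 0 %[ae mu]) ->
  forall t, 0 < t ->
    exists2 g, continuous_representative (T t f) g & forall x, 0 < g x.

End semigroup.

(* Main.v *)
(** Write a = 1 + |x|^alpha and V = |x|^beta.  In the norm N(u) = |u^+| of
    L^p(dx / a) the weight cancels the coefficient of the Laplacian and
    N(u) <= N(u - h A u) for u in D(A_p): it is enough that
    int Delta u (u^+)^(p-1) <= 0, and this follows, by approximating Delta u with
    second differences, from Young's inequality and translation invariance.
    Feeding a C^2_c family v(s) with v' <= A v and z(s) = v(s) - T(s) phi into this
    estimate along a fine time grid shows that N(z) does not increase, hence the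
    comparison principle: v(0) <= f implies v(t) <= T(t) f.  With v = 0 this gives
    positivity, and with the spreading bump
    v(s, x) = k e^(-K s) (rho + c s - |x - x0|^2)_+^3 it gives, c being arbitrary,
    strict positivity everywhere as soon as T(s) f is positive at one point. *)
Require Import Defs.
From mathcomp Require Import all_boot all_order all_algebra.
From mathcomp Require Import all_classical all_reals all_analysis.
From mathcomp Require Import measurable_realfun.
From mathcomp Require Import ring lra.
Import Order.TTheory GRing.Theory Num.Theory.
Import numFieldNormedType.Exports.
Set Implicit Arguments.
Unset Strict Implicit.
Unset Printing Implicit Defensive.
Local Open Scope classical_set_scope.
Local Open Scope ring_scope.

(** * The space L^p *)

(** The estimate on N bounds an implicit Euler step, so on each time step the derivative of v is
    taken at the right end. The error of a step is a remainder at time 0 transported by T(s). The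
    semigroup axioms bound T(s) only at each fixed s, whereas summing the errors needs a bound
    uniform on [0, tau]; hence the completeness of L^p and the uniform boundedness argument. The
    datum is first a test function, so that T(s) phi stays in the domain; density then reaches every
    f. For the bump, put w = (rho + c s - |x - x0|^2)_+. The Laplacian of w^3 contains 24 |x - x0|^2
    w, of first order in w, and |x - x0|^2 is at least nearly rho where w is small. Moving the front
    costs only 3 c w^2, and where w is large the decay K w^3 takes over. So every speed c is
    admissible. *)

Section Lp_toolkit.
Context d (X : measurableType d) (R : realType).
Variable mu : {measure set X -> \bar R}.
Implicit Types (f g : X -> R) (p q c : R).

(** Stated for an arbitrary measure; at [lebesgue_rV R N] it is convertible to [Lp]. *)
Definition Lpf p : set (X -> R) := [set f | f \in Lfun mu p%:E].

(** A real-valued norm, so that real arithmetic and [lra] apply. [fine] sends an infinite norm to 0,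
    which is why the lemmas carry membership in [Lpf]. *)
Definition Lpn p f : R := fine 'N[mu]_(p%:E)[EFin \o f]%E.

Lemma Lpf_meas p f : Lpf p f -> measurable_fun setT f.
Proof. by move=> /andP[+ _]; rewrite inE. Qed.

Lemma measurable_normpow p f : measurable_fun setT f ->
  measurable_fun setT (fun x => `|f x| `^ p).
Proof.
move=> mf; apply: (measurableT_comp (measurable_powR _)).
exact: measurableT_comp.
Qed.

Lemma LpfP p f : 1 <= p -> Lpf p f <->
  measurable_fun setT f /\ mu.-integrable setT (fun x => (`|f x| `^ p)%:E).
Proof.
move=> p1; split=> [Lf|[mf intf]].
  by split; [exact: Lpf_meas Lf|exact: Lfun_integrable].
apply/andP; split; rewrite inE//= /finite_norm.
rewrite unlock; apply: poweR_lty.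
case/integrableP : intf => _; apply: le_lt_trans.
by under [leRHS]eq_integral do rewrite gee0_abs ?lee_fin ?powR_ge0//.
Qed.

Lemma LpnE p f : Lpf p f -> (Lpn p f)%:E = 'N[mu]_(p%:E)[EFin \o f]%E.
Proof.
move=> /andP[_]; rewrite inE /= /finite_norm => fin.
by rewrite fineK// ge0_fin_numE// Lnorm_ge0.
Qed.

Lemma Lpn_ge0 p f : 0 <= Lpn p f.
Proof. by rewrite fine_ge0// Lnorm_ge0. Qed.

Lemma Lpn_powR p f : 1 <= p -> Lpf p f ->
  Lpn p f `^ p = \int[mu]_x (`|f x| `^ p).
Proof.
move=> p1 Lf; rewrite /Rintegral.
have p0 : p != 0 by rewrite gt_eqF// (lt_le_trans _ p1).
have := powR_Lnorm mu (EFin \o f) p0.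
rewrite -LpnE//= => /(congr1 fine) /= ->.
by congr fine; apply: eq_integral.
Qed.

Lemma Lpf_le p f g : 1 <= p -> measurable_fun setT f -> Lpf p g ->
  {ae mu, forall x, `|f x| <= `|g x|} -> Lpf p f.
Proof.
move=> p1 mf Lg fg; apply/LpfP => //; split => //.
have [mg intg] := (LpfP g p1).1 Lg.
apply/integrableP; split; first exact/measurable_EFinP/measurable_normpow.
case/integrableP : intg => _; apply: le_lt_trans.
apply: ae_ge0_le_integral => //.
- by apply/measurableT_comp/measurable_EFinP/measurable_normpow.
- by apply/measurableT_comp/measurable_EFinP/measurable_normpow.
- apply: filterS fg => x fgx _; rewrite /= lee_fin !(ger0_norm (powR_ge0 _ _)).
  by apply: ge0_ler_powR; rewrite ?nnegrE ?(le_trans _ p1).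
Qed.

Lemma Lpn_le p f g : 1 <= p -> Lpf p f -> Lpf p g ->
  {ae mu, forall x, `|f x| <= `|g x|} -> Lpn p f <= Lpn p g.
Proof.
move=> p1 Lf Lg fg.
have p0 : 0 < p by rewrite (lt_le_trans _ p1).
have : Lpn p f `^ p <= Lpn p g `^ p.
  rewrite (Lpn_powR p1 Lf) (Lpn_powR p1 Lg) /Rintegral; apply: fine_le.
  - by apply: integrable_fin_num => //; have [] := (LpfP f p1).1 Lf.
  - by apply: integrable_fin_num => //; have [] := (LpfP g p1).1 Lg.
  - apply: ae_ge0_le_integral => //.
    + by apply/measurable_EFinP/measurable_normpow; exact: Lpf_meas Lf.
    + by apply/measurable_EFinP/measurable_normpow; exact: Lpf_meas Lg.
    + apply: filterS fg => x fgx _; rewrite lee_fin.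
      by apply: ge0_ler_powR; rewrite ?nnegrE ?(ltW p0).
by apply: contraTT; rewrite -!ltNge => fg'; rewrite gt0_ltr_powR// nnegrE Lpn_ge0.
Qed.

Lemma ae_eq_Lpn p f g : 1 <= p -> Lpf p f -> Lpf p g ->
  f = g %[ae mu] -> Lpn p f = Lpn p g.
Proof.
move=> p1 Lf Lg fg; apply/le_anti; rewrite !Lpn_le//.
- by apply: filterS fg => x /(_ I) ->.
- by apply: filterS fg => x /(_ I) ->.
Qed.

Lemma ae_eq_Lpf p f g : 1 <= p -> measurable_fun setT f ->
  f = g %[ae mu] -> Lpf p g -> Lpf p f.
Proof.
by move=> p1 mf fg Lg; apply: (Lpf_le p1 mf Lg); apply: filterS fg => x /(_ I) ->.
Qed.

Lemma Lpf0 p : 1 <= p -> Lpf p (fun=> 0).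
Proof.
move=> p1; have p1' : (1 <= p%:E)%E by rewrite lee_fin.
have -> : (fun=> 0) = (cst 0 : X -> R) by [].
exact: LfunP (cst 0 : LfunType mu p1').
Qed.

Lemma LpfD p f g : 1 <= p -> Lpf p f -> Lpf p g -> Lpf p (fun x => f x + g x).
Proof.
move=> p1; have p1' : (1 <= p%:E)%E by rewrite lee_fin.
by move=> Lf Lg; exact: (Lfun_addr_closed mu p1').2 Lf Lg.
Qed.

Lemma LpfZ p c f : 1 <= p -> Lpf p f -> Lpf p (fun x => c * f x).
Proof.
move=> p1 Lf; apply/LpfP => //; split.
  by apply: measurable_funM => //; exact: Lpf_meas Lf.
have [mf intf] := (LpfP f p1).1 Lf.
under eq_fun do rewrite normrM powRM// EFinM.
exact: integrableZl.
Qed.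

Lemma LpfN p f : 1 <= p -> Lpf p f -> Lpf p (fun x => - f x).
Proof.
by move=> p1 Lf; under eq_fun do rewrite -mulN1r; exact: LpfZ.
Qed.

Lemma LpfB p f g : 1 <= p -> Lpf p f -> Lpf p g -> Lpf p (fun x => f x - g x).
Proof. by move=> p1 Lf Lg; apply: LpfD => //; exact: LpfN. Qed.

Lemma Lpf_norm p f : 1 <= p -> Lpf p f -> Lpf p (fun x => `|f x|).
Proof.
move=> p1 Lf; apply: (Lpf_le p1 _ Lf).
  by apply: measurableT_comp => //; exact: Lpf_meas Lf.
by apply: aeW => x; rewrite normr_id.
Qed.

Lemma Lpn0 p : 1 <= p -> Lpn p (fun=> 0) = 0.
Proof.
move=> p1; have -> : (fun=> 0) = (cst 0 : X -> R) by [].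
by rewrite /Lpn (_ : _ \o _ = cst 0%E)// Lnorm0// gt_eqF// lte_fin (lt_le_trans _ p1).
Qed.

Lemma LpnD p f g : 1 <= p -> Lpf p f -> Lpf p g ->
  Lpn p (fun x => f x + g x) <= Lpn p f + Lpn p g.
Proof.
move=> p1 Lf Lg; rewrite -lee_fin EFinD !LpnE//; last exact: LpfD.
by apply: minkowski_EFin => //; [exact: Lpf_meas Lf|exact: Lpf_meas Lg].
Qed.

Lemma LpnZ p c f : 1 <= p -> Lpf p f -> Lpn p (fun x => c * f x) = `|c| * Lpn p f.
Proof.
move=> p1; have p1' : (1 <= p%:E)%E by rewrite lee_fin.
move=> Lf; rewrite /Lpn.
have := LnormZ (Lfun_Sub p1' Lf) c => /= H.
by rewrite (_ : 'N[mu]_p%:E[EFin \o (fun x => (c * f x)%R)] = `|c|%:E * 'N[mu]_p%:E[EFin \o f])%E//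
  fineM// -?LpnE.
Qed.

Lemma LpnN p f : 1 <= p -> Lpf p f -> Lpn p (fun x => - f x) = Lpn p f.
Proof.
move=> p1 Lf; under eq_fun do rewrite -mulN1r.
by rewrite LpnZ// normrN1 mul1r.
Qed.

Lemma LpnB p f g : 1 <= p -> Lpf p f -> Lpf p g ->
  Lpn p (fun x => f x - g x) <= Lpn p f + Lpn p g.
Proof. by move=> p1 Lf Lg; rewrite -(LpnN p1 Lg) LpnD//; exact: LpfN. Qed.

Lemma Lpn_distC p f g : 1 <= p -> Lpf p f -> Lpf p g ->
  Lpn p (fun x => f x - g x) = Lpn p (fun x => g x - f x).
Proof.
move=> p1 Lf Lg; rewrite -[LHS]LpnN//; last exact: LpfB.
by under eq_fun do rewrite opprB.
Qed.

Lemma Lpn_distD p f g h : 1 <= p -> Lpf p f -> Lpf p g -> Lpf p h ->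
  Lpn p (fun x => f x - h x) <= Lpn p (fun x => f x - g x) + Lpn p (fun x => g x - h x).
Proof.
move=> p1 Lf Lg Lh.
rewrite (_ : (fun x => f x - h x) = (fun x => (f x - g x) + (g x - h x))).
  by apply: LpnD => //; exact: LpfB.
by apply/funext => x; rewrite addrA subrK.
Qed.

Lemma Lpn_eq0 p f : 1 <= p -> Lpf p f -> Lpn p f = 0 -> f = (fun=> 0) %[ae mu].
Proof.
move=> p1 Lf f0; have /Lnorm_eq0_eq0 : ('N[mu]_p%:E[EFin \o f] = 0)%E.
  by rewrite -LpnE// f0.
have mf : measurable_fun setT (EFin \o f) by apply/measurable_EFinP; exact: Lpf_meas Lf.
move=> /(_ mf); rewrite lte_fin (lt_le_trans _ p1)// => /(_ isT).
by apply: filterS => x /= + _ => /(_ I) [].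
Qed.

Lemma Lp_hoelder p q f g : 1 < p -> 1 < q -> p^-1 + q^-1 = 1 ->
  Lpf p f -> Lpf q g ->
  mu.-integrable setT (EFin \o (fun x => f x * g x)) /\
  `|\int[mu]_x (f x * g x)| <= Lpn p f * Lpn q g.
Proof.
move=> p1 q1 pq Lf Lg.
have [mf mg] := (Lpf_meas Lf, Lpf_meas Lg).
have H := hoelder mu mf mg (lt_trans ltr01 p1) (lt_trans ltr01 q1) pq.
have i : mu.-integrable setT (EFin \o (fun x => f x * g x)).
  apply/integrableP; split; first exact/measurable_EFinP/measurable_funM.
  rewrite Lnorm1 in H; apply: (le_lt_trans H).
  by rewrite -!LpnE// -EFinM ltry.
split=> //; apply: (le_trans (le_normr_Rintegral measurableT i)).
rewrite -lee_fin EFinM !LpnE//; apply: le_trans H.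
rewrite Lnorm1 /Rintegral fineK//; apply: integrable_fin_num => //.
exact: integrable_norm i.
Qed.

Lemma integrable_realD f g : mu.-integrable setT (EFin \o f) ->
  mu.-integrable setT (EFin \o g) -> mu.-integrable setT (EFin \o (fun x => f x + g x)).
Proof. by move=> h1 h2; have := integrableD measurableT h1 h2. Qed.

Lemma integrable_realZ c f : mu.-integrable setT (EFin \o f) ->
  mu.-integrable setT (EFin \o (fun x => c * f x)).
Proof. by move=> h; have := integrableZl measurableT c h. Qed.

Lemma integrable_realB f g : mu.-integrable setT (EFin \o f) ->
  mu.-integrable setT (EFin \o g) -> mu.-integrable setT (EFin \o (fun x => f x - g x)).
Proof. by move=> h1 h2; have := integrableB measurableT h1 h2. Qed.

End Lp_toolkit.

(** * Translations and cubes in R^N *)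

Section rV_geometry.
Context (R : realType).

Lemma coord_le_norm (N : nat) (x : 'rV[R]_N) i : `|x ord0 i| <= `|x|.
Proof.
have /mapP[j Hj ->] : `|x ord0 i| \in [seq `|x v.1 v.2| | v : 'I_1 * 'I_N].
  by apply/mapP; exists (ord0, i) => //=; rewrite mem_enum.
by rewrite [leRHS]/Num.norm /= mx_normrE; apply/bigmax_geP; right => /=; exists j.
Qed.

Lemma rV_ballP (N : nat) (x y : 'rV[R]_N) e :
  ball x e y <-> 0 < e /\ forall i, `|x ord0 i - y ord0 i| < e.
Proof.
split=> [[e0 h]|[e0 h]]; split => //.
  by move=> i; have := h ord0 i.
by move=> i j; rewrite ord1; exact: h.
Qed.

(** The bounds are indexed by [nat] and not by ['I_N], so that an induction on the dimension can
    shift them. *)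
Definition box (N : nat) (a b : nat -> R) : set 'rV[R]_N :=
  [set x | forall i : 'I_N, a i < x ord0 i < b i].

Lemma box_coord N (a b : nat -> R) : box (N := N) a b =
  \bigcap_(i in [set: 'I_N]) (@rV_coord R N i @^-1` `]a i, b i[%classic).
Proof.
apply/seteqP; split => x /= H i; first by move=> _ /=; rewrite in_itv/=; exact: H.
by have := H i I; rewrite /= in_itv.
Qed.

Lemma measurable_box N a b : measurable (box (N := N) a b).
Proof.
rewrite box_coord; apply: fin_bigcap_measurable => // i _.
by rewrite -[X in measurable X]setTI; apply: measurable_rV_coord.
Qed.

Lemma boxI N (a b c d : nat -> R) : box (N := N) a b `&` box c d =
  box (fun i => Num.max (a i) (c i)) (fun i => Num.min (b i) (d i)).
Proof.
apply/seteqP; split => x.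
  move=> [h1 h2] i; rewrite gt_max lt_min.
  by have /andP[-> ->] := h1 i; have /andP[-> ->] := h2 i.
move=> h; split => i; have := h i; rewrite gt_max lt_min.
  by move=> /andP[/andP[-> _] /andP[-> _]].
by move=> /andP[/andP[_ ->] /andP[_ ->]].
Qed.

(** Balls of the sup norm are boxes, so an open set is the union of the boxes with rational corners
    that it contains, of which there are countably many. This links the topology with the
    sigma-algebra generated by the coordinates. *)
Lemma open_measurable_rV N (U : set 'rV[R]_N) : open U -> measurable U.
Proof.
move=> oU.
pose bx (z : {ffun 'I_N -> rat} * {ffun 'I_N -> rat}) : set 'rV[R]_N :=
  [set x | forall i, ratr (z.1 i) < x ord0 i < ratr (z.2 i)].
pose F z := if `[< bx z `<=` U >] then bx z else set0.
have -> : U = \bigcup_z F z.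
  apply/seteqP; split => x; last first.
    by move=> [z _]; rewrite /F; case: ifPn => // /asboolP; apply.
  move=> Ux; have /nbhs_ballP[e e0 eU] := open_nbhs_nbhs (conj oU Ux).
  have /choice[q1 h1] : forall i, exists q : rat,
      ratr q \in `](x ord0 i - e), (x ord0 i)[.
    by move=> i; apply: rat_in_itvoo; rewrite ltrBlDr ltrDl.
  have /choice[q2 h2] : forall i, exists q : rat,
      ratr q \in `](x ord0 i), (x ord0 i + e)[.
    by move=> i; apply: rat_in_itvoo; rewrite ltrDl.
  exists ([ffun i => q1 i], [ffun i => q2 i]) => //.
  rewrite /F asboolT => /=.
    move=> i; rewrite /= !ffunE.
    by have := h1 i; have := h2 i; rewrite !in_itv/= => /andP[-> _] /andP[_ ->].
  move=> y /= hy; apply: eU; apply/rV_ballP; split => // i.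
  have := hy i; rewrite !ffunE; have := h1 i; have := h2 i; rewrite !in_itv/=.
  by move=> /andP[? ?] /andP[? ?] /andP[? ?]; rewrite ltr_norml; apply/andP; split; lra.
apply: countable_bigcupT_measurable => // z; rewrite /F; case: ifP => // _.
rewrite (_ : bx z = \bigcap_(i in [set: 'I_N])
  (@rV_coord R N i @^-1` `](ratr (z.1 i)), (ratr (z.2 i))[%classic)).
  apply: fin_bigcap_measurable => // i _.
  by rewrite -[X in measurable X]setTI; apply: measurable_rV_coord.
apply/seteqP; split => x /= H i; first by move=> _ /=; rewrite in_itv/=; exact: H.
by have := H i I; rewrite /= in_itv.
Qed.

Lemma closed_measurable_rV N (U : set 'rV[R]_N) : closed U -> measurable U.
Proof.
move=> cU; have oU : open (~` U) by rewrite openC.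
by rewrite -(setCK U); apply: measurableC; exact: open_measurable_rV.
Qed.

Lemma compact_measurable_rV N (U : set 'rV[R]_N) : compact U -> measurable U.
Proof.
by move=> cU; apply: closed_measurable_rV; apply: compact_closed => //; exact: norm_hausdorff.
Qed.

Lemma continuous_measurable_rV N (f : 'rV[R]_N -> R) :
  continuous f -> measurable_fun setT f.
Proof.
move=> /continuousP cf.
apply: (measurability (@RGenOpens.G R)); first exact: RGenOpens.measurableE.
move=> _ [_ [a [b ->]] <-]; rewrite setTI; apply: open_measurable_rV.
by apply: cf; exact: interval_open.
Qed.

Lemma rV_cons0 N (z : measurableTypeR R * 'rV[R]_N) : rV_cons z ord0 ord0 = z.1.
Proof. exact: (congr1 fst (rV_consK z)). Qed.

Lemma rV_consS N (z : measurableTypeR R * 'rV[R]_N) i :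
  rV_cons z ord0 (lift ord0 i) = z.2 ord0 i.
Proof.
have -> : lift ord0 i = rshift 1 i by apply/val_inj.
exact: row_mxEr.
Qed.

Lemma box_measure N (a b : nat -> R) : (forall i, a i < b i) ->
  (0 < lebesgue_rV R N (box a b) < +oo)%E.
Proof.
elim: N a b => [|N IH] a b ab.
  rewrite /= diracE mem_set ?ltry ?andbT ?lte_fin//.
  by case.
change (0 < (@lebesgue_measure R \x lebesgue_rV R N)%E (@rV_cons R N @^-1` box a b) < +oo)%E.
have -> : @rV_cons R N @^-1` box (N := N.+1) a b =
    `]a 0%N, b 0%N[%classic `*` box (N := N) (fun i => a i.+1) (fun i => b i.+1).
  apply/seteqP; split => [[x v]|[x v]]/=.
    move=> h; split; first by have := h ord0; rewrite in_itv/= rV_cons0.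
    by move=> i; have := h (lift ord0 i); rewrite rV_consS.
  move=> [+ h]; rewrite in_itv/= => h0 i.
  have [j ->|->] := unliftP ord0 i; last by rewrite rV_cons0.
  by rewrite rV_consS; exact: h.
rewrite product_measure1E//=; last exact: measurable_box.
have /andP[h1 h2] := IH (fun i => a i.+1) (fun i => b i.+1) (fun i => ab i.+1).
rewrite lebesgue_measure_itv/= lte_fin ab -EFinD.
rewrite mule_gt0 ?lte_fin ?subr_gt0//=.
by rewrite lte_mul_pinfty// lee_fin subr_ge0 ltW.
Qed.

Lemma lebesgue_measure_translate (c : R) (A : set R) : measurable A ->
  pushforward (@lebesgue_measure R) (fun x : measurableTypeR R => x + c : measurableTypeR R) A =
  lebesgue_measure A.
Proof.
move=> mA; apply/esym.
have mf : measurable_fun setT (fun x : measurableTypeR R => x + c : measurableTypeR R).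
  by apply: measurable_funD.
have := @lebesgue_measure_unique R (pushforward (@lebesgue_measure R) (fun x : measurableTypeR R => x + c : measurableTypeR R)).
apply=> // Y [[x y] _ <-] /=.
rewrite /pushforward (_ : _ @^-1` _ = `]x - c, y - c]%classic).
  by rewrite !lebesgue_measure_itv/= !lte_fin ltrD2r -!EFinB; case: ifP => // _; congr _%:E; ring.
by apply/seteqP; split => z /=; rewrite !in_itv/= ltrBlDr lerBrDr.
Qed.

Lemma measurable_translate N (v : 'rV[R]_N) : measurable_fun setT (fun x : 'rV[R]_N => x + v).
Proof.
apply: measurable_fun_rVP => i.
rewrite (_ : _ \o _ = (fun x => @rV_coord R N i x + v ord0 i)).
  by apply: measurable_funD => //; exact: measurable_rV_coord.
by apply/funext => x; rewrite /rV_coord /= mxE.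
Qed.

(** Induction on the dimension: through [rV_cons] a translation becomes a product of two
    translations, and a product measure is determined by its values on rectangles. *)
Lemma lebesgue_rV_translate N (v : 'rV[R]_N) (A : set 'rV[R]_N) : measurable A ->
  lebesgue_rV R N ((fun x => x + v) @^-1` A) = lebesgue_rV R N A.
Proof.
elim: N v A => [|N IH] v A mA.
  congr (lebesgue_rV R 0 _); apply/seteqP; split => x /=.
    by rewrite (_ : x + v = x)//; apply/rowP => -[].
  by rewrite (_ : x + v = x)//; apply/rowP => -[].
pose c := v ord0 ord0; pose w : 'rV[R]_N := rsubmx (v : 'rV[R]_(1 + N)).
pose tau (z : measurableTypeR R * 'rV[R]_N) : measurableTypeR R * 'rV[R]_N :=
  (z.1 + c : measurableTypeR R, z.2 + w).
have mtau : measurable_fun setT tau.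
  apply/measurable_fun_pairP; split.
    by apply: measurable_funD => //; exact: measurable_fst.
  by apply: (measurableT_comp (measurable_translate w)); exact: measurable_snd.
change ((@lebesgue_measure R \x lebesgue_rV R N)%E (@rV_cons R N @^-1` ((fun x => x + v) @^-1` A)) =
  (@lebesgue_measure R \x lebesgue_rV R N)%E (@rV_cons R N @^-1` A)).
have -> : @rV_cons R N @^-1` ((fun x => x + v) @^-1` A) = tau @^-1` (@rV_cons R N @^-1` A).
  have key z : rV_cons z + v = rV_cons (tau z).
    apply/rowP => i; rewrite mxE.
    have [j ->|->] := unliftP ord0 i; last by rewrite !rV_cons0.
    rewrite !rV_consS mxE; congr (_ + _); rewrite mxE; congr (v _ _).
    exact/val_inj.
  by apply/seteqP; split => z; rewrite /preimage/= key.
have mB : measurable (@rV_cons R N @^-1` A).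
  by rewrite -[X in measurable X]setTI; exact: measurable_rV_cons.
set B := _ @^-1` A in mB *.
have H := @product_measure_unique _ _ _ _ R (@lebesgue_measure R) (lebesgue_rV R N)
  (pushforward (@lebesgue_measure R \x lebesgue_rV R N)%E tau).
apply/esym; apply: (H mtau _ B mB) => A1 A2 mA1 mA2; rewrite /pushforward.
change ((@lebesgue_measure R \x lebesgue_rV R N)%E
  (((fun x : measurableTypeR R => x + c : measurableTypeR R) @^-1` A1) `*`
   ((fun x => x + w) @^-1` A2)) = (lebesgue_measure A1 * lebesgue_rV R N A2)%E).
rewrite product_measure1E.
- by rewrite IH//; congr (_ * _)%E; exact: lebesgue_measure_translate.
- by rewrite -[X in measurable X]setTI; apply: measurable_funD => //.
- by rewrite -[X in measurable X]setTI; apply: measurable_translate.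
Qed.

End rV_geometry.

(** * Translation invariance of integrals and L^p norms *)

Section translation_integral.
Context (R : realType) (N : nat).
Local Notation E := 'rV[R]_N.
Local Notation mu := (lebesgue_rV R N).
Implicit Types (f g : E -> R) (v : E) (p : R).

Lemma ge0_integral_translate (f : E -> \bar R) v : measurable_fun setT f ->
  (forall x, 0 <= f x)%E -> (\int[mu]_x f (x + v)%R = \int[mu]_x f x)%E.
Proof.
move=> mf f0.
have := @ge0_integral_pushforward _ _ _ _ R _ (measurable_translate v) mu setT f
  measurableT mf (fun x _ => f0 x).
rewrite preimage_setT => <-.
apply: (eq_measure_integral mu); first exact: measurable_translate.
by move=> ? A mA _; exact: (lebesgue_rV_translate v mA).
Qed.

Lemma integrable_translate (f : E -> \bar R) v : mu.-integrable setT f ->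
  mu.-integrable setT (fun x => f (x + v)).
Proof.
case/integrableP => mf intf; apply/integrableP; split.
  exact: (measurableT_comp mf (measurable_translate v)).
rewrite (ge0_integral_translate v (f := fun x => `|f x|%E))//.
exact: measurableT_comp.
Qed.

Lemma integral_translate (f : E -> \bar R) v : mu.-integrable setT f ->
  (\int[mu]_x f (x + v)%R = \int[mu]_x f x)%E.
Proof.
move=> intf; have mf := measurable_int mu intf.
have := @integral_pushforward _ _ _ _ R _ (measurable_translate v) mu setT f mf.
rewrite preimage_setT => /(_ (integrable_translate v intf) measurableT) <-.
apply: (eq_measure_integral mu); first exact: measurable_translate.
by move=> ? A mA _; exact: (lebesgue_rV_translate v mA).
Qed.

Lemma Rintegral_translate f v : mu.-integrable setT (EFin \o f) ->
  \int[mu]_x f (x + v) = \int[mu]_x f x.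
Proof. by move=> intf; congr fine; exact: (integral_translate v intf). Qed.

Lemma Lpf_translate p f v : 1 <= p -> Lpf mu p f -> Lpf mu p (fun x => f (x + v)).
Proof.
move=> p1 /(LpfP mu _ p1)[mf intf]; apply/LpfP => //; split.
  exact: (measurableT_comp mf (measurable_translate v)).
exact: (integrable_translate v intf).
Qed.

Lemma Lpn_translate p f v : measurable_fun setT f ->
  Lpn mu p (fun x => f (x + v)) = Lpn mu p f.
Proof.
move=> mf; rewrite /Lpn unlock; rewrite (ge0_integral_translate v (f := fun x => (`|(f x)%:E| `^ p)%E))//.
  by apply/measurable_EFinP; exact: measurable_normpow.
by move=> x; exact: poweR_ge0.
Qed.

End translation_integral.

(** * Cubes, bounded support and local integrability *)

Section bounded_support.
Context (R : realType) (N : nat).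
Local Notation E := 'rV[R]_N.
Local Notation mu := (lebesgue_rV R N).
Implicit Types (f g : E -> R) (p M C : R).

Definition cube M : set E := [set x | `|x| < M].

Lemma measurable_cube M : measurable (cube M).
Proof.
apply: open_measurable_rV; rewrite (_ : cube M = (fun x : E => `|x|) @^-1` `]-oo, M[%classic).
  by apply: open_comp => [x _|]; [exact: norm_continuous|exact: interval_open].
by apply/seteqP; split => x; rewrite /cube /= in_itv.
Qed.

Lemma cube_box M : cube M `<=` box (fun=> - M) (fun=> M).
Proof.
by move=> x xM i; rewrite -ltr_norml; exact: le_lt_trans (coord_le_norm x i) xM.
Qed.

Lemma cube_fin M : (mu (cube M) < +oo)%E.
Proof.
have [M0|M0] := leP M 0.
  rewrite (_ : cube M = set0) ?measure0 ?ltry//.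
  apply/seteqP; split => x //; rewrite /cube/= => xM.
  by have := lt_le_trans xM M0; rewrite ltNge normr_ge0.
apply: le_lt_trans (le_measure mu _ _ (@cube_box M)) _; rewrite ?inE.
- exact: measurable_cube.
- exact: measurable_box.
have MM (i : nat) : - M < M by rewrite gtrN.
by have /andP[] := @box_measure R N (fun=> - M) (fun=> M) MM.
Qed.

Definition supported_in M f := forall x, M <= `|x| -> f x = 0.

Lemma Lpf_indic_cube p M : 1 <= p -> Lpf mu p (\1_(cube M)).
Proof.
move=> p1; apply/LpfP => //; split; first exact: measurable_indic (measurable_cube M).
rewrite (_ : (fun x => _) = EFin \o \1_(cube M)).
  apply/integrableP; split.
    by apply/measurable_EFinP; apply: measurable_indic; exact: measurable_cube.
  under eq_integral do rewrite gee0_abs ?lee_fin//.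
  by rewrite integral_indic ?setIT//; [exact: cube_fin|exact: measurable_cube].
apply/funext => x /=; rewrite indicE; case: (x \in cube M); rewrite ?normr1 ?powR1//.
by rewrite normr0 powR0// gt_eqF// (lt_le_trans _ p1).
Qed.

Lemma bounded_supported_Lpf p M C f : 1 <= p -> measurable_fun setT f ->
  (forall x, `|f x| <= C) -> supported_in M f -> Lpf mu p f.
Proof.
move=> p1 mf fC fM; apply: (Lpf_le p1 mf (LpfZ C p1 (Lpf_indic_cube M p1))).
apply: aeW => x; rewrite indicE; have [xM|xM] := ltP `|x| M.
  by rewrite mem_set// mulr1 (le_trans (fC x))// ler_norm.
by rewrite fM// normr0.
Qed.

Lemma bounded_supported_Lpn p M C f : 1 <= p -> 0 <= C -> measurable_fun setT f ->
  (forall x, `|f x| <= C) -> supported_in M f ->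
  Lpn mu p f <= C * Lpn mu p (\1_(cube M)).
Proof.
move=> p1 C0 mf fC fM; have h := Lpf_indic_cube M p1.
rewrite -[C in leRHS]ger0_norm// -LpnZ//; apply: Lpn_le => //.
- exact: bounded_supported_Lpf fC fM.
- exact: LpfZ.
apply: aeW => x; rewrite indicE; have [xM|xM] := ltP `|x| M.
  by rewrite mem_set// mulr1 (le_trans (fC x))// ler_norm.
by rewrite fM// normr0.
Qed.

Lemma Lpf1_integrable f : Lpf mu 1 f -> mu.-integrable setT (EFin \o f).
Proof. by move=> /Lfun1_integrable. Qed.

Lemma bounded_supported_integrable M C f : measurable_fun setT f ->
  (forall x, `|f x| <= C) -> supported_in M f -> mu.-integrable setT (EFin \o f).
Proof.
by move=> mf fC fM; apply: Lpf1_integrable; exact: bounded_supported_Lpf fC fM.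
Qed.

Lemma compact_closed_cube M : compact [set x : E | `|x| <= M].
Proof.
apply: bounded_closed_compact.
  exists M; split; first exact: num_real.
  by move=> r Mr x /= /le_trans; apply; exact: ltW.
rewrite (_ : mkset _ = (fun x : E => `|x|) @^-1` `]-oo, M]%classic).
  by apply: closed_comp => [x _|]; [exact: norm_continuous|exact: interval_closed].
by apply/seteqP; split => x /=; rewrite in_itv.
Qed.

Lemma compact_cube (K : set E) : compact K -> exists2 M, 0 < M & K `<=` cube M.
Proof.
move=> /compact_bounded[M [Mr h]]; exists (Num.max M 0 + 2); first by rewrite ltr_wpDl// le_max lexx orbT.
move=> x Kx; rewrite /cube/=; apply: le_lt_trans (h (Num.max M 0 + 1) _ x Kx) _.
  by rewrite ltr_pwDr// le_max lexx.
by rewrite ltrD2l ltr1n.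
Qed.

Lemma continuous_supported_bounded M f : continuous f -> supported_in M f ->
  exists C, forall x, `|f x| <= C.
Proof.
move=> cf fM.
have cK := @compact_closed_cube M.
have /compact_bounded[C [Cr h]] : compact (f @` [set x : E | `|x| <= M]).
  by apply: continuous_compact => //; exact: continuous_subspaceT.
exists (Num.max C 0 + 1) => x; have [xM|xM] := leP `|x| M.
  by apply: h; [rewrite ltr_pwDr// le_max lexx|exists x].
by rewrite fM ?(ltW xM)// normr0 addr_ge0// le_max lexx orbT.
Qed.

(** Cubes suffice: each compact set lies in an open cube, and each open cube lies in a compact
    one. *)
Lemma locally_integrableP f : locally_integrable_rV f <->
  measurable_fun setT f /\ forall M, mu.-integrable (cube M) (EFin \o f).
Proof.
split=> [[mf h]|[mf h]]; split => //.
  move=> M; have cK := @compact_closed_cube M.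
  apply: (integrableS (compact_measurable_rV cK) (measurable_cube M) _ (h _ cK)).
  by move=> x; exact: ltW.
move=> K cK; have [M _ KM] := compact_cube cK.
exact: (integrableS (measurable_cube M) (compact_measurable_rV cK) KM).
Qed.

Lemma integrable_mul_supported M C f g : locally_integrable_rV f ->
  measurable_fun setT g -> (forall x, `|g x| <= C) -> supported_in M g ->
  mu.-integrable setT (EFin \o (fun x => f x * g x)).
Proof.
move=> /locally_integrableP[mf /(_ M) intf] mg gC gM.
have mc := measurable_cube M.
have i : mu.-integrable setT (fun x => (C * `|(f \_ (cube M)) x|)%:E).
  under eq_fun do rewrite EFinM.
  apply: integrableZl => //.
  apply: (@integrable_norm _ _ _ mu setT (f \_ (cube M))).
  by rewrite -restrict_EFin -integrable_mkcond.
apply: (le_integrable measurableT _ _ i).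
  by apply/measurable_EFinP/measurable_funM.
move=> x _; rewrite /= lee_fin normrM patchE.
have C0 : 0 <= C by apply: le_trans (gC x).
have [xM|xM] := ltP `|x| M.
  rewrite mem_set//= mulrC normrM normr_id (ger0_norm C0).
  by rewrite ler_wpM2r.
by rewrite gM// normr0 mulr0 normr_ge0.
Qed.

(** On a cube, which has finite measure, |f| is dominated by 1 + |f|^p. *)
Lemma Lpf_locally_integrable p f : 1 <= p -> Lpf mu p f -> locally_integrable_rV f.
Proof.
move=> p1 Lf; apply/locally_integrableP; split; first exact: Lpf_meas Lf.
move=> M; have [mf intf] := (LpfP mu f p1).1 Lf.
have mc := measurable_cube M.
apply: (le_integrable mc (g := fun x => 1%:E + (`|f x| `^ p)%:E)%E).
- by apply/measurable_EFinP; exact: measurable_funS mf.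
- move=> x _ /=; rewrite lee_fin [leRHS]ger0_norm; last by rewrite addr_ge0// powR_ge0.
  have [f1|f1] := leP `|f x| 1; first by rewrite (le_trans f1)// lerDl powR_ge0.
  by rewrite (le_trans (le1r_powR (ltW f1) p1))// lerDr.
- apply: integrableD => //.
    apply/integrableP; split; first exact: measurable_cst.
    rewrite (eq_integral (cst 1%E)); last by move=> x _; rewrite /= normr1.
    by rewrite integral_cst// mul1e cube_fin.
  exact: integrableS intf.
Qed.

(** If the open set where g < f were nonempty it would contain a box, and boxes have positive
    measure. This is the passage from almost everywhere to every point on which the final strict
    positivity rests. *)
Lemma continuous_ae_le f g : continuous f -> continuous g ->
  {ae mu, forall x, f x <= g x} -> forall x, f x <= g x.
Proof.
move=> cf cg [A [mA A0 hA]] x; rewrite leNgt; apply/negP => gfx.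
have oU : open [set y | 0 < f y - g y].
  rewrite (_ : mkset _ = (fun y => f y - g y) @^-1` `]0, +oo[%classic).
    by apply: open_comp => [y _|]; [apply: continuousB; [exact: cf|exact: cg]|exact: interval_open].
  by apply/seteqP; split => y /=; rewrite in_itv/= andbT.
have /nbhs_ballP[e /= e0 eU] : nbhs x [set y | 0 < f y - g y].
  by apply: open_nbhs_nbhs; split => //=; rewrite subr_gt0.
(* The coordinates of [x] are extended by 0 to all of [nat], the index type of the bounds of
   [box]. *)
pose a (i : nat) := (if insub i is Some j then x ord0 j else 0) - e.
pose b (i : nat) := (if insub i is Some j then x ord0 j else 0) + e.
have bA : box a b `<=` A.
  move=> y yb; apply: hA; apply/negP; rewrite -ltNge -subr_gt0.
  apply: eU; apply/rV_ballP; split => // i; have := yb i.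
  rewrite /a /b valK => /andP[? ?]; rewrite ltr_norml; apply/andP; split; lra.
have ab i : a i < b i by rewrite /a /b ltrD2l gtrN.
have /andP[+ _] := @box_measure R N a b ab.
have : (mu (box a b) <= mu A)%E by apply: le_measure => //; rewrite inE//; exact: measurable_box.
by rewrite A0 leNgt => /negbTE ->.
Qed.

End bounded_support.

(** * Smooth bumps and test functions *)

Section flat_function.
Context (R : realType).
Implicit Types (x y c : R) (P : {poly R}).

(** The polynomial parameter makes the family stable under differentiation, so that the smoothness
    of e^(-1/x), the case [P = 1], follows by induction on the order. *)
Definition flat P x : R := if 0 < x then P.[x^-1] * expR (- x^-1) else 0.

Definition flat_der P : {poly R} := 'X^2 * (P - P^`()).

(** For positive n, this is t <= e^t at t = y / n, raised to the power n. *)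
Lemma pow_le_expR n y : 0 <= y -> y ^+ n <= n%:R ^+ n * expR y.
Proof.
case: n => [y0|n y0]; first by rewrite !expr0 mul1r -expR0 ler_expR.
have h : y / n.+1%:R <= expR (y / n.+1%:R).
  by apply: le_trans (expR_ge1Dx _); rewrite lerDr.
have : (y / n.+1%:R) ^+ n.+1 <= expR (y / n.+1%:R) ^+ n.+1.
  by apply: lerXn2r => //; rewrite nnegrE ?divr_ge0 ?expR_ge0.
rewrite -expRM_natl mulrCA mulfV ?pnatr_eq0// mulr1 expr_div_n ler_pdivrMr ?exprn_gt0//.
by rewrite mulrC.
Qed.

Lemma poly_le_expR P : exists C, forall y, 0 <= y -> y ^+ 2 * `|P.[y]| <= C * expR y.
Proof.
exists (\sum_(i < size P) `|P`_i| * (i + 2)%:R ^+ (i + 2)) => y y0.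
rewrite horner_coef mulr_suml.
apply: le_trans (_ : y ^+ 2 * \sum_(i < size P) `|P`_i * y ^+ i| <= _).
  by rewrite ler_wpM2l ?exprn_ge0// ler_norm_sum.
rewrite mulr_sumr; apply: ler_sum => i _.
rewrite normrM normrX (ger0_norm y0) mulrCA -[leRHS]mulrA ler_wpM2l//.
by rewrite -exprD addnC pow_le_expR.
Qed.

(** A quadratic bound forces derivative 0 at the origin, the only point where the formula changes.
    It comes from y^2 |P(y)| <= C e^y at y = 1/x. *)
Lemma flat_bound P : exists C, forall x, `|flat P x| <= C * x ^+ 2.
Proof.
have [C h] := poly_le_expR P; exists C => x; rewrite /flat; case: ifPn => x0.
  have := h x^-1; rewrite invr_ge0 ltW// => /(_ isT).
  rewrite normrM (ger0_norm (expR_ge0 _)) expRN.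
  rewrite ler_pdivrMr ?expR_gt0// exprVn mulrC ler_pdivrMr ?exprn_gt0//.
  by rewrite mulrAC.
rewrite normr0 mulr_ge0 ?sqr_ge0//.
(* The bound at y = 0 says exactly that [C] is nonnegative. *)
have := h 0 (lexx _); rewrite expr0n/= mul0r expR0 mulr1.
by [].
Qed.

Lemma is_derive0_quadratic (f : R -> R) (C : R) :
  (forall x, `|f x| <= C * x ^+ 2) -> is_derive (0 : R) (1 : R) f 0.
Proof.
move=> fC.
have f0 : f 0 = 0 by apply/eqP; rewrite -normr_eq0 eq_le normr_ge0 andbT (le_trans (fC 0))// expr0n/= mulr0.
have lim0 : h^-1 *: (f (h *: 1 + 0) - f 0) @[h --> 0^'] --> (0 : R).
  apply/cvgrPdist_le => e e0; near=> h.
  rewrite f0 sub0r subr0 addr0 normrN /GRing.scale/= mulr1 normrM normfV.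
  have h0 : h != 0 by near: h; exact: nbhs_dnbhs_neq.
  rewrite ler_pdivrMl ?normr_gt0//; apply: (le_trans (fC h)).
  have C1 : C <= `|C| + 1 by rewrite (le_trans (ler_norm _))// lerDl.
  apply: (le_trans (ler_wpM2r (sqr_ge0 h) C1)).
  rewrite -[h ^+ 2]ger0_norm ?sqr_ge0// normrX expr2 mulrCA ler_wpM2l//.
  rewrite -ler_pdivlMl ?ltr_wpDl//.
  near: h; apply/nbhs_dnbhs.
  have : 0 < (`|C| + 1)^-1 * e by rewrite mulr_gt0// invr_gt0 ltr_wpDl.
  by move=> d0; exists ((`|C| + 1)^-1 * e) => //= h; rewrite /ball_/= sub0r normrN; exact: ltW.
apply: DeriveDef; last exact: cvg_lim lim0.
by apply/cvg_ex; exists 0.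
Unshelve. all: by end_near. Qed.

Lemma is_derive_flat P x : is_derive x 1 (flat P) (flat (flat_der P) x).
Proof.
have [x0|x0|->] := ltgtP x 0.
- rewrite /flat [0 < x]ltNge ltW//=.
  have d0 : is_derive x 1 (cst (0 : R)) (0 : R) := is_derive_cst 0 x 1.
  apply: (near_eq_is_derive _ d0).
  near=> y; rewrite ifF//; apply/negbTE; rewrite -leNgt ltW//; near: y.
  exact: lt_nbhsl.
- rewrite /flat x0.
  apply: (near_eq_is_derive (f := fun y => P.[y^-1] * expR (- y^-1))).
    by near=> y; rewrite ifT//; near: y; exact: lt_nbhsr.
  have dinv : is_derive x 1 (fun y : R => y^-1) (- x ^- 2 *: 1).
    by apply: is_deriveV => //; rewrite gt_eqF.
  have d1 := is_derive1_comp (is_derive_poly P x^-1) dinv.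
  have d2 := @is_derive1_comp R expR (fun y => - y^-1) x _ _ (is_derive_expR (- x^-1)) (is_deriveN dinv).
  apply: is_derive_eq (is_deriveM d1 d2) _.
  rewrite /flat_der /GRing.scale/= hornerM hornerXn hornerD hornerN mulr1 exprVn; ring.
- rewrite /flat ltxx.
  by have [C h] := flat_bound P; exact: is_derive0_quadratic h.
Unshelve. all: by end_near. Qed.

Lemma flat1_ge0 x : 0 <= flat 1 x.
Proof. by rewrite /flat; case: ifP => // _; rewrite hornerC mul1r expR_ge0. Qed.

Lemma flat1_le1 x : flat 1 x <= 1.
Proof.
rewrite /flat; case: ifP => // x0; rewrite hornerC mul1r -expR0 ler_expR.
by rewrite oppr_le0 invr_ge0 ltW.
Qed.

Lemma flat1_le0 x : x <= 0 -> flat 1 x = 0.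
Proof. by move=> x0; rewrite /flat ltNge x0. Qed.

Lemma flat1_cvg1 x : 0 < x -> flat 1 (n.+1%:R * x) @[n --> \oo] --> (1 : R).
Proof.
move=> x0; rewrite (_ : (fun n => _) = (fun n => expR (- (n.+1%:R^-1 * x^-1)))).
  rewrite -[X in _ --> X]expR0; apply: (@cvg_comp _ _ _ _ expR _ (nbhs (0:R))).
    rewrite -oppr0; apply: cvgN; rewrite -(mul0r x^-1); apply: cvgMl.
    exact: cvg_harmonic.
  exact: continuous_expR.
by apply/funext => n; rewrite /flat mulr_gt0// hornerC mul1r invfM.
Qed.

End flat_function.

(** * Test functions and smooth bumps on boxes *)

Section smooth_functions.
Context (R : realType) (N : nat).
Local Notation E := 'rV[R]_N.
Implicit Types (phi psi : E -> R) (x v : E).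

Definition unitv (i : 'I_N) : E := delta_mx ord0 i.

Lemma is_derive_coord i x v : is_derive x v (fun y : E => y ord0 i) (v ord0 i).
Proof.
apply: DeriveDef; first by apply: diff_derivable; exact: differentiable_coord.
apply: cvg_lim => //; apply: cvg_near_cst; near=> h.
rewrite /= !mxE addrK /GRing.scale/= mulKf//.
by near: h; exact: nbhs_dnbhs_neq.
Unshelve. all: by end_near. Qed.

Lemma affine_coord_derive (G : R -> R) (a b dG : R) i x v :
  is_derive (a * x ord0 i + b) 1 G dG ->
  differentiable (fun y : E => G (a * y ord0 i + b)) x /\
  'D_v (fun y : E => G (a * y ord0 i + b)) x = dG * (a * v ord0 i).
Proof.
move=> dGx; pose l (y : E) := a * y ord0 i + b.
have dl : differentiable l x.
  apply: (@differentiableD _ _ _ (fun y : E => a * y ord0 i) (cst b)) => //.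
  by apply: (@differentiableZ _ _ _ (fun y : E => y ord0 i) a); exact: differentiable_coord.
have dG' : differentiable G (l x) by apply/derivable1_diffP; case: dGx.
have dGl : differentiable (G \o l) x by exact: differentiable_comp.
split=> //; rewrite [LHS](@deriveE _ _ _ (G \o l) x v)// diff_comp//= -!deriveE//.
have -> : 'D_v l x = a * v ord0 i.
  have [_ H] := is_deriveD (is_deriveZ a (is_derive_coord i x v)) (is_derive_cst b x v).
  by apply: etrans H _; rewrite addr0.
set w := a * v ord0 i.
rewrite deriveE// (diff1E dG') derive1E.
by case: dGx => _ ->; rewrite [LHS]mulrC.
Qed.

(** Counting orders lets the Leibniz rule close the class under products by plain induction. The
    recursion peels off the innermost derivative while [pderiv] peels off the outermost;
    [pderiv_rcons] reconciles the two. *)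
Fixpoint smoothn n phi : Prop :=
  (forall x, differentiable phi x) /\
  match n with
  | 0 => True
  | m.+1 => forall i, smoothn m (fun x => 'D_(unitv i) phi x)
  end.

Lemma smoothnW n phi : smoothn n.+1 phi -> smoothn n phi.
Proof.
elim: n phi => [|n IH] phi [dphi h]; first by split.
by split => // i; exact/IH/h.
Qed.

Lemma smoothn_diff n phi : smoothn n phi -> forall x, differentiable phi x.
Proof. by case: n => [|n] []. Qed.

Lemma smoothnD n phi psi : smoothn n phi -> smoothn n psi ->
  smoothn n (fun x => phi x + psi x).
Proof.
elim: n phi psi => [|n IH] phi psi [d1 h1] [d2 h2]; split => //.
- by move=> x; exact: differentiableD.
- by move=> x; exact: differentiableD.
move=> i; suff -> : (fun x => 'D_(unitv i) (fun y => phi y + psi y) x) =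
    (fun x => 'D_(unitv i) phi x + 'D_(unitv i) psi x).
  by apply: IH; [exact: h1|exact: h2].
by apply/funext => x; rewrite -deriveD//; exact: diff_derivable.
Qed.

Lemma smoothnM n phi psi : smoothn n phi -> smoothn n psi ->
  smoothn n (fun x => phi x * psi x).
Proof.
elim: n phi psi => [|n IH] phi psi h1 h2.
  by split => // x; apply: differentiableM; [exact: (smoothn_diff h1)|exact: (smoothn_diff h2)].
have [d1 h1'] := h1; have [d2 h2'] := h2; split.
  by move=> x; exact: differentiableM.
move=> i; suff -> : (fun x => 'D_(unitv i) (fun y => phi y * psi y) x) =
    (fun x => phi x * 'D_(unitv i) psi x + psi x * 'D_(unitv i) phi x).
  by apply: smoothnD; apply: IH; [exact: smoothnW|exact: h2'|exact: smoothnW|exact: h1'].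
by apply/funext => x; rewrite [LHS]deriveM//; exact: diff_derivable.
Qed.

Lemma smoothn_cst n (c : R) : smoothn n (fun=> c).
Proof.
elim: n c => [|n IH] c; split => // i.
suff -> : (fun x => 'D_(unitv i) (fun=> c) x) = (fun=> 0) by [].
by apply/funext => x; exact: derive_cst.
Qed.

Lemma smoothn_prod n (I : Type) (s : seq I) (f : I -> E -> R) :
  (forall i, smoothn n (f i)) -> smoothn n (fun x => \prod_(i <- s) f i x).
Proof.
move=> h; elim: s => [|i s IH].
  by under eq_fun do rewrite big_nil; exact: smoothn_cst.
by under eq_fun do rewrite big_cons; exact: smoothnM.
Qed.

Lemma smoothn_flat n (P : {poly R}) i (a b : R) :
  smoothn n (fun x => flat P (a * x ord0 i + b)).
Proof.
elim: n P => [|n IH] P.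
  by split => // x; have [] := affine_coord_derive 0 (is_derive_flat P (a * x ord0 i + b)).
split=> [x|j]; first by have [] := affine_coord_derive 0 (is_derive_flat P (a * x ord0 i + b)).
suff -> : (fun x => 'D_(unitv j) (fun y : E => flat P (a * y ord0 i + b)) x) =
    (fun x => (a * unitv j ord0 i) * flat (flat_der P) (a * x ord0 i + b)).
  by apply: smoothnM; [exact: smoothn_cst|exact: IH].
apply/funext => x; have [_ ->] := affine_coord_derive (unitv j) (is_derive_flat P (a * x ord0 i + b)).
by rewrite mulrC.
Qed.

Lemma pderiv_rcons (s : seq 'I_N) i phi :
  pderiv (rcons s i) phi = pderiv s (pderiv [:: i] phi).
Proof. by rewrite /pderiv foldr_rcons. Qed.

Lemma smooth_pderiv phi : (forall n, smoothn n phi) ->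
  forall s x, differentiable (pderiv s phi) x.
Proof.
move=> h s; have := h (size s); elim/last_ind: s phi {h} => [|s i IH] phi.
  by case.
rewrite size_rcons => -[_ h] x; rewrite pderiv_rcons; apply: IH.
exact: (h i).
Qed.

Lemma supported_test phi (M : R) : (forall s x, differentiable (pderiv s phi) x) ->
  supported_in M phi -> test_function phi.
Proof.
move=> h phiM; split => //.
apply: (subclosed_compact _ (@compact_closed_cube R N M)); first exact: closed_closure.
have cK : closed [set x : E | `|x| <= M].
  by apply: compact_closed; [exact: norm_hausdorff|exact: compact_closed_cube].
rewrite ((closure_id _).1 cK); apply: closure_subset => x /= /eqP phi0.
by rewrite leNgt; apply/negP => /ltW /phiM.
Qed.

Lemma test_supported phi : test_function phi -> exists2 M, 0 < M & supported_in M phi.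
Proof.
move=> [_ /compact_cube[M M0 h]]; exists M => // x Mx.
apply/eqP; apply/negPn/negP => phi0; have /h : closure [set x | phi x != 0] x.
  exact: subset_closure.
by rewrite /cube/= ltNge Mx.
Qed.

Lemma test_diff phi : test_function phi -> forall x, differentiable phi x.
Proof. by move=> [h _]; exact: (h [::]). Qed.

Lemma test_continuous phi : test_function phi -> continuous phi.
Proof. by move=> /test_diff h x; exact: differentiable_continuous. Qed.

Lemma test_measurable phi : test_function phi -> measurable_fun setT phi.
Proof. by move=> /test_continuous; exact: continuous_measurable_rV. Qed.

Lemma test_bounded phi : test_function phi -> exists C, forall x, `|phi x| <= C.
Proof.
move=> h; have [M M0 hM] := test_supported h.
exact: continuous_supported_bounded (test_continuous h) hM.
Qed.

(** The additional 1 leaves a unit ball around [x] on which [phi] vanishes identically. *)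
Lemma supported_derive (M : R) phi v : supported_in M phi ->
  supported_in (M + 1) (fun x => 'D_v phi x).
Proof.
move=> phiM x Mx; rewrite (near_eq_derive (g := cst 0)) ?derive_cst//.
have : nbhs x (ball x (1:R)) by exact: nbhsx_ballx.
apply: filterS => y; rewrite mx_norm_ball /ball_/= => xy; apply: phiM.
have : `|x| <= `|x - y| + `|y| by rewrite -{1}(subrK y x) ler_normD.
lra.
Qed.

Lemma test_pderiv phi i : test_function phi -> test_function (pderiv [:: i] phi).
Proof.
move=> h; have [M M0 hM] := test_supported h; have [d _] := h.
apply: (@supported_test _ (M + 1)); last exact: supported_derive.
by move=> s x; rewrite -pderiv_rcons; exact: d.
Qed.

Lemma derive_translate phi v w x :
  'D_v (fun y => phi (y + w)) x = 'D_v phi (x + w).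
Proof.
rewrite /derive; suff -> : (fun h : R => h^-1 *: (((fun y => phi (y + w)) \o shift x) (h *: v) - phi (x + w))) =
  (fun h => h^-1 *: ((phi \o shift (x + w)) (h *: v) - phi (x + w))) by [].
by apply/funext => h /=; rewrite addrA.
Qed.

Lemma pderiv_translate s phi w :
  pderiv s (fun y => phi (y + w)) = (fun x => pderiv s phi (x + w)).
Proof.
elim: s => //= i s ->; apply/funext => x; exact: derive_translate.
Qed.

Lemma test_translate phi w : test_function phi -> test_function (fun x => phi (x + w)).
Proof.
move=> h; have [M M0 hM] := test_supported h; have [d _] := h.
apply: (@supported_test _ (M + `|w|)).
  move=> s x; rewrite pderiv_translate.
  apply: (@differentiable_comp _ _ _ _ (fun y => y + w) (pderiv s phi)); last exact: d.
  exact: differentiableD.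
move=> x Mx; apply: hM; have := ler_normD (x + w) (- w); rewrite addrK normrN; lra.
Qed.

Lemma test_scale_add c phi psi : test_function phi -> test_function psi ->
  test_function (fun x => phi x + c * psi x).
Proof.
move=> h1 h2; have [M1 M10 hM1] := test_supported h1; have [M2 M20 hM2] := test_supported h2.
have [[d1 _] [d2 _]] := (h1, h2).
apply: (@supported_test _ (Num.max M1 M2)).
  suff H s : pderiv s (fun x => phi x + c * psi x) = (fun x => pderiv s phi x + c * pderiv s psi x).
    move=> s x; rewrite H; apply: (@differentiableD _ _ _ (pderiv s phi)) => //.
    exact: (@differentiableZ _ _ _ (pderiv s psi)).
  elim: s => //= i s ->; apply/funext => x.
  rewrite [LHS](@deriveD _ _ _ (pderiv s phi) (c *: pderiv s psi)); last 2 first.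
  - exact: diff_derivable.
  - by apply: diff_derivable; exact: differentiableZ.
  by rewrite deriveZ//; exact: diff_derivable.
by move=> x; rewrite ge_max => /andP[Mx1 Mx2]; rewrite hM1// hM2// mulr0 addr0.
Qed.

Lemma test0 : test_function (fun _ : E => 0).
Proof.
apply: (@supported_test _ 0) => //; apply: smooth_pderiv => n; exact: smoothn_cst.
Qed.

(** Rescaling each factor by [n.+1] drives it to 1 inside the box while it stays 0 outside: the
    indicator is approached without enlarging the support. *)
Definition box_bump (a b : nat -> R) (n : nat) (x : E) : R :=
  \prod_(i < N) (flat 1 (n.+1%:R * (x ord0 i - a i)) * flat 1 (n.+1%:R * (b i - x ord0 i))).

Lemma box_bump_ge0 a b n x : 0 <= box_bump a b n x.
Proof. by apply: prodr_ge0 => i _; rewrite mulr_ge0 ?flat1_ge0. Qed.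

Lemma box_bump_le1 a b n x : box_bump a b n x <= 1.
Proof.
apply: prodr_ile1 => i _; rewrite mulr_ge0 ?flat1_ge0//=.
by rewrite mulr_ile1 ?flat1_ge0 ?flat1_le1.
Qed.

Lemma box_bump_out a b n x : ~ box a b x -> box_bump a b n x = 0.
Proof.
move=> /existsNP[i /negP]; rewrite negb_and -!leNgt => h.
rewrite /box_bump (bigD1 i)//= (_ : flat _ _ * flat _ _ = 0) ?mul0r//.
case/orP: h => h; [rewrite [X in X * _]flat1_le0 ?mul0r//|rewrite [X in _ * X]flat1_le0 ?mulr0//];
  by rewrite pmulr_rle0// subr_le0.
Qed.

Lemma box_bump_cvg a b x : box_bump a b n x @[n --> \oo] --> (\1_(box a b) x : R).
Proof.
rewrite indicE; have [xb|xb] := pselect (box a b x); last first.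
  rewrite memNset//; under eq_fun do rewrite box_bump_out//; exact: cvg_cst.
rewrite mem_set// /box_bump.
elim: (index_enum _) => [|i s IH].
  by under eq_fun do rewrite big_nil; exact: cvg_cst.
have /andP[ai bi] := xb i; rewrite -subr_gt0 in ai; rewrite -subr_gt0 in bi.
have -> : (true%:R : R) = 1 * 1 * true%:R by rewrite !mul1r.
under eq_fun do rewrite big_cons.
by apply: cvgM => //; apply: cvgM; exact: flat1_cvg1.
Qed.

Lemma box_bump_smooth a b n k : smoothn k (box_bump a b n).
Proof.
apply: smoothn_prod => i; apply: smoothnM.
  rewrite (_ : (fun x => _) = (fun x : E => flat 1 (n.+1%:R * x ord0 i + - (n.+1%:R * a i)))).
    exact: smoothn_flat.
  by apply/funext => x; rewrite mulrBr.
rewrite (_ : (fun x => _) = (fun x : E => flat 1 (- n.+1%:R * x ord0 i + n.+1%:R * b i))).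
  exact: smoothn_flat.
by apply/funext => x; rewrite mulrBr mulNr addrC.
Qed.

End smooth_functions.

(** * A functional monotone class theorem for functions of bounded support *)

Section monotone_class.
Context (R : realType) (N : nat).
Local Notation E := 'rV[R]_N.
Local Notation mu := (lebesgue_rV R N).
Implicit Types (f g : E -> R) (A : set E).

(** Boxes are stable under intersection, as Dynkin's theorem requires. A slab in one coordinate is
    the countable union of boxes that grow in the others. *)
Lemma box_generates : @measurable _ E = <<s [set A | exists a b : nat -> R, A = box a b] >>.
Proof.
set G := mkset _; apply/seteqP; split; last first.
  apply: smallest_sub; first exact: sigma_algebra_measurable.
  by move=> _ [a [b ->]]; exact: measurable_box.
suff coordG i : measurable_fun setT (@rV_coord R N i : g_sigma_algebraType G -> measurableTypeR R).
  apply: smallest_sub; first exact: smallest_sigma_algebra.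
  case: N G coordG => [|n] G coordG; first by rewrite big_ord0.
  rewrite -bigcup_mkord_ord; apply: bigcup_sub => i Ii.
  by move=> _ [B mB <-]; exact: coordG.
apply: (measurability (@RGenOpens.G R)); first exact: RGenOpens.measurableE.
move=> _ [_ [x [y ->]] <-]; rewrite setTI.
have -> : (@rV_coord R N i : g_sigma_algebraType G -> measurableTypeR R) @^-1` `]x, y[%classic =
  \bigcup_n (box (fun k => if k == i then x else - n.+1%:R) (fun k => if k == i then y else n.+1%:R)).
  apply/seteqP; split => [v|v].
    rewrite /= in_itv/= => vxy; exists (Num.truncn `|v|) => // j.
    case: eqP => [/val_inj ->//|_]; rewrite -ltr_norml.
    exact: le_lt_trans (coord_le_norm v j) (truncnS_gt _).
  by move=> [n _ /(_ i)]; rewrite eqxx /= in_itv.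
apply: bigcupT_measurable => n; apply: sub_sigma_algebra.
by do 2 eexists; reflexivity.
Qed.

Definition bounded_supported f :=
  measurable_fun setT f /\ exists M C : R, (forall x, `|f x| <= C) /\ supported_in M f.

Lemma bs_lin f g (c : R) : bounded_supported f -> bounded_supported g ->
  bounded_supported (fun x => f x + c * g x).
Proof.
move=> [mf [M1 [C1 [fC fM]]]] [mg [M2 [C2 [gC gM]]]]; split.
  by apply: measurable_funD => //; exact: measurable_funM.
exists (Num.max M1 M2), (C1 + `|c| * C2); split => x.
  by rewrite (le_trans (ler_normD _ _))// lerD// normrM ler_wpM2l.
by rewrite ge_max => /andP[? ?]; rewrite fM// gM// mulr0 addr0.
Qed.

Lemma test_bs f : test_function f -> bounded_supported f.
Proof.
move=> h; split; first exact: test_measurable.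
have [C fC] := test_bounded h; have [M _ fM] := test_supported h.
by exists M, C.
Qed.

Lemma bs_indic A (M : R) : measurable A -> A `<=` cube M -> bounded_supported (\1_A).
Proof.
move=> mA AM; split; first exact: measurable_indic.
exists M, 1; split => x.
  by rewrite indicE; case: (x \in A); rewrite ?normr1 ?normr0.
move=> Mx; rewrite indicE memNset// => /AM; rewrite /cube/=.
by rewrite ltNge Mx.
Qed.

Variable H : set (E -> R).
Hypothesis H_test : forall phi, test_function phi -> H phi.
Hypothesis H_lin : forall f g (c : R), bounded_supported f -> bounded_supported g ->
  H f -> H g -> H (fun x => f x + c * g x).
Hypothesis H_lim : forall (M C : R) (f_ : nat -> E -> R) f,
  (forall n, measurable_fun setT (f_ n)) -> (forall n x, `|f_ n x| <= C) ->
  (forall n, supported_in M (f_ n)) -> (forall n, H (f_ n)) ->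
  (forall x, f_ n x @[n --> \oo] --> f x) -> H f.

Lemma H_box (a b : nat -> R) : H (\1_(box a b)).
Proof.
pose M : R := \big[Num.max/0]_(i < N) (Num.max `|a i| `|b i|) + 1.
have bM : box (N := N) a b `<=` cube M.
  move=> x xab; rewrite /cube/=.
  have M0 : 0 < M by rewrite ltr_wpDl//; exact: bigmax_ge_id.
  rewrite -[`|x|]normrN -sub0r.
  suff : ball (0 : E) M x by rewrite mx_norm_ball.
  apply/rV_ballP; split => // i; rewrite mxE sub0r normrN.
  have /andP[ax xb] := xab i.
  have : Num.max `|a i| `|b i| <= \big[Num.max/0]_(i < N) (Num.max `|a i| `|b i|) by exact: le_bigmax.
  rewrite ge_max => /andP[aM bM]; rewrite ltr_norml /M.
  have := ler_norm (b i); have := ler_norm (- a i); rewrite normrN => ? ?.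
  by apply/andP; split; lra.
have sb n : supported_in M (@box_bump R N a b n).
  by move=> x Mx; apply: box_bump_out => /bM; rewrite /cube/= ltNge Mx.
have tb n : test_function (@box_bump R N a b n).
  by apply: supported_test (sb n); apply: smooth_pderiv => k; exact: box_bump_smooth.
refine (@H_lim M 1 (@box_bump R N a b) (\1_(box a b)) _ _ _ _ _).
- by move=> n; exact: test_measurable.
- by move=> n x; rewrite ger0_norm ?box_bump_ge0// box_bump_le1.
- exact: sb.
- by move=> n; exact: H_test.
- by move=> x; exact: box_bump_cvg.
Qed.

Lemma H_indic A (M : R) : measurable A -> A `<=` cube M -> H (\1_A).
Proof.
move=> mA AM.
pose Q : set E := box (fun=> - M) (fun=> M).
have QM : Q `<=` cube (`|M| + 1).
  move=> x xQ; rewrite /cube/= -[`|x|]normrN -sub0r.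
  suff : ball (0 : E) (`|M| + 1) x by rewrite mx_norm_ball.
  apply/rV_ballP; split => [|i]; first by rewrite ltr_wpDl.
  rewrite mxE sub0r normrN; have := xQ i; rewrite -ltr_norml => /lt_le_trans; apply.
  by rewrite (le_trans (ler_norm M))// lerDl.
have mQ : measurable Q by exact: measurable_box.
have bsQ B : measurable B -> bounded_supported (\1_(B `&` Q)).
  by move=> mB; apply: (@bs_indic _ (`|M| + 1)); [exact: measurableI|move=> x [_ /QM]].
suff : H (\1_(A `&` Q)) by rewrite setIidl//; exact: subset_trans (@cube_box R N M).
have mA' : <<s [set A | exists a b : nat -> R, A = box (N := N) a b] >> A by rewrite -box_generates.
move: A mA' {mA AM} => A.
(* Intersecting with the fixed box [Q] keeps complements bounded, so that they can be written as
   differences inside the class. *)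
apply: (dynkin_induction (P := fun B => H (\1_(B `&` Q))) box_generates).
- move=> _ _ [a [b ->]] [c [d ->]]; rewrite boxI.
  by do 2 eexists; reflexivity.
- by rewrite setTI; exact: H_box.
- by move=> _ [a [b ->]]; rewrite boxI; exact: H_box.
- move=> B mB HB.
  rewrite (_ : \1_(~` B `&` Q) = (fun x => \1_(setT `&` Q) x + (-1) * \1_(B `&` Q) x) :> (E -> R)).
    apply: H_lin; [exact: bsQ|exact: bsQ| |exact: HB].
    by rewrite setTI; exact: H_box.
  apply/funext => x; rewrite !indicE setTI mulN1r !in_setI in_setC.
  by case: (x \in B); case: (x \in Q); rewrite /= ?subr0 ?subrr.
- move=> F mF tF HF.
  pose G n := \bigcup_(i in [set k | (k < n)%N]) F i `&` Q.
  have mG n : measurable (G n) by apply: measurableI => //; exact: bigcup_measurable.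
  have GQ n : G n `<=` Q by move=> x [].
  have bsG n : bounded_supported (\1_(G n)).
    by rewrite -(setIidl (@GQ n)); exact: bsQ.
  refine (@H_lim (`|M| + 1) 1 (fun n => \1_(G n)) (\1_(\bigcup_k F k `&` Q)) _ _ _ _ _).
  + by move=> n; exact: measurable_indic.
  + by move=> n x; rewrite indicE; case: (x \in G n); rewrite ?normr1 ?normr0.
  + move=> n x Mx; rewrite indicE memNset// => /GQ/QM; rewrite /cube/=.
    by rewrite ltNge Mx.
  + elim=> [|n IH].
      rewrite (_ : \1_(G 0%N) = (fun=> 0) :> (E -> R)); first exact: (H_test (@test0 R N)).
      by apply/funext => x; rewrite indicE memNset// => -[[i]].
    rewrite (_ : \1_(G n.+1) = (fun x => \1_(G n) x + 1 * \1_(F n `&` Q) x) :> (E -> R)).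
      by apply: H_lin; [exact: bsG|exact: bsQ|exact: IH|exact: HF].
    apply/funext => x; rewrite mul1r !indicE.
    have [xFQ|xF] := pselect ((F n `&` Q) x).
      have [Fn Qx] := xFQ; rewrite (mem_set xFQ) mem_set; last by split => //; exists n => /=.
      rewrite memNset ?add0r// => -[[i /= ni Fi] _].
      move/trivIsetP : tF => /(_ i n I I); rewrite neq_ltn ni => /(_ isT) /seteqP[+ _].
      by move=> /(_ x (conj Fi Fn)).
    rewrite (memNset xF) addr0; congr (nat_of_bool _)%:R; apply/idP/idP => /set_mem[[i /= ni Fi] Qx].
      apply/mem_set; split => //; exists i => //=; rewrite ltn_neqAle -ltnS ni andbT.
      by apply/eqP => ni'; apply: xF; rewrite -ni'.
    by apply/mem_set; split => //; exists i => //=; exact: ltnW.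
  + move=> x; apply: cvg_near_cst.
    have [xF|xF] := pselect ((\bigcup_k F k `&` Q) x); last first.
      apply: nearW => n; rewrite !indicE (memNset xF) memNset// => h.
      apply: xF; split; last exact: GQ h.
      by case: h => -[i _ ?] _; exists i.
    have [[k _ Fk] Qx] := xF; near=> n.
    rewrite !indicE (mem_set xF) mem_set//; split => //; exists k => //=.
    by near: n; exact: nbhs_infty_gt.
Unshelve. all: by end_near. Qed.

(* The greedy binary expansion writes [f] as a uniform limit of linear
   combinations of indicators. *)
Lemma H_nonneg f (M C : R) : measurable_fun setT f -> (forall x, 0 <= f x <= C) ->
  supported_in M f -> H f.
Proof.
move=> mf f0C fM.
have step (c : R) (h : E -> R) : 0 < c -> measurable_fun setT h -> (forall x, 0 <= h x <= c) -> supported_in M h ->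
    exists h' : E -> R, [/\ measurable_fun setT h', forall x, 0 <= h' x <= c / 2, supported_in M h' &
      exists2 A, measurable A /\ A `<=` cube M & h' = fun x => h x - c / 2 * \1_A x].
  move=> c0 mh h0c hM; pose A := [set x | c / 2 <= h x].
  have mA : measurable A.
    rewrite (_ : A = h @^-1` `[c / 2, +oo[%classic).
      by rewrite -[X in measurable X]setTI; apply: mh.
    by apply/seteqP; split => x; rewrite /A /= in_itv/= andbT.
  have AM : A `<=` cube M.
    move=> x; rewrite /A /cube/= ltNge => chx; apply/negP => /hM h0.
    by move: chx; rewrite h0; lra.
  exists (fun x => h x - c / 2 * \1_A x); split.
  - by apply: measurable_funB => //; apply: measurable_funM => //; exact: measurable_indic.
  - move=> x; rewrite indicE; have /andP[h0 hc] := h0c x.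
    have [xA|xA] := boolP (x \in A).
      by move: xA; rewrite inE /A/= => xA; apply/andP; split; lra.
    have : ~ A x by move=> Ax; rewrite mem_set in xA.
    by rewrite /A/= => /negP; rewrite -ltNge => xA'; apply/andP; split; lra.
  - move=> x Mx; rewrite hM// indicE memNset ?mulr0 ?subrr// => /AM.
    by rewrite /cube/= ltNge Mx.
  - by exists A.
pose C' : R := `|C| + 1.
have C'0 : 0 < C' by rewrite ltr_wpDl.
pose P (n : nat) (h : E -> R) := [/\ measurable_fun setT h, forall x, 0 <= h x <= C' / 2 ^+ n,
  supported_in M h & H (fun x => f x - h x)].
have bsf : bounded_supported f.
  split=> //; exists M, C; split => // x.
  by have /andP[? ?] := f0C x; rewrite ger0_norm.
have P0 : P 0%N f.
  split=> //.
    move=> x; have /andP[-> fC] := f0C x; rewrite /= expr0 divr1 (le_trans fC)//.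
    by rewrite /C' (le_trans (ler_norm _))// lerDl.
  by rewrite (_ : (fun x => _) = (fun=> 0)); [exact/H_test/test0|apply/funext => x; rewrite subrr].
have PS n h : {h' | P n h -> P n.+1 h'}.
  apply: cid; have [Ph|Ph] := pselect (P n h); last by exists h.
  have [mh h0 hM Hh] := Ph.
  have [|h' [mh' h'0 h'M [A [mA AM] h'E]]] := step (C' / 2 ^+ n) h _ mh h0 hM.
    by rewrite divr_gt0// exprn_gt0.
  exists h' => _; split => //.
    by move=> x; have := h'0 x; rewrite -mulrA -invfM exprSr.
  rewrite (_ : (fun x => _) = (fun x => (f x - h x) + (C' / 2 ^+ n / 2) * \1_A x)).
    apply: H_lin => //; [|exact: bs_indic AM|exact: H_indic AM].
    rewrite (_ : (fun x => _) = (fun x => f x + (-1) * h x)); last by apply/funext => x; rewrite mulN1r.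
    apply: bs_lin => //; split => //; exists M, (C' / 2 ^+ n); split => // x.
    by have /andP[? ?] := h0 x; rewrite ger0_norm.
  by apply/funext => x; rewrite h'E opprB addrA addrAC.
pose h_ := fix h_ n := match n with 0 => f | m.+1 => sval (PS m (h_ m)) end.
have Ph n : P n (h_ n).
  by elim: n => [//|n IH]; exact: (svalP (PS n (h_ n))).
have C0 x : `|f x| <= C' by have [_ /(_ x) + _ _] := P0; rewrite expr0 divr1 => /andP[? ?]; rewrite ger0_norm.
refine (@H_lim M C' (fun n x => f x - h_ n x) f _ _ _ _ _).
- by move=> n; apply: measurable_funB => //; have [] := Ph n.
- move=> n x; have [_ /(_ x) + _ _] := Ph n => /andP[h0 hC].
  have /andP[f0 fC] := f0C x.
  have h1 : C' / 2 ^+ n <= C'.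
    by rewrite ler_pdivrMr ?exprn_gt0// ler_peMr ?(ltW C'0)// exprn_ege1// ler1n.
  have := C0 x; rewrite ger0_norm// => fC'.
  by rewrite ler_norml; apply/andP; split; lra.
- by move=> n x Mx; have [_ _ hM _] := Ph n; rewrite fM// hM// subrr.
- by move=> n; have [] := Ph n.
move=> x; rewrite -[X in _ --> X]subr0; apply: cvgB; first exact: cvg_cst.
apply: (@squeeze_cvgr _ _ _ _ (fun=> 0) (fun n => C' * (2^-1) ^+ n)).
- by apply: nearW => n; have [_ /(_ x) + _ _] := Ph n; rewrite exprVn.
- exact: cvg_cst.
- rewrite -(mulr0 C'); apply: cvgM; first exact: cvg_cst.
  by apply: cvg_expr; rewrite ger0_norm ?invr_ge0// invf_lt1// ltr1n.
Qed.

(** It serves with two classes: functions orthogonal to a given locally integrable function, and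
    functions approximable by test functions in L^q. *)
Lemma monotone_class f : bounded_supported f -> H f.
Proof.
move=> [mf [M [C [fC fM]]]].
rewrite (_ : f = (fun x => Num.max (f x) 0 + (-1) * Num.max (- f x) 0)); last first.
  apply/funext => x; have [f0|f0] := boolP (0 <= f x).
    by rewrite max_l// max_r ?oppr_le0// mulr0 addr0.
  rewrite -ltNge in f0.
  by rewrite max_r ?(ltW f0)// max_l ?oppr_ge0 ?(ltW f0)// add0r mulN1r opprK.
have m1 : measurable_fun setT (fun x => Num.max (f x) 0) by exact: measurable_maxr.
have m2 : measurable_fun setT (fun x => Num.max (- f x) 0).
  by apply: measurable_maxr => //; exact: measurableT_comp.
have b1 x : 0 <= Num.max (f x) 0 <= C.
  by rewrite le_max lexx orbT ge_max (le_trans (ler_norm _) (fC x)) (le_trans _ (fC x)).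
have b2 x : 0 <= Num.max (- f x) 0 <= C.
  by rewrite le_max lexx orbT ge_max (le_trans _ (fC x)) ?(le_trans _ (fC x))// -normrN ler_norm.
have s1 : supported_in M (fun x => Num.max (f x) 0) by move=> x Mx; rewrite fM// maxxx.
have s2 : supported_in M (fun x => Num.max (- f x) 0) by move=> x Mx; rewrite fM// oppr0 maxxx.
apply: H_lin.
- split=> //; exists M, C; split => // x; have /andP[? ?] := b1 x; by rewrite ger0_norm.
- split=> //; exists M, C; split => // x; have /andP[? ?] := b2 x; by rewrite ger0_norm.
- exact: H_nonneg m1 b1 s1.
- exact: H_nonneg m2 b2 s2.
Qed.

End monotone_class.

(** * Dominated convergence for real integrals and in L^p *)

Section dominated.
Context d (X : measurableType d) (R : realType).
Variable mu : {measure set X -> \bar R}.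
Implicit Types (f g : X -> R) (p : R).

Lemma Rintegral_dominated (f_ : nat -> X -> R) f g :
  (forall n, measurable_fun setT (f_ n)) ->
  (forall x, f_ n x @[n --> \oo] --> f x) -> mu.-integrable setT (EFin \o g) ->
  (forall n x, `|f_ n x| <= g x) ->
  \int[mu]_x f_ n x @[n --> \oo] --> \int[mu]_x f x.
Proof.
move=> mf cf ig fg.
have mf' : measurable_fun setT (EFin \o f).
  apply: (emeasurable_fun_cvg (fun n => EFin \o f_ n)).
    by move=> n; exact/measurable_EFinP.
  by move=> x _; apply: cvg_EFin; [exact: nearW|exact: cf].
have h1 n : measurable_fun setT (EFin \o f_ n) by exact/measurable_EFinP.
have h2 : {ae mu, forall x, setT x -> (EFin \o f_ n) x @[n --> \oo] --> (EFin \o f) x}.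
  by apply: aeW => x _; apply: cvg_EFin; [exact: nearW|exact: cf].
have h3 : {ae mu, forall x n, setT x -> (`|(EFin \o f_ n) x| <= (EFin \o g) x)%E}.
  by apply: aeW => x n _; rewrite /= lee_fin.
have [intf _ h] := dominated_convergence measurableT h1 mf' h2 ig h3.
rewrite /Rintegral; apply: fine_cvg.
by rewrite fineK//; exact: integrable_fin_num.
Qed.

Lemma Lpn_dominated p (f_ : nat -> X -> R) f g : 1 <= p ->
  (forall n, measurable_fun setT (f_ n)) ->
  (forall x, f_ n x @[n --> \oo] --> f x) -> Lpf mu p g ->
  (forall n x, `|f_ n x| <= `|g x|) ->
  Lpf mu p f /\ forall e, 0 < e -> \forall n \near \oo, Lpn mu p (fun x => f x - f_ n x) < e.
Proof.
move=> p1 mf cf Lg fg.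
have mf' : measurable_fun setT f.
  apply: measurable_fun_cvg mf _ => x _; exact: cf.
have fg' x : `|f x| <= `|g x|.
  have c : `|f_ n x| @[n --> \oo] --> `|f x| by exact: cvg_norm.
  by rewrite -(cvg_lim _ c)//; apply: limr_le; [exact: cvgP c|exact: nearW].
have Lf : Lpf mu p f by apply: (Lpf_le p1 mf' Lg); exact: aeW.
have Lf_ n : Lpf mu p (f_ n) by apply: (Lpf_le p1 (mf n) Lg); exact: aeW.
split=> // e e0.
have p0 : 0 < p by rewrite (lt_le_trans _ p1).
have [_ ig] := (LpfP mu _ p1).1 (LpfZ 2 p1 (Lpf_norm p1 Lg)).
have h : \int[mu]_x (`|f x - f_ n x| `^ p) @[n --> \oo] --> \int[mu]_x (0 : R).
  apply: (Rintegral_dominated (g := fun x => `|2 * `|g x| | `^ p)).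
  - by move=> n; apply: measurable_normpow; exact: measurable_funB.
  - move=> x; have c : `|f x - f_ n x| @[n --> \oo] --> (0 : R).
      by rewrite -(normr0 R) -(subrr (f x)); apply: cvg_norm; apply: cvgB; [exact: cvg_cst|exact: cf].
    apply/cvgrPdist_lt => r r0; near=> n.
    rewrite sub0r normrN ger0_norm ?powR_ge0//.
    rewrite -[ltRHS](@powRr1 _ r) ?ltW// -(mulVf (lt0r_neq0 p0)) powRrM.
    rewrite gt0_ltr_powR// ?nnegrE ?powR_ge0//.
    near: n; have r1 : 0 < r `^ p^-1 by rewrite powR_gt0.
    have /cvgrPdist_lt/(_ _ r1) := c; apply: filterS => n.
    by rewrite sub0r normrN normr_id.
  - exact: ig.
  - move=> n x; rewrite ger0_norm ?powR_ge0//; apply: ge0_ler_powR; rewrite ?nnegrE ?(ltW p0)//.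
    rewrite (ger0_norm (_ : 0 <= 2 * `|g x|)) ?mulr_ge0//.
    rewrite (le_trans (ler_normB _ _))// mulr_natl mulr2n lerD//; exact: fg'.
move: h; rewrite (_ : \int[mu]_x (0 : R) = 0); last by rewrite /Rintegral integral0.
move=> /cvgrPdist_lt/(_ (e `^ p)); rewrite powR_gt0// => /(_ isT).
apply: filterS => n; rewrite sub0r normrN -Lpn_powR//; last exact: LpfB.
rewrite ger0_norm ?powR_ge0//; apply: contraTT; rewrite -!leNgt => eL.
by apply: ge0_ler_powR; rewrite ?nnegrE ?Lpn_ge0 ?(ltW p0) ?(ltW e0).
Unshelve. all: by end_near. Qed.

End dominated.

(** * Fundamental lemma of the calculus of variations and density of test functions *)

Section test_functions_are_rich.
Context (R : realType) (N : nat).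
Local Notation E := 'rV[R]_N.
Local Notation mu := (lebesgue_rV R N).
Implicit Types (f g : E -> R) (p q : R).

Lemma bs_mul_integrable f g : locally_integrable_rV f -> bounded_supported g ->
  mu.-integrable setT (EFin \o (fun x => f x * g x)).
Proof. by move=> lf [mg [M [C [gC gM]]]]; exact: integrable_mul_supported gC gM. Qed.

(** By [monotone_class] the integral also vanishes against every bounded measurable function of
    bounded support, in particular against the sign of [f] on a cube, which yields the integral of
    |f| there. *)
Lemma weak_zero f : locally_integrable_rV f ->
  (forall phi, test_function phi -> \int[mu]_x (f x * phi x) = 0) ->
  {ae mu, forall x, f x = 0}.
Proof.
move=> lf f0.
have Hbs g : bounded_supported g -> \int[mu]_x (f x * g x) = 0.
  apply: (monotone_class (H := fun g => \int[mu]_x (f x * g x) = 0)) => //.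
  - move=> g1 g2 c b1 b2 h1 h2.
    rewrite (_ : (fun x => _) = (fun x => f x * g1 x + c * (f x * g2 x))).
      rewrite RintegralD//; [|exact: bs_mul_integrable|].
        by rewrite RintegralZl ?h1 ?h2 ?mulr0 ?addr0//; exact: bs_mul_integrable.
      rewrite (_ : _ \o _ = (fun x => c%:E * (f x * g2 x)%:E)%E)//.
      by apply: integrableZl => //; exact: bs_mul_integrable.
    by apply/funext => x; ring.
  - move=> M C f_ gl mf_ f_C f_M hf_ cf_.
    have lim : \int[mu]_x (f x * f_ n x) @[n --> \oo] --> \int[mu]_x (f x * gl x).
      apply: (Rintegral_dominated (g := fun x => `|f x * (C * \1_(cube M) x)|)).
      - by move=> n; apply: measurable_funM => //; case: lf.
      - by move=> x; apply: cvgM; [exact: cvg_cst|exact: cf_].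
      - apply: (@integrable_norm _ _ _ mu setT (fun x => f x * (C * \1_(cube M) x))).
        apply: bs_mul_integrable => //.
        have := bs_lin C (test_bs (@test0 R N)) (bs_indic (measurable_cube M) (@subset_refl _ (cube M))).
        by under eq_fun do rewrite add0r.
      move=> n x; rewrite !normrM ler_wpM2l//; have [xM|xM] := ltP `|x| M.
        by rewrite indicE mem_set//= normr1 mulr1 (le_trans (f_C n x))// ler_norm.
      by rewrite f_M// normr0.
    have : \int[mu]_x (f x * f_ n x) @[n --> \oo] --> (0 : R).
      by under eq_fun do rewrite hf_; exact: cvg_cst.
    by move=> /(cvg_lim (@Rhausdorff R)) <-; rewrite (cvg_lim (@Rhausdorff R) lim).
have mf : measurable_fun setT f by case: lf.
have ae0 M : {ae mu, forall x, cube M x -> f x = 0}.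
  have mc := measurable_cube (N := N) M.
  (* The sign of [f], cut off to the cube. *)
  pose s x := (if 0 <= f x then 1 else -1) * \1_(cube M) x : R.
  have ms : measurable_fun setT s.
    apply: measurable_funM; last exact: measurable_indic.
    by apply: measurable_fun_ifT => //; exact: measurable_fun_ler.
  have : \int[mu]_x (f x * s x) = 0.
    apply: Hbs; split => //; exists M, 1; split => x.
      rewrite /s normrM indicE; case: ifP => _; rewrite ?normrN normr1 mul1r;
        by case: (x \in cube M); rewrite ?normr1 ?normr0.
    by move=> Mx; rewrite /s indicE memNset ?mulr0// /cube/= ltNge Mx.
  have intf : mu.-integrable (cube M) (EFin \o f) by have [_] := (locally_integrableP f).1 lf; exact.
  have -> : \int[mu]_x (f x * s x) = \int[mu]_(x in cube M) `|f x|.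
    rewrite [RHS]Rintegral_mkcond; apply: eq_Rintegral => x _.
    rewrite /s patchE indicE; case: (x \in cube M); rewrite ?mulr0// mulr1.
    by case: ifPn => f0'; rewrite ?mulr1 ?mulrN1; [rewrite ger0_norm|rewrite ltr0_norm// ltNge].
  move=> h.
  have : (\int[mu]_(x in cube M) `|(f x)%:E| = 0)%E.
    have := congr1 EFin h; rewrite /Rintegral fineK//.
    by apply: integrable_fin_num => //; exact: integrable_norm.
  have mf' : measurable_fun (cube M) (EFin \o f) by apply/measurable_EFinP; exact: measurable_funS mf.
  by move/(ae_eq_integral_abs mu mc mf').1; apply: filterS => x /= + /[dup] /[swap] => /[apply] -[].
have := ae_foralln (fun n => ae0 n.+1%:R).
by apply: filterS => x /(_ (Num.truncn `|x|)); apply; exact: truncnS_gt.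
Qed.

(** Approximability is stable under linear combinations and, by dominated convergence, under bounded
    limits with common support; so it holds for bounded functions of bounded support, and truncation
    reaches the rest. *)
Lemma test_dense q f (e : R) : 1 <= q -> Lpf mu q f -> 0 < e ->
  exists2 phi, test_function phi & Lpn mu q (fun x => f x - phi x) < e.
Proof.
move=> q1.
have bsL g : bounded_supported g -> Lpf mu q g.
  by move=> [mg [M [C [gC gM]]]]; exact: bounded_supported_Lpf gC gM.
have testL phi : test_function phi -> Lpf mu q phi by move=> /test_bs/bsL.
pose H g := forall e : R, 0 < e -> exists2 phi, test_function phi & Lpn mu q (fun x => g x - phi x) < e.
have Hbs g : bounded_supported g -> H g.
  apply: (monotone_class (H := H)).
  - move=> phi tphi r r0; exists phi => //.
    by under eq_fun do rewrite subrr; rewrite Lpn0.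
  - move=> g1 g2 c b1 b2 h1 h2 r r0.
    have [phi1 t1 l1] := h1 (r / 2) (divr_gt0 r0 (ltr0n _ 2)).
    have c0 : 0 < `|c| + 1 by rewrite ltr_wpDl.
    have [phi2 t2 l2] := h2 (r / 2 / (`|c| + 1)) (divr_gt0 (divr_gt0 r0 (ltr0n _ 2)) c0).
    exists (fun x => phi1 x + c * phi2 x); first exact: test_scale_add.
    rewrite (_ : (fun x => _) = (fun x => (g1 x - phi1 x) + c * (g2 x - phi2 x))); last first.
      by apply/funext => x; ring.
    have L1 : Lpf mu q (fun x => g1 x - phi1 x) by apply: LpfB => //; [exact: bsL|exact: testL].
    have L2 : Lpf mu q (fun x => g2 x - phi2 x) by apply: LpfB => //; [exact: bsL|exact: testL].
    apply: le_lt_trans (LpnD q1 L1 (LpfZ c q1 L2)) _; rewrite LpnZ//.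
    rewrite [r]splitr ltr_leD//.
    rewrite ltr_pdivlMr// in l2.
    apply: le_trans (ltW l2); rewrite mulrC ler_wpM2l ?Lpn_ge0// lerDl//.
  - move=> M C f_ gl mf_ f_C f_M hf_ cf_ r r0.
    have r20 : 0 < r / 2 by rewrite divr_gt0.
    have Lg : Lpf mu q (fun x => C * \1_(cube M) x) by apply: LpfZ => //; exact: Lpf_indic_cube.
    have [|Lgg /(_ _ r20)[n _ /(_ n (leqnn n)) /= ln]] := Lpn_dominated q1 mf_ cf_ Lg.
      move=> n x; have [xM|xM] := ltP `|x| M.
        by rewrite indicE mem_set//= mulr1 (le_trans (f_C n x))// ler_norm.
      by rewrite f_M// normr0.
    have [phi tphi lphi] := hf_ n _ r20; exists phi => //.
    have Lfn : Lpf mu q (f_ n) by exact: bounded_supported_Lpf (f_C n) (f_M n).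
    apply: le_lt_trans (Lpn_distD q1 Lgg Lfn (testL _ tphi)) _.
    by rewrite [r]splitr ltrD.
move=> Lf e0; have mf := Lpf_meas Lf.
(* Truncation in space and in height at once; at each point the sequence is eventually constant. *)
pose f_ n x := if (`|x| < n.+1%:R) && (`|f x| < n.+1%:R) then f x else 0.
have mf_ n : measurable_fun setT (f_ n).
  apply: measurable_fun_ifT => //; apply: measurable_and.
    by apply: measurable_fun_ltr => //; apply: continuous_measurable_rV => x; exact: norm_continuous.
  by apply: measurable_fun_ltr => //; exact: measurableT_comp.
have cf_ x : f_ n x @[n --> \oo] --> f x.
  apply: cvg_near_cst; near=> n; rewrite /f_ ifT//; apply/andP; split.
    near: n; exists (Num.truncn `|x|) => // n /= xn.
    by apply: lt_le_trans (truncnS_gt _) _; rewrite ler_nat.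
  near: n; exists (Num.truncn `|f x|) => // n /= xn.
  by apply: lt_le_trans (truncnS_gt _) _; rewrite ler_nat.
have e20 : 0 < e / 2 by rewrite divr_gt0.
have [|_ /(_ _ e20)[n _ /(_ n (leqnn n)) /= ln]] := Lpn_dominated q1 mf_ cf_ Lf.
  by move=> n x; rewrite /f_; case: ifP; rewrite ?normr0.
have bfn : bounded_supported (f_ n).
  split=> //; exists n.+1%:R, n.+1%:R; split => x; rewrite /f_.
    by case: ifP => [/andP[_ /ltW]|]; rewrite ?normr0.
  by rewrite leNgt => /negbTE ->.
have [phi tphi lphi] := Hbs _ bfn _ e20; exists phi => //.
apply: le_lt_trans (Lpn_distD q1 Lf (bsL _ bfn) (testL _ tphi)) _.
by rewrite [e]splitr ltrD.
Unshelve. all: by end_near. Qed.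

End test_functions_are_rich.

(** * Dispersivity *)

Section second_difference.
Context (R : realType).
Variables m m1 m2 : R -> R.
Hypothesis dm : forall s : R, is_derive s 1 m (m1 s).
Hypothesis dm1 : forall s : R, is_derive s 1 m1 (m2 s).

(** Cauchy's mean value theorem for m(s) + m(-s) against s^2 gives (m'(c) - m'(-c)) / (2 c), and the
    ordinary one on [-c, c] turns this into a value of m''. Continuity of m'' is not assumed. *)
Lemma second_difference_MVT (h : R) : 0 < h ->
  exists2 eta, `|eta| < h & m h + m (- h) - 2 * m 0 = h ^+ 2 * m2 eta.
Proof.
move=> h0.
have dmN (s : R) : is_derive s 1 (fun s => m (- s)) (- m1 (- s)).
  have dN : is_derive s 1 (-%R : R -> R) (-1) by exact: is_deriveNid.
  apply: is_derive_eq (@is_derive1_comp R m -%R s _ _ (dm (- s)) dN) _.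
  by rewrite mulrN1.
have df (s : R) : is_derive s 1 (fun s => m s + m (- s)) (m1 s + - m1 (- s)) by exact: is_deriveD.
have dg (s : R) : is_derive s 1 (fun s : R => s ^+ 2) (2 * s).
  apply: is_derive_eq (is_deriveX 2 (is_derive_id s 1)) _.
  by rewrite /= expr1 /GRing.scale/= mulr1.
have cont (f f' : R -> R) (a b : R) : (forall s : R, is_derive s 1 f (f' s)) -> {within `[a, b], continuous f}.
  by move=> fd; apply: derivable_within_continuous => s _; case: (fd s).
have dg0 s : s \in `]0, h[ -> 2 * s != 0.
  by rewrite in_itv/= => /andP[s0 _]; rewrite mulf_neq0// gt_eqF.
have [c] := cauchy_MVT h0 (cont _ _ 0 h df) (cont _ _ 0 h dg)
  (fun s _ => df s) (fun s _ => dg s) dg0.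
rewrite in_itv/= => /andP[c0 ch] E.
have cc : - c < c by lra.
have [eta] := MVT cc (fun s _ => dm1 s) (cont _ _ (- c) c dm1).
rewrite in_itv/= -ltr_norml => etac E2; exists eta; first exact: lt_trans ch.
move: E; rewrite E2 oppr0 expr0n/= subr0.
have c0' : c != 0 by rewrite gt_eqF.
have h0' : h ^+ 2 != 0 by rewrite expf_neq0// gt_eqF.
move=> /(congr1 (fun z => z * h ^+ 2)); rewrite divfK// => E.
have -> : m h + m (- h) - 2 * m 0 = m h + m (- h) - (m 0 + m 0) by ring.
by rewrite -E; field.
Qed.

End second_difference.

(** * Second differences tested against smooth functions *)

Section translation_derivative.
Context (R : realType) (N : nat).
Local Notation E := 'rV[R]_N.
Local Notation mu := (lebesgue_rV R N).
Implicit Types (u phi : E -> R).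

Lemma is_derive_line (f : E -> R) (x v : E) (s df : R) :
  is_derive (x + s *: v) v f df -> is_derive s 1 (fun r => f (x + r *: v)) df.
Proof.
move=> [dv dE].
have E1 : (fun h : R => h^-1 *: (((fun r => f (x + r *: v)) \o shift s) (h *: (1 : R)) - f (x + s *: v))) =
    (fun h => h^-1 *: ((f \o shift (x + s *: v)) (h *: v) - f (x + s *: v))).
  apply/funext => h /=; congr (_ *: (f _ - _)).
  by rewrite (_ : h *: (1 : R) = h) ?scalerDl 1?addrCA//; exact: mulr1.
by apply: DeriveDef; [rewrite /derivable E1|rewrite /derive E1].
Qed.

(** The translation falls on [phi], so this is differentiable in [s] for [u] merely locally
    integrable. *)
Definition smear u phi i (s : R) : R := \int[mu]_x (u x * phi (x + s *: unitv R i)).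

Lemma is_derive_smear u phi i (s : R) : locally_integrable_rV u -> test_function phi ->
  is_derive s 1 (smear u phi i) (smear u (pderiv [:: i] phi) i s).
Proof.
move=> lu tphi; have tdphi := test_pderiv i tphi.
have [M M0 dM] := test_supported tdphi; have [C dC] := test_bounded tdphi.
pose f (s : R) (x : E) := u x * phi (x + s *: unitv R i).
have dphi x (r : R) : is_derive r 1 (fun r => phi (x + r *: unitv R i)) (pderiv [:: i] phi (x + r *: unitv R i)).
  apply: is_derive_line; apply: DeriveDef => //.
  by apply: diff_derivable; exact: (test_diff tphi).
have df x (r : R) : is_derive r 1 (f ^~ x) (u x * pderiv [:: i] phi (x + r *: unitv R i)).
  exact: is_deriveZ.
have Is : `]s - 1, s + 1[%classic s by rewrite /= in_itv/=; apply/andP; split; lra.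
have intf r : `]s - 1, s + 1[%classic r -> mu.-integrable setT (EFin \o f r).
  by move=> _; apply: bs_mul_integrable => //; apply: test_bs; exact: test_translate.
have derf r x : `]s - 1, s + 1[%classic r -> setT x -> derivable (f ^~ x) r 1.
  by move=> _ _; case: (df x r).
(* The parameter stays within 1 of [s], so all translates in play vanish outside this cube. *)
pose K := M + `|s| + 1.
pose G x := `|u x * (C * \1_(cube K) x)|.
have intG : mu.-integrable setT (EFin \o G).
  apply: (@integrable_norm _ _ _ mu setT (fun x => u x * (C * \1_(cube K) x))).
  apply: bs_mul_integrable => //.
  have := bs_lin C (test_bs (@test0 R N)) (bs_indic (measurable_cube K) (@subset_refl _ (cube K))).
  by under eq_fun do rewrite add0r.
have dE (r : R) x : partial1of2 f r x = u x * pderiv [:: i] phi (x + r *: unitv R i).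
  by rewrite partial1of2E; case: (df x r).
have G_ub (r : R) x : `]s - 1, s + 1[%classic r -> setT x -> `|partial1of2 f r x| <= G x.
  move=> rs _; rewrite dE /G !normrM ler_wpM2l// indicE.
  have [xK|xK] := ltP `|x| K.
    by rewrite mem_set//= normr1 mulr1 (le_trans (dC _))// ler_norm.
  suff Mx : M <= `|x + r *: unitv R i| by rewrite (dM _ Mx) normr0 mulr_ge0.
  have e1 : `|unitv R i| <= 1.
    rewrite /unitv [leLHS]/Num.norm /= mx_normrE; apply/bigmax_leP; split => // j _.
    by rewrite mxE; case: (_ && _); rewrite ?normr1 ?normr0.
  have : `|r *: unitv R i| <= `|r|.
    by rewrite normrZ; rewrite -[leRHS]mulr1; apply: ler_wpM2l.
  have r1 : `|r| <= `|s| + 1.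
    have : `|r - s| <= 1 by move: rs; rewrite /= in_itv/= => /andP[? ?]; rewrite ler_norml; apply/andP; split; lra.
    have := ler_normD (r - s) s; rewrite subrK; lra.
  have := ler_normD (x + r *: unitv R i) (- (r *: unitv R i)); rewrite addrK normrN; move: xK; rewrite /K; lra.
have G0 x : 0 <= G x by exact: normr_ge0.
have d1 := derivable_under_integral measurableT Is intf derf G0 intG G_ub.
have d2 := differentiation_under_integral measurableT Is intf derf G0 intG G_ub.
apply: DeriveDef => //; rewrite -derive1E; apply: etrans d2 _.
by apply: eq_Rintegral => x _; exact: dE.
Qed.

Lemma smear_second u g phi i (s : R) : weak_derivative u [:: i; i] g -> test_function phi ->
  smear u (pderiv [:: i] (pderiv [:: i] phi)) i s = smear g phi i s.
Proof.
move=> [_ h] tphi; have := h _ (test_translate (s *: unitv R i) tphi).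
by rewrite pderiv_translate /= expr2 mulrNN !mul1r.
Qed.

(** Invariance moves the translations from [u] to [phi]; the integral is then a second difference of
    [smear u phi i], whose second derivative is [smear g phi i] by definition of the weak
    derivative. *)
Lemma integral_second_difference u g phi i (h : R) : locally_integrable_rV u ->
  weak_derivative u [:: i; i] g -> test_function phi -> 0 < h ->
  let e := h *: unitv R i in
  exists2 eta, `|eta| < h &
  \int[mu]_x ((u (x + e) + u (x - e) - 2 * u x) * phi x) = h ^+ 2 * smear g phi i eta.
Proof.
move=> lu wd tphi h0 e.
have tdphi := test_pderiv i tphi.
have [eta etah E1] := second_difference_MVT (fun s => is_derive_smear i s lu tphi)
  (fun s => is_derive_smear i s lu tdphi) h0.
exists eta => //; rewrite -(smear_second eta wd tphi) -{}E1.
have mint w : mu.-integrable setT (EFin \o (fun x => u x * phi (x + w))).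
  by apply: bs_mul_integrable => //; apply: test_bs; exact: test_translate.
have tint w : mu.-integrable setT (EFin \o (fun x => u (x + w) * phi x)).
  have := integrable_translate w (mint (- w)).
  by rewrite (_ : (fun x => _) = EFin \o (fun x => u (x + w) * phi x))//; apply/funext => x /=; rewrite addrK.
have trans w : \int[mu]_x (u (x + w) * phi x) = \int[mu]_x (u x * phi (x - w)).
  rewrite -(Rintegral_translate w (mint (- w))).
  by apply: eq_Rintegral => x _; rewrite addrK.
have int0 := bs_mul_integrable lu (test_bs tphi).
rewrite (_ : (fun x => _) = (fun x => (u (x + e) * phi x + u (x - e) * phi x) - 2 * (u x * phi x))); last first.
  by apply/funext => x; ring.
rewrite RintegralB//; last 2 first.
- by apply: integrable_realD; exact: tint.
- exact: integrable_realZ.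
rewrite RintegralD// RintegralZl// !trans opprK.
have -> : smear u phi i (- h) = \int[mu]_x (u x * phi (x - e)).
  by apply: eq_Rintegral => x _; rewrite scaleNr.
have -> : smear u phi i 0 = \int[mu]_x (u x * phi x).
  by apply: eq_Rintegral => x _; rewrite scale0r addr0.
by rewrite [X in X - _ = _]addrC.
Qed.

End translation_derivative.

Section young.
Context (R : realType) (p : R) (p1 : 1 < p).

Lemma conj_exponent : [/\ 1 < p / (p - 1), p^-1 + (p / (p - 1))^-1 = 1 & (p - 1) * (p / (p - 1)) = p].
Proof.
have p10 : 0 < p - 1 by rewrite subr_gt0.
have p0 : p != 0 by rewrite gt_eqF// (lt_trans ltr01).
have p10' : p - 1 != 0 by rewrite gt_eqF.
split.
- by rewrite ltr_pdivlMr// mul1r ltrBlDr ltrDl.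
- by field; rewrite p0 p10'.
- by field; rewrite p10'.
Qed.

(** The exponents are p and p / (p - 1). Any sign of [x] is allowed, since passing to its positive
    part only increases the left side; this is what makes the estimates one-sided. *)
Lemma young_powR (x y : R) : 0 <= y ->
  x * y `^ (p - 1) <= Num.max x 0 `^ p / p + y `^ p * (1 - p^-1).
Proof.
move=> y0; have [q1 pq pq'] := conj_exponent.
have q0 : 0 < p / (p - 1) by rewrite (lt_trans ltr01).
have x0 : 0 <= Num.max x 0 by rewrite le_max lexx orbT.
apply: (@le_trans _ _ (Num.max x 0 * y `^ (p - 1))).
  by rewrite ler_wpM2r ?powR_ge0// le_max lexx.
apply: (le_trans (conjugate_powR x0 (powR_ge0 _ _) (lt_trans ltr01 p1) q0 pq)).
rewrite lerD2l -powRrM pq' (_ : 1 - p^-1 = (p / (p - 1))^-1)//.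
by apply/eqP; rewrite subr_eq addrC; apply/eqP; rewrite pq.
Qed.

End young.

Section dispersivity.
Context (R : realType) (N : nat).
Local Notation E := 'rV[R]_N.
Local Notation mu := (lebesgue_rV R N).
Implicit Types (u g f : E -> R).

Definition ppart u (x : E) : R := Num.max (u x) 0.

Lemma ppart_ge0 u x : 0 <= ppart u x.
Proof. by rewrite /ppart le_max lexx orbT. Qed.

Lemma ppart_le_norm u x : ppart u x <= `|u x|.
Proof. by rewrite /ppart ge_max normr_ge0 ler_norm. Qed.

Lemma measurable_ppart u : measurable_fun setT u -> measurable_fun setT (ppart u).
Proof. by move=> mu'; exact: measurable_maxr. Qed.

Variables (p : R) (p1 : 1 < p).
Let p1' : 1 <= p := ltW p1.
Let p0 : 0 < p := lt_trans ltr01 p1.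

Lemma Lpf_ppart u : Lpf mu p u -> Lpf mu p (ppart u).
Proof.
move=> Lu; apply: (Lpf_le p1' (measurable_ppart (Lpf_meas Lu)) Lu).
by apply: aeW => x; rewrite ger0_norm ?ppart_ge0 ?ppart_le_norm.
Qed.

Lemma ppart_pow_integrable u : Lpf mu p u ->
  mu.-integrable setT (EFin \o (fun x => ppart u x `^ p)).
Proof.
move=> /Lpf_ppart/(LpfP mu _ p1')[_]; under eq_fun do rewrite ger0_norm ?ppart_ge0//.
by [].
Qed.

Lemma mul_ppart_pow u x : u x * ppart u x `^ (p - 1) = ppart u x `^ p.
Proof.
have pp : p - 1 != 0 by rewrite subr_eq0 gt_eqF.
have [u0|u0] := leP 0 (u x).
  by rewrite /ppart max_l// mulr_powRB1.
by rewrite /ppart max_r ?(ltW u0)// !powR0 ?mulr0// gt_eqF.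
Qed.

Lemma Lpf_ppart_pow u : Lpf mu p u -> Lpf mu (p / (p - 1)) (fun x => ppart u x `^ (p - 1)).
Proof.
move=> Lu; have [q1 _ pq] := conj_exponent p1; apply/(LpfP mu _ (ltW q1)); split.
  apply: (measurableT_comp (measurable_powR _)).
  by apply: measurable_ppart; exact: Lpf_meas Lu.
rewrite (_ : (fun x => _) = EFin \o (fun x => ppart u x `^ p)).
  exact: ppart_pow_integrable.
by apply/funext => x /=; rewrite (ger0_norm (powR_ge0 _ _)) -powRrM pq.
Qed.

(** Extends a bound from test functions to L^q with the same constant [C]; the norm of [u], far
    larger in the application, enters only the approximation error. *)
Lemma test_functional_bound (q C : R) u f : 1 < q -> p^-1 + q^-1 = 1 -> Lpf mu p u -> 0 <= C ->
  (forall phi, test_function phi -> `|\int[mu]_x (u x * phi x)| <= C * Lpn mu q phi) ->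
  Lpf mu q f -> `|\int[mu]_x (u x * f x)| <= C * Lpn mu q f.
Proof.
move=> q1 pq Lu C0 h Lf; apply/ler_addgt0Pr => e e0.
(* An approximation at distance d costs at most (C + |u|_p) d; the added 1 makes [D] positive. *)
pose D := Lpn mu p u + C + 1.
have D0 : 0 < D by rewrite ltr_wpDl// addr_ge0// Lpn_ge0.
have [phi tphi lphi] := test_dense (ltW q1) Lf (divr_gt0 e0 D0).
have Lphi : Lpf mu q phi.
  have [mphi [M [K [bK bM]]]] := test_bs tphi.
  exact: bounded_supported_Lpf (ltW q1) mphi bK bM.
have Ld : Lpf mu q (fun x => f x - phi x) by exact: LpfB (ltW q1) Lf Lphi.
have [i1 _] := Lp_hoelder p1 q1 pq Lu Lphi.
have [i2 b2] := Lp_hoelder p1 q1 pq Lu Ld.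
have -> : \int[mu]_x (u x * f x) = \int[mu]_x (u x * phi x) + \int[mu]_x (u x * (f x - phi x)).
  by rewrite -RintegralD//; apply: eq_Rintegral => x _; ring.
have phif : Lpn mu q phi <= Lpn mu q f + Lpn mu q (fun x => f x - phi x).
  rewrite -(Lpn_distC (ltW q1) Lphi Lf); apply: le_trans (LpnD (ltW q1) Lf (LpfB (ltW q1) Lphi Lf)).
  by under [in leRHS]eq_fun do rewrite addrC subrK.
apply: le_trans (ler_normD _ _) _; apply: le_trans (lerD (h _ tphi) b2) _.
set d := Lpn _ _ (fun x => f x - phi x) in lphi phif b2 *.
have d0 : 0 <= d by exact: Lpn_ge0.
have dD : d * D <= e by rewrite -ler_pdivlMr// ltW.
have h1 : C * Lpn mu q phi <= C * (Lpn mu q f + d) by rewrite ler_wpM2l.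
apply: le_trans (lerD h1 (lexx _)) _; rewrite mulrDr -addrA lerD2l.
apply: le_trans dD; rewrite /D !mulrDr mulr1 [d * _]mulrC [d * C]mulrC addrC.
by rewrite lerDl.
Qed.

(** The pairing of the second difference with [psi] is nonpositive for every step, but its link with
    [g] holds only against test functions. Since the second difference has size at most h^2 |g|_p as
    a functional on L^q, [psi] may be replaced by a nearby test function uniformly in h. *)
Lemma laplacian_dispersive i u g : Lpf mu p u -> Lpf mu p g -> weak_derivative u [:: i; i] g ->
  \int[mu]_x (g x * ppart u x `^ (p - 1)) <= 0.
Proof.
move=> Lu Lg wd; have [q1 pq pq'] := conj_exponent p1.
set q := p / (p - 1) in q1 pq pq'.
set psi := fun x => ppart u x `^ (p - 1).
have Lpsi : Lpf mu q psi by exact: Lpf_ppart_pow.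
have lu : locally_integrable_rV u by exact: Lpf_locally_integrable p1' Lu.
pose e h : E := h *: unitv R i.
pose D h x := u (x + e h) + u (x - e h) - 2 * u x.
have LD h : Lpf mu p (D h).
  apply: LpfB => //; last exact: LpfZ.
  by apply: LpfD => //; exact: Lpf_translate.
have testL r phi : 1 < r -> test_function phi -> Lpf mu r phi.
  move=> r1 tphi; have [mphi [M [K [bK bM]]]] := test_bs tphi.
  exact: bounded_supported_Lpf (ltW r1) mphi bK bM.
have smear_bound phi s : test_function phi -> `|smear g phi i s| <= Lpn mu p g * Lpn mu q phi.
  move=> tphi; have := (Lp_hoelder p1 q1 pq Lg (testL _ _ q1 (test_translate (s *: unitv R i) tphi))).2.
  by rewrite Lpn_translate//; exact: test_measurable.
have D_bound h chi : 0 < h -> Lpf mu q chi ->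
    `|\int[mu]_x (D h x * chi x)| <= h ^+ 2 * Lpn mu p g * Lpn mu q chi.
  move=> h0; apply: test_functional_bound => //.
    by rewrite mulr_ge0 ?Lpn_ge0// sqr_ge0.
  move=> phi tphi; have [eta _ ->] := integral_second_difference lu wd tphi h0.
  rewrite normrM (ger0_norm (sqr_ge0 h)) -[leRHS]mulrA ler_wpM2l ?sqr_ge0//.
  exact: smear_bound.
have D_psi h : \int[mu]_x (D h x * psi x) <= 0.
  pose P x := ppart u x `^ p.
  have iP : mu.-integrable setT (EFin \o P) by exact: ppart_pow_integrable.
  have iPt v : mu.-integrable setT (EFin \o (fun x => P (x + v))) by exact: (integrable_translate v iP).
  (* What Young's inequality leaves once u psi = P is used: the terms P (1 - 1/p) combine with -2 P
     into -2 P / p. Its integral vanishes by translation invariance. *)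
  pose B x := (p^-1 * P (x + e h) + p^-1 * P (x - e h)) - 2 * p^-1 * P x.
  have iB1 : mu.-integrable setT (EFin \o (fun x => p^-1 * P (x + e h) + p^-1 * P (x - e h))).
    by apply: integrable_realD; apply: integrable_realZ; exact: iPt.
  have iB2 : mu.-integrable setT (EFin \o (fun x => 2 * p^-1 * P x)) by exact: integrable_realZ.
  have -> : 0 = \int[mu]_x B x.
    rewrite RintegralB// RintegralD//; [|by apply: integrable_realZ; exact: iPt..].
    rewrite !RintegralZl//; [|exact: iPt..].
    by rewrite !Rintegral_translate//; ring.
  apply: le_Rintegral => //.
  - exact: (Lp_hoelder p1 q1 pq (LD h) Lpsi).1.
  - exact: integrable_realB.
  move=> x _.
  have mpp : u x * psi x = P x by exact: mul_ppart_pow.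
  have y1 : u (x + e h) * psi x <= P (x + e h) / p + P x * (1 - p^-1).
    exact: (young_powR p1 (u (x + e h)) (ppart_ge0 u x)).
  have y2 : u (x - e h) * psi x <= P (x - e h) / p + P x * (1 - p^-1).
    exact: (young_powR p1 (u (x - e h)) (ppart_ge0 u x)).
  have -> : D h x * psi x = u (x + e h) * psi x + u (x - e h) * psi x - 2 * P x.
    by rewrite -mpp /D; ring.
  rewrite /B; lra.
rewrite leNgt; apply/negP => I0; set I := \int[mu]_x _ in I0.
pose K := Lpn mu p g + 1.
have K0 : 0 < K by rewrite ltr_wpDl ?Lpn_ge0.
(* The budget: replacing [psi] by [phi] costs at most I / 4, so the smear at 0 is at least 3 I / 4,
   and by continuity it exceeds I / 2 at [eta]; the second difference bounds that value by I / 4. *)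
have [phi tphi lphi] := test_dense (ltW q1) Lpsi (divr_gt0 (divr_gt0 I0 (ltr0n R 4)) K0).
have Lphi := testL _ _ q1 tphi.
have Ld : Lpf mu q (fun x => psi x - phi x) by exact: LpfB (ltW q1) Lpsi Lphi.
set d := Lpn _ _ _ in lphi; have d0 : 0 <= d by exact: Lpn_ge0.
have gd : Lpn mu p g * d <= I / 4.
  rewrite ltr_pdivlMr// in lphi; apply: le_trans (ltW lphi).
  by rewrite mulrC ler_wpM2l// lerDl.
have Iphi : I * (3 / 4) <= smear g phi i 0.
  have -> : smear g phi i 0 = I - \int[mu]_x (g x * (psi x - phi x)).
    rewrite /I -RintegralB//; last 2 first.
    - exact: (Lp_hoelder p1 q1 pq Lg Lpsi).1.
    - exact: (Lp_hoelder p1 q1 pq Lg Ld).1.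
    by apply: eq_Rintegral => x _; rewrite scale0r addr0 -/(psi x); ring.
  have := (Lp_hoelder p1 q1 pq Lg Ld).2; rewrite -/d => b.
  have := le_trans (ler_norm _) b; lra.
have lg : locally_integrable_rV g by exact: Lpf_locally_integrable p1' Lg.
have csm : {for 0, continuous (smear g phi i)}.
  apply/differentiable_continuous/derivable1_diffP.
  by case: (is_derive_smear i (0 : R) lg tphi).
have I4 : 0 < I / 4 by rewrite divr_gt0.
have /nbhs_ballP[h /= h0 hh] : nbhs (0 : R) [set s | `|smear g phi i 0 - smear g phi i s| < I / 4].
  by move/cvgrPdist_lt : csm => /(_ _ I4).
have [eta etah Eeta] := integral_second_difference lu wd tphi h0.
have : `|smear g phi i 0 - smear g phi i eta| < I / 4.
  by apply: hh; rewrite /ball/= sub0r normrN.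
rewrite ltr_norml => /andP[_ s1].
have E1 : \int[mu]_x (D h x * phi x) = \int[mu]_x (D h x * psi x) - \int[mu]_x (D h x * (psi x - phi x)).
  rewrite -RintegralB//; last 2 first.
  - exact: (Lp_hoelder p1 q1 pq (LD h) Lpsi).1.
  - exact: (Lp_hoelder p1 q1 pq (LD h) Ld).1.
  by apply: eq_Rintegral => x _; ring.
have b1 := le_trans (ler_norm _) (D_bound h _ h0 (LpfN (ltW q1) Ld)).
rewrite (LpnN (ltW q1) Ld) -/d -mulrA in b1.
have b1' : - (\int[mu]_x (D h x * (psi x - phi x))) <= h ^+ 2 * (I / 4).
  have -> : - (\int[mu]_x (D h x * (psi x - phi x))) = \int[mu]_x (D h x * - (psi x - phi x)).
    rewrite -mulN1r -RintegralZl//; last exact: (Lp_hoelder p1 q1 pq (LD h) Ld).1.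
    by apply: eq_Rintegral => x _; ring.
  by apply: (le_trans b1); rewrite ler_wpM2l ?sqr_ge0.
have : h ^+ 2 * smear g phi i eta <= h ^+ 2 * (I / 4).
  rewrite -Eeta; have := D_psi h; move: E1; rewrite /D /e => ->; lra.
rewrite ler_pM2l ?exprn_gt0//; lra.
Qed.

End dispersivity.

(** * The coefficients, the domain of the operator and the weighted resolvent estimate *)

Section coefficients.
Context (R : realType) (N : nat) (alpha beta : R).
Hypotheses (alpha0 : 0 <= alpha) (beta0 : 0 <= beta).
Local Notation E := 'rV[R]_N.
Local Notation mu := (lebesgue_rV R N).
Local Notation a := (@diffusion R N alpha).
Local Notation V := (@potential R N beta).

Lemma ler_term_sum (I : finType) (F : I -> R) i : (forall j, 0 <= F j) -> F i <= \sum_j F j.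
Proof. by move=> F0; rewrite (bigD1 i)//= lerDl sumr_ge0. Qed.

Lemma measurable_enorm : measurable_fun setT (@enorm R N).
Proof.
apply: (measurableT_comp (continuous_measurable_fun (@sqrt_continuous R))).
apply: measurable_sum => i; apply: measurable_funX; exact: measurable_rV_coord.
Qed.

Lemma measurable_diffusion : measurable_fun setT a.
Proof.
apply: measurable_funD => //; apply: (measurableT_comp (measurable_powR _)).
exact: measurable_enorm.
Qed.

Lemma measurable_potential : measurable_fun setT V.
Proof. by apply: (measurableT_comp (measurable_powR _)); exact: measurable_enorm. Qed.

Lemma diffusion_ge1 x : 1 <= a x.
Proof. by rewrite /diffusion lerDl powR_ge0. Qed.

Lemma diffusion_gt0 x : 0 < a x.
Proof. exact: lt_le_trans ltr01 (diffusion_ge1 x). Qed.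

Lemma potential_ge0 x : 0 <= V x.
Proof. exact: powR_ge0. Qed.

Lemma enorm_le (M : R) (x : E) : `|x| <= M -> enorm x <= N%:R * M.
Proof.
move=> xM; have M0 : 0 <= M by rewrite (le_trans _ xM).
rewrite /enorm -[leRHS]ger0_norm ?mulr_ge0// -sqrtr_sqr ler_wsqrtr//.
apply: (@le_trans _ _ (\sum_(i < N) M ^+ 2)).
  apply: ler_sum => i _; rewrite -[leLHS]ger0_norm ?sqr_ge0// normrX.
  by rewrite lerXn2r ?nnegrE// (le_trans (coord_le_norm x i)).
rewrite sumr_const card_ord -[leLHS]mulr_natl exprMn ler_wpM2r ?sqr_ge0//.
by case: N => [|n]; rewrite ?expr0n// expr2 ler_peMl ?ler1n.
Qed.

Lemma coefficients_bounded (M : R) :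
  exists K : R, [/\ 0 <= K, forall x, `|x| <= M -> a x <= K & forall x, `|x| <= M -> V x <= K].
Proof.
pose K : R := Num.max (N%:R * M) 0.
have K0 : 0 <= K by rewrite le_max lexx orbT.
have h (g : R) (x : E) : 0 <= g -> `|x| <= M -> enorm x `^ g <= K `^ g.
  move=> g0 xM; apply: ge0_ler_powR => //; rewrite ?nnegrE ?sqrtr_ge0//.
  by rewrite le_max (enorm_le xM).
exists (1 + K `^ alpha + K `^ beta); split.
- by rewrite !addr_ge0// powR_ge0.
- by move=> x xM; rewrite /diffusion -addrA lerD2l (le_trans (h _ _ alpha0 xM))// lerDl powR_ge0.
- by move=> x xM; rewrite (le_trans (h _ _ beta0 xM))// lerDr addr_ge0// powR_ge0.
Qed.

Variables (p : R) (p1 : 1 < p).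
Let p1' : 1 <= p := ltW p1.
Let p0 : 0 < p := lt_trans ltr01 p1.

Section domA_facts.
Variable u : E -> R.
Hypothesis Du : domA alpha beta p u.

Lemma domA_Lp : Lpf mu p u.
Proof. by case: Du => -[]. Qed.

(** Membership in the Sobolev space supplies the existence that makes the [get] in [weakD] return a
    genuine weak derivative. *)
Lemma domA_weakD s : (size s <= 2)%N -> weak_derivative u s (weakD s u).
Proof.
move=> s2; case: Du => -[_ /(_ s s2)[v Lv wv]] _ _ _.
by apply: (getPex (P := weak_derivative u s)); exists v.
Qed.

Lemma measurable_weakD s : (size s <= 2)%N -> measurable_fun setT (weakD s u).
Proof. by move=> /domA_weakD[[]]. Qed.

Lemma weakD2_le_hess i j x : `|weakD [:: i; j] u x| <= hess_norm u x.
Proof.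
rewrite /hess_norm -sqrtr_sqr; apply: ler_wsqrtr.
apply: le_trans (@ler_term_sum _ (fun k => \sum_(l < N) weakD [:: k; l] u x ^+ 2) i _).
  by apply: (@ler_term_sum _ (fun l => weakD [:: i; l] u x ^+ 2)) => l; exact: sqr_ge0.
by move=> k; apply: sumr_ge0 => l _; exact: sqr_ge0.
Qed.

Lemma domA_a_weakD2 i j : Lpf mu p (fun x => a x * weakD [:: i; j] u x).
Proof.
case: Du => _ LH _ _; apply: (Lpf_le p1' _ LH).
  by apply: measurable_funM; [exact: measurable_diffusion|exact: measurable_weakD].
apply: aeW => x; rewrite !normrM ler_wpM2l//.
by rewrite [leRHS]ger0_norm ?sqrtr_ge0 ?weakD2_le_hess.
Qed.

(** As a >= 1, the weighted condition of the domain contains the unweighted one; the chosen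
    representative need not be compared with the one given by [sobolev]. *)
Lemma domA_weakD2 i j : Lpf mu p (weakD [:: i; j] u).
Proof.
apply: (Lpf_le p1' _ (domA_a_weakD2 i j)); first exact: measurable_weakD.
apply: aeW => x; rewrite normrM ler_peMl// (le_trans (diffusion_ge1 x))//.
exact: ler_norm.
Qed.

Lemma Lpf_sum (I : Type) (s : seq I) (f : I -> E -> R) :
  (forall i, Lpf mu p (f i)) -> Lpf mu p (fun x => \sum_(i <- s) f i x).
Proof.
move=> Lf; elim: s => [|i s IH].
  by under eq_fun do rewrite big_nil; exact: Lpf0.
by under eq_fun do rewrite big_cons; exact: LpfD.
Qed.

Lemma domA_opA : Lpf mu p (opA alpha beta u).
Proof.
apply: LpfB => //; last by case: Du.
rewrite /laplacian; under eq_fun do rewrite mulr_sumr.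
by apply: Lpf_sum => i; exact: domA_a_weakD2.
Qed.

Lemma domA_dispersive : \int[mu]_x (laplacian u x * ppart u x `^ (p - 1)) <= 0.
Proof.
have [q1 pq _] := conj_exponent p1.
have int i := (Lp_hoelder p1 q1 pq (domA_weakD2 i i) (Lpf_ppart_pow p1 domA_Lp)).1.
rewrite /laplacian.
have key (s : seq 'I_N) :
    mu.-integrable setT (EFin \o (fun x => (\sum_(i <- s) weakD [:: i; i] u x) * ppart u x `^ (p - 1))) /\
    \int[mu]_x ((\sum_(i <- s) weakD [:: i; i] u x) * ppart u x `^ (p - 1)) <= 0.
  elim: s => [|i s [IH1 IH2]].
    under eq_fun do rewrite big_nil mul0r; split; first exact: integrable0.
    by rewrite /Rintegral integral0.
  under eq_fun do rewrite big_cons mulrDl; split; first exact: integrable_realD.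
  rewrite RintegralD//.
  rewrite -[leRHS]addr0 lerD//.
  apply: (laplacian_dispersive p1 domA_Lp (domA_weakD2 i i)).
  exact: domA_weakD.
exact: (key _).2.
Qed.

End domA_facts.

(** Its p-th power is 1 / a, so the norm of L^p(dx / a) is written with Lebesgue measure and the
    lemmas on [Lpn] apply as they are. *)
Definition weight (x : E) : R := a x `^ (- p^-1).

Lemma measurable_weight : measurable_fun setT weight.
Proof. by apply: (measurableT_comp (measurable_powR _)); exact: measurable_diffusion. Qed.

Lemma weight_gt0 x : 0 < weight x.
Proof. by rewrite powR_gt0// diffusion_gt0. Qed.

Lemma weight_le1 x : weight x <= 1.
Proof.
rewrite /weight powRN invf_le1 ?powR_gt0 ?diffusion_gt0//.
apply: (@le_trans _ _ (1 `^ p^-1)); first by rewrite powR1.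
rewrite ge0_ler_powR ?nnegrE ?invr_ge0 ?(ltW p0) ?(ltW (diffusion_gt0 x))//.
exact: diffusion_ge1.
Qed.

Lemma weight_pow x : weight x `^ p = (a x)^-1.
Proof.
by rewrite /weight -powRrM mulNr mulVf ?gt_eqF// powR_inv1// ltW// diffusion_gt0.
Qed.

(* In L^p(dx / a) the unbounded coefficient in front of the Laplacian cancels. *)
Definition wplus (f : E -> R) : R := Lpn mu p (fun x => weight x * ppart f x).

Lemma Lpf_wplus f : Lpf mu p f -> Lpf mu p (fun x => weight x * ppart f x).
Proof.
move=> Lf; apply: (Lpf_le p1' _ Lf).
  apply: measurable_funM; first exact: measurable_weight.
  by apply: measurable_ppart; exact: Lpf_meas Lf.
apply: aeW => x; rewrite normrM (gtr0_norm (weight_gt0 x)) (ger0_norm (ppart_ge0 f x)).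
by rewrite -[leRHS]mul1r ler_pM ?ppart_ge0 ?weight_le1 ?ppart_le_norm// ltW// weight_gt0.
Qed.

Lemma wplus_le f g : Lpf mu p f -> Lpf mu p g -> {ae mu, forall x, f x <= g x} ->
  wplus f <= wplus g.
Proof.
move=> Lf Lg fg; apply: Lpn_le => //; [exact: Lpf_wplus|exact: Lpf_wplus|].
apply: filterS fg => x fgx.
rewrite !normrM ler_wpM2l// !(ger0_norm (ppart_ge0 _ x)) /ppart.
by rewrite ge_max !le_max fgx lexx orbT.
Qed.

Lemma wplus_le_norm f : Lpf mu p f -> wplus f <= Lpn mu p f.
Proof.
move=> Lf; apply: Lpn_le => //; first exact: Lpf_wplus.
apply: aeW => x; rewrite normrM (gtr0_norm (weight_gt0 x)) (ger0_norm (ppart_ge0 f x)).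
by rewrite -[leRHS]mul1r ler_pM ?ppart_ge0 ?weight_le1 ?ppart_le_norm// ltW// weight_gt0.
Qed.

Lemma wplusD f g : Lpf mu p f -> Lpf mu p g ->
  wplus (fun x => f x + g x) <= wplus f + wplus g.
Proof.
move=> Lf Lg; have [Lf' Lg'] := (Lpf_wplus Lf, Lpf_wplus Lg).
apply: le_trans (LpnD p1' Lf' Lg'); apply: Lpn_le => //.
- by apply: Lpf_wplus; exact: LpfD.
- exact: LpfD.
apply: aeW => x; rewrite -mulrDr !normrM ler_wpM2l// (ger0_norm (ppart_ge0 _ x)).
rewrite ger0_norm ?addr_ge0 ?ppart_ge0// /ppart ge_max addr_ge0 ?ppart_ge0 ?andbT//.
by rewrite lerD// le_max lexx.
Qed.

Lemma wplus_eq0 f : Lpf mu p f -> wplus f = 0 -> {ae mu, forall x, f x <= 0}.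
Proof.
move=> Lf /(Lpn_eq0 p1' (Lpf_wplus Lf)); apply: filterS => x /(_ I) /eqP.
rewrite mulf_eq0 (gt_eqF (weight_gt0 x))/= /ppart => /eqP h.
by rewrite -h le_max lexx.
Qed.

Lemma wplus_nonpos f : {ae mu, forall x, f x <= 0} -> Lpf mu p f -> wplus f = 0.
Proof.
move=> f0 Lf; apply/eqP; rewrite eq_le Lpn_ge0 andbT.
apply: (le_trans (wplus_le Lf (Lpf0 mu p1') f0)).
rewrite /wplus (_ : (fun x => _) = (fun=> 0)) ?Lpn0//.
by apply/funext => x; rewrite /ppart maxxx mulr0.
Qed.

Lemma wplus_powR f : Lpf mu p f -> wplus f `^ p = \int[mu]_x ((a x)^-1 * ppart f x `^ p).
Proof.
move=> Lf; rewrite Lpn_powR//; last exact: Lpf_wplus.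
apply: eq_Rintegral => x _; rewrite ger0_norm ?mulr_ge0 ?ppart_ge0 ?ltW ?weight_gt0//.
by rewrite powRM ?ppart_ge0 ?weight_pow// ltW// weight_gt0.
Qed.

Lemma wplus_integrable f : Lpf mu p f ->
  mu.-integrable setT (EFin \o (fun x => (a x)^-1 * ppart f x `^ p)).
Proof.
move=> Lf; have [_ h] := (LpfP mu _ p1').1 (Lpf_wplus Lf).
rewrite (_ : EFin \o _ = (fun x => (`|weight x * ppart f x| `^ p)%:E))//.
apply/funext => x /=; rewrite ger0_norm ?mulr_ge0 ?ppart_ge0 ?ltW ?weight_gt0//.
by rewrite powRM ?ppart_ge0 ?weight_pow// ltW// weight_gt0.
Qed.

(** With y = u - l A u, multiply by (u^+)^(p-1) / a and apply Young's inequality to y (u^+)^(p-1).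
    The diffusion coefficient disappears from the Laplacian term, whose integral is nonpositive by
    [domA_dispersive]. *)
Lemma wplus_resolvent (l : R) u : 0 <= l -> domA alpha beta p u ->
  wplus u <= wplus (fun x => u x - l * opA alpha beta u x).
Proof.
move=> l0 Du; have Lu := domA_Lp Du.
have Ly : Lpf mu p (fun x => u x - l * opA alpha beta u x).
  by apply: LpfB => //; apply: LpfZ => //; exact: domA_opA.
set y := fun x => _ in Ly *.
have [q1 pq _] := conj_exponent p1.
have LL : Lpf mu p (laplacian u) by apply: Lpf_sum => i; exact: domA_weakD2.
have iL := (Lp_hoelder p1 q1 pq LL (Lpf_ppart_pow p1 Lu)).1.
have iu := wplus_integrable Lu; have iy := wplus_integrable Ly.
have ip : p^-1 != 0 by rewrite invr_eq0 gt_eqF.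
have : \int[mu]_x (p^-1 * ((a x)^-1 * ppart u x `^ p)) <=
       \int[mu]_x (p^-1 * ((a x)^-1 * ppart y x `^ p) + l * (laplacian u x * ppart u x `^ (p - 1))).
  apply: le_Rintegral => //.
  - exact: integrable_realZ.
  - by apply: integrable_realD; exact: integrable_realZ.
  move=> x _.
  have Y : y x * ppart u x `^ (p - 1) <= ppart y x `^ p / p + ppart u x `^ p * (1 - p^-1).
    exact: (young_powR p1 (y x) (ppart_ge0 u x)).
  have mpp := mul_ppart_pow p1 u x.
  have a0 := diffusion_gt0 x; have v0 := potential_ge0 x.
  have P0 : 0 <= ppart u x `^ p by exact: powR_ge0.
  have yE : y x = u x - l * (a x * laplacian u x - V x * u x) by [].
  move: Y mpp yE P0.
  set w := ppart u x `^ (p - 1); set P := ppart u x `^ p; set Q := ppart y x `^ p.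
  set L := laplacian u x => Y mpp yE P0.
  have Y2 : P - l * (a x * (L * w)) + l * (V x * P) <= Q / p + P * (1 - p^-1).
    by apply: le_trans Y; rewrite yE -mpp le_eqVlt; apply/orP; left; apply/eqP; ring.
  (* The potential contributes l V P >= 0 on the smaller side and is dropped. *)
  have Y3 : P / p <= Q / p + l * (a x * (L * w)).
    have : 0 <= l * (V x * P) by rewrite !mulr_ge0.
    lra.
  rewrite -(ler_pM2l a0) mulrDr.
  rewrite [leLHS](_ : _ = P / p); last by field; rewrite !gt_eqF.
  by apply: le_trans Y3 _; rewrite le_eqVlt; apply/orP; left; apply/eqP; field; rewrite !gt_eqF.
rewrite RintegralD//; [|exact: integrable_realZ|exact: integrable_realZ].
rewrite !RintegralZl// -!wplus_powR// => h.
have := domA_dispersive Du => D0.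
have : wplus u `^ p <= wplus y `^ p.
  rewrite -(ler_pM2l (_ : 0 < p^-1)) ?invr_gt0//; apply: (le_trans h).
  by rewrite gerDl mulr_ge0_le0.
apply: contraTT; rewrite -!ltNge => lt; apply: gt0_ltr_powR => //; rewrite ?nnegrE; exact: Lpn_ge0.
Qed.

End coefficients.

(** * Functions of class C^2 with compact support *)

Section C2c.
Context (R : realType) (N : nat).
Local Notation E := 'rV[R]_N.
Local Notation mu := (lebesgue_rV R N).
Implicit Types (u v f phi : E -> R).

Definition cont_supported f := continuous f /\ exists M : R, supported_in M f.

Lemma cs_bs f : cont_supported f -> bounded_supported f.
Proof.
move=> [cf [M fM]]; split; first exact: continuous_measurable_rV.
by have [C fC] := continuous_supported_bounded cf fM; exists M, C.
Qed.

Lemma cs_Lpf p f : 1 <= p -> cont_supported f -> Lpf mu p f.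
Proof.
by move=> p1 /cs_bs[mf [M [C [fC fM]]]]; exact: bounded_supported_Lpf fC fM.
Qed.

Lemma test_cs phi : test_function phi -> cont_supported phi.
Proof.
move=> t; split; first exact: test_continuous.
by have [M _ phiM] := test_supported t; exists M.
Qed.

(* Translation invariance makes the integral of a difference quotient vanish. *)
Lemma integral_derivative_eq0 f f' i : cont_supported f -> cont_supported f' ->
  (forall x, is_derive x (unitv R i) f (f' x)) -> \int[mu]_x f' x = 0.
Proof.
move=> csf csf' df.
have [mf [M [C [fC fM]]]] := cs_bs csf.
have [mf' [M' [C' [fC' fM']]]] := cs_bs csf'.
have intf : mu.-integrable setT (EFin \o f) by exact: bounded_supported_integrable fC fM.
pose h n : R := n.+1%:R^-1.
have h0 n : 0 < h n by rewrite invr_gt0.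
have h1 n : h n <= 1 by rewrite invf_le1// ler1n.
have e1 : `|unitv R i| <= 1.
  rewrite /unitv [leLHS]/Num.norm /= mx_normrE; apply/bigmax_leP; split => // j _.
  by rewrite mxE; case: (_ && _); rewrite ?normr1 ?normr0.
pose q n x := (h n)^-1 * (f (x + h n *: unitv R i) - f x).
have intq n : \int[mu]_x q n x = 0.
  have it := integrable_translate (h n *: unitv R i) intf.
  rewrite RintegralZl//; last exact: integrable_realB it intf.
  by rewrite RintegralB// Rintegral_translate// subrr mulr0.
(* The steps [h n] are at most 1, so every difference quotient vanishes outside this cube; inside,
   the mean value theorem bounds it by [C']. *)
pose K := Num.max M M' + 1.
have lim : \int[mu]_x q n x @[n --> \oo] --> \int[mu]_x f' x.
  apply: (Rintegral_dominated (g := fun x => C' * \1_(cube K) x)).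
  - move=> n; apply: measurable_funM => //; apply: measurable_funB => //.
    exact: (measurableT_comp mf (measurable_translate _)).
  - move=> x; have [dx dE] := df x.
    have : (fun t : R => t^-1 *: ((f \o shift x) (t *: unitv R i) - f x)) @ 0^' --> f' x.
      by rewrite -dE; exact: dx.
    move=> /cvgr_dnbhsP/(_ h) /= H.
    have -> : q ^~ x = (fun n => (h n)^-1 *: (f (h n *: unitv R i + x) - f x)).
      by apply/funext => n; rewrite /q [x + _]addrC.
    apply: H; split; first by move=> n; rewrite gt_eqF.
    exact: cvg_harmonic.
  - have := bs_lin C' (test_bs (@test0 R N)) (bs_indic (measurable_cube K) (@subset_refl _ (cube K))).
    move=> [mg [Mg [Cg [gC gM]]]].
    have := bounded_supported_integrable mg gC gM.
    by under eq_fun do rewrite add0r.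
  - move=> n x; rewrite indicE; have [xK|xK] := ltP `|x| K.
      rewrite mem_set//= mulr1 /q normrM gtr0_norm ?invr_gt0// ler_pdivrMl//.
      have dl (r : R) : is_derive r 1 (fun r => f (x + r *: unitv R i)) (f' (x + r *: unitv R i)).
        exact: is_derive_line.
      have [|c _] := MVT (h0 n) (fun r _ => dl r) _.
        by apply: derivable_within_continuous => r _; case: (dl r).
      rewrite scale0r addr0 subr0 => ->; rewrite normrM (gtr0_norm (h0 n)) mulrC.
      by rewrite ler_wpM2l// ltW.
    rewrite memNset ?mulr0; last by rewrite /cube/= ltNge xK.
    have he : `|h n *: unitv R i| <= 1.
      by rewrite normrZ gtr0_norm// -[leRHS]mulr1 ler_pM// ltW.
    rewrite /q !fM ?subrr ?mulr0 ?normr0//; rewrite /K in xK.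
      by have : M <= Num.max M M' by [rewrite le_max lexx]; lra.
    have : M <= Num.max M M' by rewrite le_max lexx.
    have := ler_normD (x + h n *: unitv R i) (- (h n *: unitv R i)); rewrite addrK normrN; lra.
have : \int[mu]_x q n x @[n --> \oo] --> (0 : R).
  by under eq_fun do rewrite intq; exact: cvg_cst.
by move=> /(cvg_lim (@Rhausdorff R)) <-; rewrite (cvg_lim (@Rhausdorff R) lim).
Qed.

Lemma csM u phi : continuous u -> cont_supported phi -> cont_supported (fun x => u x * phi x).
Proof.
move=> cu [cphi [M phiM]]; split; last by exists M => x Mx; rewrite phiM// mulr0.
by move=> x; apply: continuousM; [exact: cu|exact: cphi].
Qed.

Lemma integration_by_parts u v phi i : cont_supported u -> cont_supported v ->
  (forall x, is_derive x (unitv R i) u (v x)) -> test_function phi ->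
  \int[mu]_x (u x * pderiv [:: i] phi x) = - \int[mu]_x (v x * phi x).
Proof.
move=> csu csv du tphi; have tdphi := test_pderiv i tphi.
have int1 : mu.-integrable setT (EFin \o (fun x => u x * pderiv [:: i] phi x)).
  have [m [M [C [h1 h2]]]] := cs_bs (csM csu.1 (test_cs tdphi)).
  exact: bounded_supported_integrable h1 h2.
have int2 : mu.-integrable setT (EFin \o (fun x => v x * phi x)).
  have [m [M [C [h1 h2]]]] := cs_bs (csM csv.1 (test_cs tphi)).
  exact: bounded_supported_integrable h1 h2.
apply/eqP; rewrite -addr_eq0 -RintegralD//; apply/eqP.
apply: (@integral_derivative_eq0 (fun x => u x * phi x) _ i).
- exact: csM csu.1 (test_cs tphi).
- have [c1 [M1 s1]] := csM csu.1 (test_cs tdphi).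
  have [c2 [M2 s2]] := csM csv.1 (test_cs tphi).
  split; first by move=> x; have := continuousD (c1 x) (c2 x).
  by exists (Num.max M1 M2) => x; rewrite ge_max => /andP[? ?]; rewrite s1// s2// addr0.
move=> x; apply: is_derive_eq (is_deriveM (du x) _) _.
  apply: DeriveDef => //; apply: diff_derivable; exact: (test_diff tphi).
by rewrite /GRing.scale/= [phi x * _]mulrC.
Qed.

(* [C2c u u1 u2]: [u] has compact support and continuous partial derivatives
   [u1 i] along [e_i] and [u2 j i] of [u1 i] along [e_j]. *)
Definition C2c u (u1 : 'I_N -> E -> R) (u2 : 'I_N -> 'I_N -> E -> R) :=
  [/\ cont_supported u, forall i, cont_supported (u1 i), forall i j, cont_supported (u2 i j),
    forall i x, is_derive x (unitv R i) u (u1 i x) &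
    forall i j x, is_derive x (unitv R j) (u1 i) (u2 j i x)].

Lemma cs_locally_integrable f : cont_supported f -> locally_integrable_rV f.
Proof. by move=> h; apply: (Lpf_locally_integrable (lexx 1)); exact: cs_Lpf. Qed.

(** In [pderiv [:: i; j] phi] the derivative along i is outermost, hence the first to be moved onto
    [u]: this is why the indices of [u2] come out swapped, with no appeal to the symmetry of second
    derivatives. *)
Lemma C2c_weak u (u1 : 'I_N -> E -> R) (u2 : 'I_N -> 'I_N -> E -> R) : C2c u u1 u2 ->
  [/\ weak_derivative u [::] u, forall i, weak_derivative u [:: i] (u1 i) &
      forall i j, weak_derivative u [:: i; j] (u2 j i)].
Proof.
move=> [c0 c1 c2 d1 d2]; split=> [|i|i j]; split; try exact: cs_locally_integrable.
- by move=> phi _; rewrite expr0 mul1r.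
- by move=> phi tphi; rewrite (integration_by_parts c0 (c1 i) (d1 i) tphi) expr1 mulN1r.
- move=> phi tphi.
  have := integration_by_parts c0 (c1 i) (d1 i) (test_pderiv j tphi).
  rewrite (integration_by_parts (c1 i) (c2 j i) (d2 i j) tphi) opprK => h.
  by rewrite /= expr2 mulrNN !mul1r -h.
Qed.

Lemma weak_derivative_unique u s v w : weak_derivative u s v -> weak_derivative u s w ->
  v = w %[ae mu].
Proof.
move=> [lv hv] [lw hw].
have [[mv iv] [mw iw]] := ((locally_integrableP v).1 lv, (locally_integrableP w).1 lw).
have ld : locally_integrable_rV (fun x => v x - w x).
  apply/locally_integrableP; split; first exact: measurable_funB.
  by move=> M; have := integrableB (measurable_cube M) (iv M) (iw M).
have : {ae mu, forall x, v x - w x = 0}.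
  apply: weak_zero => // phi tphi.
  have := hv _ tphi; rewrite (hw _ tphi) => /(mulfI (_ : (-1) ^+ size s != 0 :> R)) h.
  rewrite (_ : (fun x => _) = (fun x => v x * phi x - w x * phi x)); last by apply/funext => x; ring.
  rewrite RintegralB//; [|exact: bs_mul_integrable lv (test_bs tphi)|exact: bs_mul_integrable lw (test_bs tphi)].
  by rewrite h ?subrr// signr_eq0.
by apply: filterS => x h _; apply/eqP; rewrite -subr_eq0 h.
Qed.

Lemma weakD_unique u s v : weak_derivative u s v -> weakD s u = v %[ae mu].
Proof.
move=> wv; apply: (weak_derivative_unique _ wv).
by apply: (getPex (P := weak_derivative u s)); exists v.
Qed.

Lemma weakD_measurable u s v : weak_derivative u s v -> measurable_fun setT (weakD s u).
Proof.
by move=> wv; have [[]] : weak_derivative u s (weakD s u)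
  by apply: (getPex (P := weak_derivative u s)); exists v.
Qed.

End C2c.

(** * Functions of class C^2 with compact support lie in the domain *)

Section C2c_domain.
Context (R : realType) (N : nat) (alpha beta : R).
Hypotheses (alpha0 : 0 <= alpha) (beta0 : 0 <= beta).
Local Notation E := 'rV[R]_N.
Local Notation mu := (lebesgue_rV R N).
Local Notation a := (@diffusion R N alpha).
Local Notation V := (@potential R N beta).
Variables (p : R) (p1 : 1 < p).
Let p1' : 1 <= p := ltW p1.

Lemma ae_ord (P : 'I_N -> E -> Prop) : (forall i, {ae mu, forall x, P i x}) ->
  {ae mu, forall x, forall i, P i x}.
Proof.
move=> h; have H n : {ae mu, forall x, forall i : 'I_N, val i = n -> P i x}.
  have [nN|nN] := ltnP n N.
    apply: filterS (h (Ordinal nN)) => x Px i iE.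
    by rewrite (_ : i = Ordinal nN)//; exact/val_inj.
  by apply: aeW => x i iE; move: nN; rewrite -iE leqNgt ltn_ord.
by apply: filterS (ae_foralln H) => x hx i; exact: (hx i).
Qed.

(** Here [g] will be built from chosen weak derivatives, which vanish outside a cube only up to a
    null set; hence a domination by [k] almost everywhere in place of a support condition on [g]. *)
Lemma locally_bounded_Lpf (c g : E -> R) (k : E -> R) (M K : R) : measurable_fun setT c ->
  measurable_fun setT g -> (forall x, `|x| <= M -> `|c x| <= K) ->
  Lpf mu p k -> supported_in M k -> {ae mu, forall x, `|g x| <= `|k x|} ->
  Lpf mu p (fun x => c x * g x).
Proof.
move=> mc mg cK Lk kM gk; apply: (Lpf_le p1' _ (LpfZ K p1' Lk)).
  exact: measurable_funM.
apply: filterS gk => x gx; rewrite !normrM.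
have [xM|xM] := leP `|x| M.
  by rewrite ler_pM// (le_trans (cK _ xM))// ler_norm.
move: gx; rewrite kM ?(ltW xM)// normr0 normr_le0 => /eqP ->.
by rewrite normr0 !mulr0.
Qed.

Lemma cs_common_support (I : finType) (f : I -> E -> R) : (forall i, cont_supported (f i)) ->
  exists M : R, forall i, supported_in M (f i).
Proof.
move=> h; have /choice[M hM] : forall i, exists M : R, supported_in M (f i).
  by move=> i; case: (h i).
exists (\big[Num.max/0]_i M i) => i x Mx; apply: hM; apply: le_trans Mx.
exact: le_bigmax.
Qed.

Lemma C2c_domA (u : E -> R) u1 u2 : C2c u u1 u2 ->
  domA alpha beta p u /\
  opA alpha beta u = (fun x => a x * (\sum_(i < N) u2 i i x) - V x * u x) %[ae mu].
Proof.
move=> C; have [c0 c1 c2 _ _] := C; have [w0 w1 w2] := C2c_weak C.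
have ae1 : {ae mu, forall x, forall i, weakD [:: i] u x = u1 i x}.
  by apply: ae_ord => i; apply: filterS (weakD_unique (w1 i)) => x /(_ I).
have ae2 : {ae mu, forall x, forall i j, weakD [:: i; j] u x = u2 j i x}.
  apply: ae_ord => i; apply: ae_ord => j.
  by apply: filterS (weakD_unique (w2 i j)) => x /(_ I).
have [M1 s1] := cs_common_support c1.
have [M2 s2] := cs_common_support (fun ij : 'I_N * 'I_N => c2 ij.1 ij.2).
have [_ [M0 s0]] := c0.
have sq (m : E -> R) : measurable_fun setT m -> measurable_fun setT (fun x : E => Num.sqrt (m x) : R).
  by move=> mm; exact: (measurableT_comp (continuous_measurable_fun (@sqrt_continuous R)) mm).
have abs_sq (x : R) : Num.sqrt (x ^+ 2) = `|x| by exact: sqrtr_sqr.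
(* Sums of absolute values serve as dominating functions, since they visibly lie in L^p and keep the
   common support. *)
have l1 (I : finType) (F : I -> R) : Num.sqrt (\sum_i F i ^+ 2) <= \sum_i `|F i|.
  have s0' : 0 <= \sum_i `|F i| by apply: sumr_ge0.
  rewrite -[leRHS]ger0_norm// -sqrtr_sqr; apply: ler_wsqrtr.
  rewrite expr2 mulr_suml; apply: ler_sum => i _.
  rewrite -[leLHS]ger0_norm ?sqr_ge0// normrX expr2 ler_wpM2l//.
  exact: (@ler_term_sum R I (fun j => `|F j|)).
split; first split.
- split; first exact: cs_Lpf p1' c0.
  case=> [|i [|j [|]]]//= _.
  + by exists u => //; exact: cs_Lpf p1' c0.
  + by exists (u1 i) => //; exact: cs_Lpf p1' (c1 i).
  + by exists (u2 j i) => //; exact: cs_Lpf p1' (c2 j i).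
- have [K [_ aK _]] := coefficients_bounded N alpha0 beta0 M2.
  apply: (locally_bounded_Lpf (M := M2) (K := K) (k := fun x => \sum_i \sum_j `|u2 j i x|)).
  + exact: measurable_diffusion.
  + apply: sq; apply: measurable_sum => i; apply: measurable_sum => j.
    by apply: measurable_funX; exact: weakD_measurable (w2 i j).
  + by move=> x xM; rewrite gtr0_norm ?diffusion_gt0 ?aK.
  + by apply: Lpf_sum => // i; apply: Lpf_sum => // j; apply: Lpf_norm => //; exact: cs_Lpf p1' (c2 _ _).
  + by move=> x Mx; apply: big1 => i _; apply: big1 => j _; rewrite (s2 (j, i))// normr0.
  + apply: filterS ae2 => x hx; rewrite /hess_norm.
    rewrite pair_big/= ger0_norm ?sqrtr_ge0//.
    apply: le_trans (l1 _ (fun ij : 'I_N * 'I_N => weakD [:: ij.1; ij.2] u x)) _.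
    rewrite pair_big/= ger0_norm ?sumr_ge0//.
    by apply: ler_sum => -[i j] _; rewrite hx.
- have [K [K0 aK _]] := coefficients_bounded N alpha0 beta0 M1.
  apply: (locally_bounded_Lpf (M := M1) (K := Num.sqrt K) (k := fun x => \sum_i `|u1 i x|)).
  + by apply: sq; exact: measurable_diffusion.
  + apply: sq; apply: measurable_sum => i.
    by apply: measurable_funX; exact: weakD_measurable (w1 i).
  + by move=> x xM; rewrite ger0_norm ?sqrtr_ge0// ler_wsqrtr// aK.
  + by apply: Lpf_sum => // i; apply: Lpf_norm => //; exact: cs_Lpf p1' (c1 _).
  + by move=> x Mx; apply: big1 => i _; rewrite s1// normr0.
  + apply: filterS ae1 => x hx; rewrite /grad_norm ger0_norm ?sqrtr_ge0//.
    apply: le_trans (l1 _ (fun i => weakD [:: i] u x)) _.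
    rewrite ger0_norm ?sumr_ge0//.
    by apply: ler_sum => i _; rewrite hx.
- have [K [_ _ VK]] := coefficients_bounded N alpha0 beta0 M0.
  apply: (locally_bounded_Lpf (M := M0) (K := K) (k := u)) => //.
  + exact: measurable_potential.
  + by case: (cs_bs c0).
  + by move=> x xM; rewrite ger0_norm ?potential_ge0 ?VK.
  + exact: cs_Lpf p1' c0.
  + exact: aeW.
apply: filterS ae2 => x hx _; rewrite /opA /laplacian; congr (_ * _ - _).
by apply: eq_bigr => i _; rewrite hx.
Qed.

Lemma test_C2c (phi : E -> R) : test_function phi ->
  C2c phi (fun i => pderiv [:: i] phi) (fun j i => pderiv [:: j; i] phi).
Proof.
move=> t; split.
- exact: test_cs.
- by move=> i; apply: test_cs; exact: test_pderiv.
- by move=> i j; apply: test_cs; exact: (test_pderiv i (test_pderiv j t)).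
- by move=> i x; apply: DeriveDef => //; apply: diff_derivable; exact: test_diff t x.
- move=> i j x; apply: DeriveDef => //; apply: diff_derivable.
  exact: test_diff (test_pderiv i t) x.
Qed.

End C2c_domain.

(** * Semigroups on L^p *)

Section Lp_complete.
Context d (X : measurableType d) (R : realType).
Variable mu : {measure set X -> \bar R}.
Variables (p : R) (p1 : 1 <= p).
Let p0 : 0 < p := lt_le_trans ltr01 p1.

(** The core of the Riesz-Fischer theorem: Minkowski bounds the partial sums in L^p, and monotone
    convergence of their p-th powers makes the supremum finite almost everywhere. *)
Lemma Lpf_sum_bound (f_ : nat -> X -> R) (C : R) : (forall k, Lpf mu p (f_ k)) ->
  (forall n, \sum_(k < n) Lpn mu p (f_ k) <= C) ->
  exists2 G, Lpf mu p G & {ae mu, forall x, forall n, \sum_(k < n) `|f_ k x| <= G x}.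
Proof.
move=> Lf fC.
pose G n x := \sum_(k < n) `|f_ k x|.
have G0 n x : 0 <= G n x by exact: sumr_ge0.
have LG n : Lpf mu p (G n) /\ Lpn mu p (G n) <= \sum_(k < n) Lpn mu p (f_ k).
  elim: n => [|n [IH1 IH2]].
    by rewrite /G; under eq_fun do rewrite big_ord0; rewrite big_ord0 Lpn0//; split => //; exact: Lpf0.
  rewrite (_ : G n.+1 = fun x => G n x + `|f_ n x|); last by apply/funext => x; rewrite /G big_ord_recr.
  have Ln := Lpf_norm p1 (Lf n).
  split; first exact: LpfD.
  rewrite big_ord_recr/=; apply: le_trans (LpnD p1 IH1 Ln) _; rewrite lerD//.
  by apply: Lpn_le => //; apply: aeW => x; rewrite normr_id.
pose g n x : \bar R := (G n x `^ p)%:E.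
have mg n : measurable_fun setT (g n).
  apply/measurable_EFinP; apply: (measurableT_comp (measurable_powR _)).
  exact: Lpf_meas (LG n).1.
have g0 n x : setT x -> (0 <= g n x)%E by move=> _; rewrite lee_fin powR_ge0.
have ndg x : setT x -> {homo g^~ x : n m / (n <= m)%N >-> (n <= m)%E}.
  move=> _ n m nm; rewrite lee_fin ge0_ler_powR ?nnegrE ?(ltW p0)//.
  rewrite -(subnK nm); elim: (m - n)%N => // k IH; rewrite addSn; apply: le_trans IH _.
  by rewrite /G big_ord_recr/= lerDl.
have C0 : 0 <= C by have := fC 0%N; rewrite big_ord0.
have intg n : (\int[mu]_x g n x <= (C `^ p)%:E)%E.
  have [L1 L2] := LG n; have [_ i1] := (LpfP mu _ p1).1 L1.
  rewrite (_ : g n = fun x => (`|G n x| `^ p)%:E); last by apply/funext => x; rewrite ger0_norm.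
  rewrite -(fineK (integrable_fin_num measurableT i1)) lee_fin.
  rewrite -[fine _](Lpn_powR p1 L1); apply: ge0_ler_powR; rewrite ?nnegrE ?Lpn_ge0 ?(ltW p0)//.
  exact: le_trans L2 (fC n).
pose gl x := limn (g^~ x).
have mgl : measurable_fun setT gl.
  by apply: (emeasurable_fun_cvg g) => // x _; apply: ereal_nondecreasing_is_cvgn; exact: ndg.
have gl0 x : (0 <= gl x)%E.
  apply: lime_ge; first by apply: ereal_nondecreasing_is_cvgn; exact: ndg.
  by apply: nearW => n; exact: g0.
have intgl : (\int[mu]_x gl x <= (C `^ p)%:E)%E.
  rewrite (monotone_convergence mu measurableT mg g0 ndg).
  apply: lime_le; last exact: nearW.
  apply: ereal_nondecreasing_is_cvgn => n m nm; apply: ge0_le_integral => //.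
    exact: g0.
  by move=> x _; exact: ndg.
have igl : mu.-integrable setT gl.
  apply/integrableP; split => //.
  under eq_integral do rewrite gee0_abs//.
  by apply: le_lt_trans intgl _; rewrite ltry.
(* Where the limit is infinite [fine] returns 0; this happens on a null set, so the bound is claimed
   only almost everywhere. *)
pose H x := fine (gl x) `^ p^-1.
exists H.
  apply/LpfP => //; split.
    apply: (measurableT_comp (measurable_powR _)).
    exact: (measurableT_comp (fine_measurable _) mgl).
  have -> : (fun x => (`|H x| `^ p)%:E) = (fun x => (fine (gl x))%:E).
    apply/funext => x; rewrite ger0_norm ?powR_ge0// -powRrM mulVf ?gt_eqF// powRr1//.
    exact: fine_ge0.
  apply: (le_integrable measurableT _ _ igl).
    exact/measurable_EFinP/(measurableT_comp (fine_measurable _) mgl).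
  move=> x _; rewrite gee0_abs ?lee_fin ?fine_ge0// gee0_abs//.
  by move: (gl0 x); case: (gl x) => //= _; exact: leey.
have := integrable_ae measurableT igl.
apply: filterS => x /(_ I) fx n.
have : (g n x <= gl x)%E.
  have cg : cvgn (g^~ x) by apply: ereal_nondecreasing_is_cvgn; exact: ndg.
  by apply: lime_ge => //; near=> m; apply: ndg => //; near: m; exact: nbhs_infty_ge.
rewrite -(fineK fx) lee_fin => h.
rewrite /H -[leLHS](@powRr1 _ (G n x))// -(mulfV (lt0r_neq0 p0)) powRrM.
by apply: ge0_ler_powR; rewrite ?nnegrE ?powR_ge0 ?invr_ge0 ?(ltW p0)// fine_ge0.
Unshelve. all: by end_near. Qed.

(** A quantitative form: the rate [c] passes to the limit, as the gliding hump needs it, and [c 0]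
    also bounds the total variation that gives pointwise convergence. *)
Lemma Lp_complete (f_ : nat -> X -> R) (c : nat -> R) : (forall k, Lpf mu p (f_ k)) ->
  (forall n, \sum_(k < n) Lpn mu p (fun x => f_ k.+1 x - f_ k x) <= c 0%N) ->
  (forall k m, (k <= m)%N -> Lpn mu p (fun x => f_ m x - f_ k x) <= c k) ->
  exists2 f, Lpf mu p f & forall k, Lpn mu p (fun x => f x - f_ k x) <= c k.
Proof.
move=> Lf sumf fc.
have Ld k : Lpf mu p (fun x => f_ k.+1 x - f_ k x) by exact: LpfB.
have [G LG [A [mA A0 hA]]] := Lpf_sum_bound Ld sumf.
have hA' x : ~ A x -> forall n, \sum_(k < n) `|f_ k.+1 x - f_ k x| <= G x.
  by move=> Ax; apply: contrapT => h; apply: Ax; exact: hA.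
(* Erasing the exceptional null set makes the convergence hold at every point, as [Lpn_dominated]
   demands. *)
pose g_ n x := if x \in A then 0 else f_ n x.
have mg n : measurable_fun setT (g_ n).
  apply: measurable_fun_ifT => //; last exact: Lpf_meas (Lf n).
  exact: measurable_fun_bool_mem || by apply: (measurable_fun_bool true); rewrite setTI preimage_mem_true.
have gf n : g_ n = f_ n %[ae mu].
  exists A; split => // x /= h; apply: contrapT => Ax; apply: h => _.
  by rewrite /g_ memNset.
have cg x : cvgn (g_^~ x).
  rewrite /g_; have [xA|xA] := boolP (x \in A); first exact: is_cvg_cst.
  have nA : ~ A x by move=> /mem_set; apply/negP.
  have cs : cvgn (series (fun k => f_ k.+1 x - f_ k x)).
    apply: normed_cvg; apply: nondecreasing_is_cvgn.
      by apply: nondecreasing_series => k _ _; exact: normr_ge0.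
    exists (G x) => _ [n _ <-]; rewrite /=.
    by rewrite /series/= big_mkord; exact: hA'.
  have -> : (fun n => f_ n x) = (fun n => f_ 0%N x + series (fun k => f_ k.+1 x - f_ k x) n).
    by apply/funext => n; rewrite /series/= telescope_sumr// addrC subrK.
  by apply: is_cvgD => //; exact: is_cvg_cst.
pose f x := limn (g_^~ x).
have cgf x : g_ n x @[n --> \oo] --> f x by exact: cg.
have LB : Lpf mu p (fun x => `|f_ 0%N x| + G x) by apply: LpfD => //; exact: Lpf_norm.
have gB n x : `|g_ n x| <= `| `|f_ 0%N x| + G x|.
  rewrite /g_; have [xA|xA] := boolP (x \in A); first by rewrite normr0.
  have nA : ~ A x by move=> /mem_set; apply/negP.
  apply: le_trans (ler_norm _); rewrite -[f_ n x](subrK (f_ 0%N x)) addrC.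
  apply: le_trans (ler_normD _ _) _; rewrite lerD2l.
  apply: le_trans (hA' _ nA n); rewrite -(telescope_sumr (fun k => f_ k x) (leq0n n)).
  by rewrite big_mkord; exact: ler_norm_sum.
have [Lff lim] := Lpn_dominated p1 mg cgf LB gB.
exists f => // k; apply/ler_addgt0Pr => e e0.
have [n _ hn] := lim e e0; pose m := maxn n k.
have Lg : Lpf mu p (g_ m) by apply: (ae_eq_Lpf p1 (mg m) (gf m)).
apply: le_trans (Lpn_distD p1 Lff Lg (Lf k)) _; rewrite addrC lerD//; last first.
  by apply: ltW; apply: hn => /=; exact: leq_maxl.
rewrite (ae_eq_Lpn (g := fun x => f_ m x - f_ k x) p1); last 3 first.
- exact: LpfB.
- exact: LpfB.
- by apply: filterS (gf m) => x h _; rewrite h.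
by apply: fc; exact: leq_maxr.
Qed.

End Lp_complete.

(** * Uniform boundedness of the semigroup and its generator *)

Section semigroup_facts.
Context (R : realType) (N : nat) (p : R) (p1 : 1 < p).
Let p1' : 1 <= p := ltW p1.
Local Notation E := 'rV[R]_N.
Local Notation mu := (lebesgue_rV R N).
Local Notation L := (Lpf mu p).
Local Notation nrm := (Lpn mu p).
Implicit Types (f g : E -> R) (s t h e : R).

Lemma Lp_norm_cvg0P (F : R -> E -> R) : (forall h, 0 < h -> L (F h)) ->
  Lp_norm p (F h) @[h --> 0^'+] --> 0%E <->
  (forall e, 0 < e -> exists2 del : R, 0 < del & forall h, 0 < h < del -> nrm (F h) < e).
Proof.
move=> LF; split=> [cF e e0|H].
  have : \forall h \near 0^'+, (Lp_norm p (F h) < e%:E)%E.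
    have H : ereal_nbhs 0%E (fun u : \bar R => (u < e%:E)%E).
      by apply: open_ereal_lt'; rewrite lte_fin.
    exact: (cF _ H).
  move=> [del /= del0 hdel]; exists del => // h /andP[h0 hd].
  rewrite -lte_fin (LpnE (LF _ h0)); apply: hdel => //=.
  by rewrite sub0r normrN gtr0_norm.
apply: (@cvg_trans _ ((nrm (F h))%:E @[h --> 0^'+])).
  apply: near_eq_cvg; near=> h; rewrite (LpnE (LF h _))//.
apply: cvg_EFin; first exact: nearW.
apply/cvgrPdist_lt => e e0; have [del del0 hdel] := H e e0.
near=> h; rewrite sub0r normrN ger0_norm ?Lpn_ge0//; apply: hdel; apply/andP; split.
  by near: h; exact: nbhs_right_gt.
by near: h; exact: nbhs_right_lt.
Unshelve. all: by end_near. Qed.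

Variable T : R -> (E -> R) -> (E -> R).
Hypothesis hT : C0_semigroup p T.

Lemma T_Lp t f : 0 <= t -> L f -> L (T t f).
Proof. by move=> t0; exact: (blin_Lp (C0_bounded_linear hT t0)). Qed.

Lemma T_ae t f g : 0 <= t -> L f -> L g -> f = g %[ae mu] -> T t f = T t g %[ae mu].
Proof. by move=> t0; exact: (blin_ae (C0_bounded_linear hT t0)). Qed.

Lemma T_0 t : 0 <= t -> T t (fun=> 0) = (fun=> 0) %[ae mu].
Proof.
move=> t0; have L0 := Lpf0 mu p1'.
have := blin_linear (C0_bounded_linear hT t0) 1 L0 L0.
rewrite (_ : (fun x => 1 * 0 + 0) = (fun=> 0)); last by apply/funext => x; rewrite mulr0 addr0.
apply: filterS => x /(_ I) h _; move: h; rewrite mul1r => /eqP.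
by rewrite -[X in X == _]addr0 (inj_eq (addrI _)) eq_sym => /eqP.
Qed.

Lemma T_Z t c f : 0 <= t -> L f -> T t (fun x => c * f x) = (fun x => c * T t f x) %[ae mu].
Proof.
move=> t0 Lf; have L0 := Lpf0 mu p1'.
have := blin_linear (C0_bounded_linear hT t0) c Lf L0.
rewrite (_ : (fun x => c * f x + 0) = (fun x => c * f x)); last by apply/funext => x; rewrite addr0.
apply: filterS2 (T_0 t0) => x /(_ I) T0 /(_ I) h _.
by rewrite h T0 addr0.
Qed.

Lemma T_B t f g : 0 <= t -> L f -> L g ->
  T t (fun x => f x - g x) = (fun x => T t f x - T t g x) %[ae mu].
Proof.
move=> t0 Lf Lg; have := blin_linear (C0_bounded_linear hT t0) (-1) Lg Lf.
rewrite (_ : (fun x => -1 * g x + f x) = (fun x => f x - g x)); last first.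
  by apply/funext => x; rewrite mulN1r addrC.
by apply: filterS => x h _; rewrite h// mulN1r addrC.
Qed.

Lemma T_add s t f : 0 <= s -> 0 <= t -> L f -> T (s + t) f = T s (T t f) %[ae mu].
Proof. by move=> s0 t0 Lf; exact: (C0_add hT s0 t0 Lf). Qed.

Lemma T_bound t : 0 <= t -> exists2 M, 1 <= M & forall f, L f -> nrm (T t f) <= M * nrm f.
Proof.
move=> t0; have [M hM] := blin_bounded (C0_bounded_linear hT t0).
exists (Num.max M 1); first by rewrite le_max lexx orbT.
move=> f Lf; have := hM f Lf.
rewrite /Lp_norm -(LpnE Lf) -(LpnE (T_Lp t0 Lf)) -EFinM lee_fin => /le_trans; apply.
by rewrite ler_wpM2r ?Lpn_ge0// le_max lexx.
Qed.

Lemma T_cvg0 f e : L f -> 0 < e ->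
  exists2 del : R, 0 < del & forall h, 0 < h < del -> nrm (fun x => T h f x - f x) < e.
Proof.
move=> Lf; have := C0_cvg hT Lf; move/Lp_norm_cvg0P; apply.
by move=> h h0; apply: LpfB => //; apply: T_Lp => //; exact: ltW.
Qed.

Lemma nrm_ae f g : L f -> L g -> f = g %[ae mu] -> nrm f = nrm g.
Proof. exact: ae_eq_Lpn. Qed.

(* A gliding hump: were T unbounded near 0, the series of humps below would sum
   to some [x] with [T s x] unbounded as s -> 0+. *)
Lemma T_bounded_near0 : exists2 del : R, 0 < del &
  exists2 M : R, 1 <= M & forall s f, 0 <= s <= del -> L f -> nrm (T s f) <= M * nrm f.
Proof.
apply: contrapT => nb.
have unb (del M : R) : 0 < del -> 1 <= M ->
    exists s, exists f, [/\ 0 < s <= del, L f & M * nrm f < nrm (T s f)].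
  move=> del0 M1; apply: contrapT => H; apply: nb; exists del => //; exists M => //.
  move=> s f /andP[s0 sdel] Lf.
  have [s00|s00] := eqVneq s 0.
    rewrite s00 (nrm_ae (T_Lp (lexx 0) Lf) Lf (C0_id hT Lf)).
    by rewrite ler_peMl ?Lpn_ge0.
  rewrite leNgt; apply/negP => h; apply: H; exists s, f; split => //.
  by rewrite sdel lt_neqAle eq_sym s00 s0.
(* A state is a point with the radius granted to all later corrections. These add up to at most 2
   z'.2, so M z'.2 <= 1/2 guarantees that they change T(s) z'.1 by at most 1. *)
pose step (k : nat) (z z' : (E -> R) * R) := L z'.1 /\ 0 < z'.2 /\ z'.2 <= z.2 / 2 /\
  nrm (fun x => z'.1 x - z.1 x) <= z.2 /\
  exists s, exists M, [/\ 0 < s <= k.+1%:R^-1, 0 < M, M * z'.2 <= 2^-1,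
    forall f, L f -> nrm (T s f) <= M * nrm f & k.+1%:R <= nrm (T s z'.1)].
have next k z : L z.1 -> 0 < z.2 -> exists z', step k z z'.
  case: z => x r /= Lx r0.
  pose M0 : R := Num.max 1 (k.+1%:R / r).
  have M01 : 1 <= M0 by rewrite le_max lexx.
  have k0 : 0 < k.+1%:R^-1 :> R by rewrite invr_gt0.
  have [s [f [/andP[s0 sk] Lf hf]]] := unb _ M0 k0 M01.
  have s0' := ltW s0.
  have f0 : 0 < nrm f.
    rewrite lt_neqAle Lpn_ge0 andbT eq_sym; apply/eqP => f0.
    have [M _ hM] := T_bound s0'.
    by have := hM f Lf; have := hf; rewrite f0 !mulr0 => /lt_le_trans h /h; rewrite ltxx.
  pose c := r / nrm f; have c0 : 0 < c by rewrite divr_gt0.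
  pose g x := c * f x.
  have Lg : L g by exact: LpfZ.
  have ng : nrm g = r by rewrite LpnZ// gtr0_norm// divfK// gt_eqF.
  have Tg : k.+1%:R <= nrm (T s g).
    rewrite (nrm_ae (T_Lp s0' Lg) (LpfZ c p1' (T_Lp s0' Lf)) (T_Z c s0' Lf)).
    rewrite LpnZ//; last exact: T_Lp.
    rewrite gtr0_norm// -ler_pdivrMl// invf_div.
    apply: le_trans (ltW hf).
    rewrite (_ : nrm f / r * _ = k.+1%:R / r * nrm f); last by ring.
    by rewrite ler_wpM2r ?(ltW f0)// le_max lexx orbT.
  have Lp' : L (fun x' => x x' + g x') by exact: LpfD.
  have Lm' : L (fun x' => x x' - g x') by exact: LpfB.
  have [M M1 hM] := T_bound s0'.
  have M0' : 0 < M by rewrite (lt_le_trans ltr01).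
  pose r' := Num.min (r / 2) (M^-1 / 2).
  have r'0 : 0 < r' by rewrite lt_min !divr_gt0// invr_gt0.
  have Mr' : M * r' <= 2^-1.
    by rewrite -ler_pdivlMl// ge_min lexx orbT.
  (* The images of x + g and x - g differ by 2 T(s) g, so one of them is at least as large as T(s)
     g: the hump may have to be subtracted. *)
  have choose : k.+1%:R <= nrm (T s (fun x' => x x' + g x')) \/
                k.+1%:R <= nrm (T s (fun x' => x x' - g x')).
    apply/orP; rewrite -[_ || _]negbK negb_or -!ltNge; apply/negP => /andP[l1 l2].
    have : 2 * nrm (T s g) <= nrm (T s (fun x' => x x' + g x')) + nrm (T s (fun x' => x x' - g x')).
      apply: le_trans (LpnB p1' (T_Lp s0' Lp') (T_Lp s0' Lm')).
      have L2 : L (fun x' => 2 * g x') by exact: LpfZ.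
      rewrite -[2 in leLHS]ger0_norm// -LpnZ//; last exact: T_Lp.
      rewrite -(nrm_ae (T_Lp s0' L2) (LpfZ 2 p1' (T_Lp s0' Lg)) (T_Z 2 s0' Lg)).
      have LB : L (fun x' => (x x' + g x') - (x x' - g x')) by exact: LpfB.
      rewrite -(nrm_ae (T_Lp s0' LB) (LpfB p1' (T_Lp s0' Lp') (T_Lp s0' Lm')) (T_B s0' Lp' Lm')).
      rewrite (_ : (fun x' => 2 * g x') = (fun x' => (x x' + g x') - (x x' - g x')))//.
      by apply/funext => x'; ring.
    lra.
  have r'r : r' <= r / 2 by rewrite ge_min lexx.
  case: choose => hh.
    exists (fun x' => x x' + g x', r'); do 4 split => //=.
      by under eq_fun do rewrite addrC addKr; rewrite ng.
    by exists s, M; split => //; rewrite s0.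
  exists (fun x' => x x' - g x', r'); do 4 split => //=.
    under eq_fun do rewrite addrC addKr.
    by rewrite LpnN// ng.
  by exists s, M; split => //; rewrite s0.
have nextS k z : {z' | L z.1 -> 0 < z.2 -> step k z z'}.
  apply: cid; have [[h1 h2]|h] := pselect (L z.1 /\ 0 < z.2).
    by have [z' hz'] := next k z h1 h2; exists z'.
  by exists z => h1 h2; exfalso; apply: h.
pose z_ := fix z_ n := match n with 0%N => (fun=> 0, 1) | m.+1 => sval (nextS m (z_ m)) end.
have zP n : L (z_ n).1 /\ 0 < (z_ n).2.
  elim: n => [|n [IH1 IH2]]; first by split; [exact: Lpf0|exact: ltr01].
  by have [h1 [h2 _]] := svalP (nextS n (z_ n)) IH1 IH2.
have zS n : step n (z_ n) (z_ n.+1) by have [h1 h2] := zP n; exact: (svalP (nextS n (z_ n)) h1 h2).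
pose x_ n := (z_ n).1; pose r_ n := (z_ n).2.
have Lx n : L (x_ n) by have [] := zP n.
have r0 n : 0 < r_ n by have [] := zP n.
have rS n : r_ n.+1 <= r_ n / 2 by have [_ [_ []]] := zS n.
have xS n : nrm (fun x => x_ n.+1 x - x_ n x) <= r_ n by have [_ [_ [_ []]]] := zS n.
have sum_r n : \sum_(k < n) r_ k <= 2 * r_ 0%N - 2 * r_ n.
  elim: n => [|n IH]; first by rewrite big_ord0 subrr.
  rewrite big_ord_recr/=; have := rS n; lra.
have [||x LX hx] := @Lp_complete _ _ _ mu p p1' x_ (fun k => 2 * r_ k) Lx.
- move=> n; apply: (@le_trans _ _ (\sum_(k < n) r_ k)); first by apply: ler_sum => k _.
  by apply: (le_trans (sum_r n)); have := r0 n; lra.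
- move=> k m km.
  suff : nrm (fun x => x_ m x - x_ k x) <= 2 * r_ k - 2 * r_ m by have := r0 m; lra.
  rewrite -(subnK km); elim: (m - k)%N => [|j IH].
    by rewrite add0n; under eq_fun do rewrite subrr; rewrite Lpn0// subrr.
  rewrite addSn; apply: le_trans (Lpn_distD p1' (Lx _) (Lx (j + k)%N) (Lx _)) _.
  have := rS (j + k)%N; have := xS (j + k)%N; lra.
have [del del0 hdel] := T_cvg0 LX ltr01.
(* Large enough that the time of hump k falls where T(s) x is within 1 of x, and that |x| + 1 < k.
   The hump then forces k + 1 <= |T(s) x| + 1 < k + 1. *)
pose k := (maxn (Num.truncn (nrm x + 1)) (Num.truncn del^-1)).+1.
have [_ [_ [_ [_ [s [M [/andP[s0 sk] M0 Mr hM hk]]]]]]] := zS k.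
have s0' := ltW s0.
have k1 : nrm x + 1 < k%:R.
  by apply: lt_le_trans (truncnS_gt _) _; rewrite ler_nat ltnS leq_maxl.
have k2 : del^-1 < k.+1%:R.
  by apply: lt_trans (truncnS_gt _) _; rewrite ltr_nat !ltnS leq_maxr.
have sdel : s < del.
  by apply: le_lt_trans sk _; rewrite -[del]invrK ltf_pV2 ?posrE ?invr_gt0.
have n1 : nrm (fun y => T s x y - x y) < 1 by apply: hdel; rewrite s0.
have LTx : L (T s x) by exact: T_Lp.
have h1 : nrm (T s x) < k%:R.
  apply: le_lt_trans k1; rewrite [T s x](_ : _ = fun y => (T s x y - x y) + x y).
    by apply: le_trans (LpnD p1' (LpfB p1' LTx LX) LX) _; rewrite addrC lerD2l ltW.
  by apply/funext => y; rewrite subrK.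
have h2 : nrm (T s (x_ k.+1)) <= nrm (T s x) + 1.
  rewrite [T s (x_ k.+1)](_ : _ = fun y => T s x y - (T s x y - T s (x_ k.+1) y)); last first.
    by apply/funext => y; rewrite subKr.
  have LTk : L (T s (x_ k.+1)) by exact: T_Lp.
  apply: le_trans (LpnB p1' LTx (LpfB p1' LTx LTk)) _; rewrite lerD2l.
  have LB : L (fun y => x y - x_ k.+1 y) by exact: LpfB.
  rewrite -(nrm_ae (T_Lp s0' LB) (LpfB p1' LTx LTk) (T_B s0' LX (Lx _))).
  apply: (le_trans (hM _ LB)); apply: (@le_trans _ _ (M * (2 * r_ k.+1))).
    by rewrite ler_pM2l.
  rewrite mulrCA; rewrite -/(r_ k.+1) in Mr; lra.
rewrite -/(x_ k.+1) in hk.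
have : (k.+1%:R : R) = k%:R + 1 by rewrite natr1.
lra.
Qed.

(** The semigroup law cuts the interval into pieces of length [del], each costing a factor [M]. *)
Lemma T_bounded_on (t : R) : exists2 M : R, 1 <= M &
  forall s f, 0 <= s <= t -> L f -> nrm (T s f) <= M * nrm f.
Proof.
have [del del0 [M M1 hM]] := T_bounded_near0.
have H n : forall s f, 0 <= s <= n.+1%:R * del -> L f -> nrm (T s f) <= M ^+ n.+1 * nrm f.
  elim: n => [|n IH] s f /andP[s0 sn] Lf.
    by rewrite expr1; apply: hM => //; rewrite s0 -[del]mul1r.
  have [sd|sd] := leP s del.
    apply: le_trans (hM s f _ Lf) _; first by rewrite s0.
    by rewrite ler_wpM2r ?Lpn_ge0// exprS ler_peMr ?exprn_ege1// (le_trans ler01).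
  have s1 : 0 <= s - del by rewrite subr_ge0 ltW.
  have d0 := ltW del0.
  have E1 : T s f = T (s - del) (T del f) %[ae mu].
    by have := T_add s1 d0 Lf; rewrite subrK.
  have LTd : L (T del f) by exact: T_Lp.
  rewrite (nrm_ae (T_Lp s0 Lf) (T_Lp s1 LTd) E1).
  apply: (@le_trans _ _ (M ^+ n.+1 * nrm (T del f))).
    apply: IH => //; rewrite s1/= lerBlDr (le_trans sn)//.
    by rewrite -[in leLHS]natr1 mulrDl mul1r.
  rewrite [M ^+ n.+2]exprSr -[leRHS]mulrA ler_wpM2l ?exprn_ge0 ?(le_trans ler01)//.
  by apply: hM => //; rewrite d0/=.
exists (M ^+ (Num.truncn (t / del)).+1); first by rewrite exprn_ege1.
move=> s f /andP[s0 st] Lf; apply: H => //; rewrite s0 (le_trans st)//.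
by rewrite -ler_pdivrMr// ltW// truncnS_gt.
Qed.

Definition gen_at f g := forall e, 0 < e -> exists2 del : R, 0 < del &
  forall h, 0 < h < del -> nrm (fun x => h^-1 * (T h f x - f x) - g x) < e.

Lemma quot_L h f g : 0 < h -> L f -> L g -> L (fun x => h^-1 * (T h f x - f x) - g x).
Proof.
move=> h0 Lf Lg; apply: LpfB => //; apply: LpfZ => //; apply: LpfB => //.
by apply: T_Lp => //; exact: ltW.
Qed.

Lemma gen_atB f1 g1 f2 g2 : L f1 -> L g1 -> L f2 -> L g2 -> gen_at f1 g1 -> gen_at f2 g2 ->
  gen_at (fun x => f1 x - f2 x) (fun x => g1 x - g2 x).
Proof.
move=> Lf1 Lg1 Lf2 Lg2 h1 h2 e e0.
have e2 : 0 < e / 2 by rewrite divr_gt0.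
have [d1 d10 hd1] := h1 _ e2; have [d2 d20 hd2] := h2 _ e2.
exists (Num.min d1 d2); first by rewrite lt_min d10.
move=> h; rewrite lt_min => /and3P[h0 hh1 hh2]; have h0' := ltW h0.
have Q1 := quot_L h0 Lf1 Lg1; have Q2 := quot_L h0 Lf2 Lg2.
rewrite (nrm_ae (g := fun x => (h^-1 * (T h f1 x - f1 x) - g1 x) - (h^-1 * (T h f2 x - f2 x) - g2 x))).
- apply: le_lt_trans (LpnB p1' Q1 Q2) _; rewrite [e]splitr.
  by apply: ltrD; [apply: hd1; rewrite h0|apply: hd2; rewrite h0].
- by apply: quot_L => //; exact: LpfB.
- exact: LpfB.
by apply: filterS (T_B h0' Lf1 Lf2) => x hx _; rewrite hx//; ring.
Qed.

(** T(t) commutes with T(h) and is bounded, so it carries the difference quotients of [f] to those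
    of T(t) f. Hence orbits starting in the domain stay there. *)
Lemma gen_atT t f g : 0 <= t -> L f -> L g -> gen_at f g -> gen_at (T t f) (T t g).
Proof.
move=> t0 Lf Lg hfg e e0; have [M M1 hM] := T_bound t0.
have M0 : 0 < M by rewrite (lt_le_trans ltr01).
have [d d0 hd] := hfg _ (divr_gt0 e0 M0); exists d => // h hh.
have /andP[h0 _] := hh; have h0' := ltW h0.
have Q := quot_L h0 Lf Lg.
have LTh : L (T h f) by exact: T_Lp.
have LD : L (fun x => T h f x - f x) by exact: LpfB.
have LZ : L (fun x => h^-1 * (T h f x - f x)) by exact: LpfZ.
rewrite (nrm_ae (g := T t (fun x => h^-1 * (T h f x - f x) - g x))).
- by apply: le_lt_trans (hM _ Q) _; rewrite mulrC -ltr_pdivlMr//; exact: hd.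
- by apply: quot_L => //; exact: T_Lp.
- exact: T_Lp.
have A1 := T_add h0' t0 Lf; have A2 := T_add t0 h0' Lf; rewrite addrC in A2.
have B1 := T_B t0 LZ Lg; have B2 := T_Z h^-1 t0 LD; have B3 := T_B t0 LTh Lf.
apply: filterS2 (filterI A1 A2) (filterI B1 (filterI B2 B3)) => x [a1 a2] [b1 [b2 b3]] _.
by rewrite b1// b2// b3// -a1// a2.
Qed.

End semigroup_facts.

(** * The comparison principle *)

Section comparison.
Context (R : realType) (N : nat) (alpha beta : R).
Hypotheses (alpha0 : 0 <= alpha) (beta0 : 0 <= beta).
Variables (p : R) (p1 : 1 < p).
Let p1' : 1 <= p := ltW p1.
Local Notation E := 'rV[R]_N.
Local Notation mu := (lebesgue_rV R N).
Local Notation L := (Lpf mu p).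
Local Notation nrm := (Lpn mu p).
Local Notation A := (opA (N := N) alpha beta).
Local Notation wplus := (@wplus R N alpha p).
Variable T : R -> (E -> R) -> (E -> R).
Hypothesis hT : C0_semigroup p T.
Hypothesis hA : generates p (domA (N := N) alpha beta p) (opA alpha beta) T.

Lemma gen_atP (u g : E -> R) : L u -> L g -> gen_at p T u g <->
  Lp_norm p (fun x => h^-1 * (T h u x - u x) - g x) @[h --> 0^'+] --> 0%E.
Proof.
move=> Lu Lg; apply: iff_sym.
have LF h : 0 < h -> L (fun x => h^-1 * (T h u x - u x) - g x) by move=> h0; exact: (quot_L p1 hT).
exact: (Lp_norm_cvg0P LF).
Qed.

Lemma domA_gen_at (u : E -> R) : domA alpha beta p u -> gen_at p T u (A u).
Proof.
move=> Du; have Lu := domA_Lp Du; have LA := domA_opA p1 Du.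
by apply/(gen_atP Lu LA)/(hA Lu LA); split => //; exact: aeW.
Qed.

Lemma gen_at_domA (u g : E -> R) : L u -> L g -> gen_at p T u g ->
  domA alpha beta p u /\ A u = g %[ae mu].
Proof. by move=> Lu Lg ug; apply/(hA Lu Lg)/(gen_atP Lu Lg). Qed.

Lemma wplus_triangle (f g : E -> R) : L f -> L g ->
  wplus f <= wplus g + nrm (fun x => f x - g x).
Proof.
move=> Lf Lg; have LB : L (fun x => f x - g x) by exact: LpfB.
rewrite (_ : wplus f = wplus (fun x => g x + (f x - g x))); last first.
  by congr wplus; apply/funext => x; rewrite addrC subrK.
by apply: (le_trans (wplusD alpha p1 Lg LB)); rewrite lerD2l; exact: wplus_le_norm.
Qed.

(** One implicit Euler step for z = w1 - T(s + h) phi, which lies in the domain: z - h A z is,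
    almost everywhere, at most the previous difference w0 - T(s) phi plus the Taylor remainders of
    [w] and of the orbit. *)
Lemma comparison_step (w0 w1 w' phi psi : E -> R) (s h e c M : R) : 0 <= s -> 0 < h ->
  (forall f, L f -> nrm (T s f) <= M * nrm f) -> 0 <= M ->
  domA alpha beta p w1 -> L w0 -> L w' -> {ae mu, forall x, w' x <= A w1 x} ->
  nrm (fun x => w1 x - w0 x - h * w' x) <= c ->
  L phi -> L psi -> gen_at p T phi psi ->
  nrm (fun x => h^-1 * (T h phi x - phi x) - psi x) <= e ->
  nrm (fun x => T h psi x - psi x) <= e ->
  wplus (fun x => w1 x - T (s + h) phi x) <=
    wplus (fun x => w0 x - T s phi x) + (c + M * (h * (e + e))).
Proof.
move=> s0 h0 hM M0 Dw Lw0 Lw' ww hc Lphi Lpsi gphi q1 q2.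
have h0' := ltW h0; have sh0 : 0 <= s + h by exact: addr_ge0.
have Lw1 := domA_Lp Dw; have LA := domA_opA p1 Dw.
have TL (t : R) (f : E -> R) : 0 <= t -> L f -> L (T t f) by exact: (T_Lp hT).
have [L1 L2 L3 L4] := And4 (TL _ _ sh0 Lphi) (TL _ _ sh0 Lpsi) (TL _ _ h0' Lphi) (TL _ _ h0' Lpsi).
have Lz : L (fun x => w1 x - T (s + h) phi x) by exact: LpfB.
have [Dz Az] := gen_at_domA Lz (LpfB p1' LA L2)
  (gen_atB p1 hT Lw1 LA L1 L2 (domA_gen_at Dw) (gen_atT p1 hT sh0 Lphi Lpsi gphi)).
(* The backward Taylor remainder of the orbit at time 0. The remainder at time s is T(s) q, so only
   the smallness of [q] and the bound on T(s) matter. *)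
pose q x := phi x - (T h phi x - h * T h psi x).
have LZ : L (fun x => h * T h psi x) by exact: LpfZ.
have LBq : L (fun x => T h phi x - h * T h psi x) by exact: LpfB.
have Lq : L q by exact: LpfB.
have Tq : T s q = (fun x => T s phi x - (T (s + h) phi x - h * T (s + h) psi x)) %[ae mu].
  have B1 := T_B hT s0 Lphi LBq; have B2 := T_B hT s0 L3 LZ.
  have B3 := T_Z p1 hT h s0 L4; have B4 := T_add hT s0 h0' Lphi; have B5 := T_add hT s0 h0' Lpsi.
  by apply: filterS2 (filterI B1 B2) (filterI B3 (filterI B4 B5)) => x [b1 b2] [b3 [b4 b5]] _;
     rewrite b1// b2// b3// b4// b5.
have nq : nrm q <= h * (e + e).
  have Q1 := quot_L p1 hT h0 Lphi Lpsi.
  have Q2 : L (fun x => T h psi x - psi x) by exact: LpfB.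
  rewrite (_ : q = fun x => h * ((T h psi x - psi x) - (h^-1 * (T h phi x - phi x) - psi x))).
    rewrite LpnZ//; last exact: LpfB.
    rewrite gtr0_norm// ler_wpM2l//; apply: le_trans (LpnB p1' Q2 Q1) _.
    by apply: lerD.
  by apply/funext => x; rewrite /q; field; rewrite gt_eqF.
have LTq : L (T s q) by exact: TL.
have Lerr : L (fun x => w1 x - w0 x - h * w' x) by apply: LpfB => //; [exact: LpfB|exact: LpfZ].
have Ly0 : L (fun x => w0 x - T s phi x) by apply: LpfB => //; exact: TL.
have Ly1 : L (fun x => (w1 x - w0 x - h * w' x) + T s q x) by exact: LpfD.
apply: le_trans (wplus_resolvent p1 h0' Dz) _.
apply: (@le_trans _ _ (wplus (fun x => (w0 x - T s phi x) + ((w1 x - w0 x - h * w' x) + T s q x)))).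
  apply: wplus_le => //.
  - by apply: LpfB => //; apply: LpfZ => //; exact: domA_opA.
  - exact: LpfD.
  apply: filterS2 (filterI Az Tq) ww => x [Azx Tqx] wx.
  rewrite Azx// Tqx//; have := ler_wpM2l h0' wx; lra.
apply: le_trans (wplusD alpha p1 Ly0 Ly1) _; rewrite lerD2l.
apply: le_trans (wplus_le_norm alpha p1 Ly1) _.
apply: le_trans (LpnD p1' Lerr LTq) _; apply: lerD => //.
by apply: le_trans (hM _ Lq) _; rewrite ler_wpM2l.
Qed.

Lemma comparison_gen (tau C : R) (v v' : R -> E -> R) (phi psi : E -> R) : 0 < tau -> 0 <= C ->
  (forall s, 0 <= s <= tau -> [/\ domA alpha beta p (v s), L (v' s) &
    {ae mu, forall x, v' s x <= A (v s) x}]) ->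
  (forall s h, 0 <= s -> 0 < h -> s + h <= tau ->
    nrm (fun x => v (s + h) x - v s x - h * v' (s + h) x) <= C * h ^+ 2) ->
  L phi -> L psi -> gen_at p T phi psi ->
  wplus (fun x => v tau x - T tau phi x) <= wplus (fun x => v 0 x - phi x).
Proof.
move=> tau0 C0 hv hdv Lphi Lpsi gphi; apply/ler_addgt0Pr => e e0.
have [M M1 hM] := T_bounded_on p1 hT tau; have M0 : 0 <= M by rewrite (le_trans ler01).
have Mt : 0 < M * tau by rewrite mulr_gt0// (lt_le_trans ltr01).
(* Over the whole grid the orbit remainders add up to 2 M tau d, which is e / 2. *)
pose d := e / (4 * (M * tau)).
have d0 : 0 < d by rewrite divr_gt0// mulr_gt0.
have [d1 d10 hd1] := gphi _ d0; have [d2 d20 hd2] := T_cvg0 p1 hT Lpsi d0.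
(* A number of steps above each summand gives h < d1, h < d2 and C tau h <= e / 2, the share of the
   Taylor error of [v]. *)
pose B := tau / d1 + tau / d2 + 2 * C * tau ^+ 2 / e.
have B1 : 0 < tau / d1 by exact: divr_gt0.
have B2 : 0 < tau / d2 by exact: divr_gt0.
have B3 : 0 <= 2 * C * tau ^+ 2 / e by rewrite divr_ge0 ?(ltW e0)// mulr_ge0 ?sqr_ge0// mulr_ge0.
pose k := (Num.truncn B).+1.
have kB : B < k%:R by exact: truncnS_gt.
have k0 : 0 < k%:R :> R by rewrite ltr0n.
pose h := tau / k%:R; have h0 : 0 < h by rewrite divr_gt0.
have kh : k%:R * h = tau by rewrite mulrC divfK// gt_eqF.
have hsmall (x : R) : 0 < x -> tau / x < k%:R -> h < x.
  by move=> x0; rewrite ltr_pdivrMr// ltr_pdivrMr// mulrC.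
have hd1' : 0 < h < d1 by rewrite h0 hsmall//; rewrite /B in kB; lra.
have hd2' : 0 < h < d2 by rewrite h0 hsmall//; rewrite /B in kB; lra.
have hC : C * tau * h <= e / 2.
  have : 2 * C * tau ^+ 2 / e <= k%:R by rewrite /B in kB; lra.
  rewrite ler_pdivrMr// => H; rewrite /h mulrA ler_pdivrMr//; lra.
have step (j : nat) : (j <= k)%N ->
    wplus (fun x => v (j%:R * h) x - T (j%:R * h) phi x) <=
    wplus (fun x => v 0 x - T 0 phi x) + j%:R * (C * h ^+ 2 + M * (h * (d + d))).
  elim: j => [|j IH] jk; first by rewrite !mul0r addr0.
  have jh : j%:R * h + h = j.+1%:R * h by rewrite -[j.+1%:R]natr1 mulrDl mul1r.
  have j0 : 0 <= j%:R * h by rewrite mulr_ge0// ltW.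
  have jt : j.+1%:R * h <= tau by rewrite -kh ler_pM2r// ler_nat.
  have jt' : j%:R * h <= tau by apply: le_trans jt; rewrite -jh lerDl ltW.
  have [D1 L1 A1] : [/\ domA alpha beta p (v (j%:R * h + h)), L (v' (j%:R * h + h)) &
    {ae mu, forall x, v' (j%:R * h + h) x <= A (v (j%:R * h + h)) x}].
    by apply: hv; rewrite jh jt mulr_ge0// ltW.
  have [D0 _ _] : [/\ domA alpha beta p (v (j%:R * h)), L (v' (j%:R * h)) &
    {ae mu, forall x, v' (j%:R * h) x <= A (v (j%:R * h)) x}] by apply: hv; rewrite j0.
  have jht : j%:R * h + h <= tau by rewrite jh.
  have hMj (f : E -> R) : L f -> nrm (T (j%:R * h) f) <= M * nrm f by apply: hM; rewrite j0.
  have := comparison_step j0 h0 hMj M0 D1 (domA_Lp D0) L1 A1 (hdv _ _ j0 h0 jht)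
    Lphi Lpsi gphi (ltW (hd1 _ hd1')) (ltW (hd2 _ hd2')).
  rewrite jh => /le_trans; apply; have := IH (ltnW jk); rewrite -[j.+1%:R]natr1; lra.
have := step k (leqnn _); rewrite kh => /le_trans; apply.
have Dv0 : domA alpha beta p (v 0) by have [] := hv 0; rewrite ?lexx ?ltW.
have Lv0 := domA_Lp Dv0.
have L0 : L (T 0 phi) by exact: (T_Lp hT).
apply: lerD.
  apply: wplus_le => //; [exact: LpfB|exact: LpfB|].
  by apply: filterS (C0_id hT Lphi) => x ->.
rewrite mulrDr (_ : k%:R * (C * h ^+ 2) = C * (k%:R * h) * h); last by ring.
rewrite (_ : k%:R * (M * (h * (d + d))) = 2 * M * (k%:R * h) * d); last by ring.
rewrite kh.
have -> : 2 * M * tau * d = e / 2 by rewrite /d; field; rewrite gt_eqF //= gt_eqF // (lt_le_trans ltr01).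
lra.
Qed.

(** A general [f] need not be in the domain; replacing it by a test function costs at most (1 + M)
    |f - phi|, counting time 0 and time [tau]. *)
Lemma comparison (tau C : R) (v v' : R -> E -> R) (f : E -> R) : 0 < tau -> 0 <= C ->
  (forall s, 0 <= s <= tau -> [/\ domA alpha beta p (v s), L (v' s) &
    {ae mu, forall x, v' s x <= A (v s) x}]) ->
  (forall s h, 0 <= s -> 0 < h -> s + h <= tau ->
    nrm (fun x => v (s + h) x - v s x - h * v' (s + h) x) <= C * h ^+ 2) ->
  L f -> {ae mu, forall x, v 0 x <= f x} -> {ae mu, forall x, v tau x <= T tau f x}.
Proof.
move=> tau0 C0 hv hdv Lf v0f; have tau0' := ltW tau0.
have Lv0 : L (v 0) by have [D _ _] := hv 0 (introT andP (conj (lexx 0) tau0')); exact: domA_Lp D.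
have Lvt : L (v tau) by have [D _ _] := hv tau (introT andP (conj tau0' (lexx _))); exact: domA_Lp D.
have LTf : L (T tau f) by exact: (T_Lp hT).
have LB0 : L (fun x => v 0 x - f x) by exact: LpfB.
have LBt : L (fun x => v tau x - T tau f x) by exact: LpfB.
have w0 : wplus (fun x => v 0 x - f x) = 0.
  by apply: wplus_nonpos => //; apply: filterS v0f => x; rewrite subr_le0.
suff wt : wplus (fun x => v tau x - T tau f x) = 0.
  by apply: filterS (wplus_eq0 p1 LBt wt) => x; rewrite subr_le0.
have [M M1 hM] := T_bound hT tau0'; have M0 : 0 <= M by rewrite (le_trans ler01).
apply/eqP; rewrite eq_le Lpn_ge0 andbT; apply/ler_addgt0Pr => e e0; rewrite add0r.
have M2 : 0 < 1 + M by rewrite ltr_pwDl.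
have [phi tphi hphi] := test_dense p1' Lf (divr_gt0 e0 M2).
have [Dphi _] := C2c_domA alpha0 beta0 p1 (test_C2c tphi).
have Lphi := domA_Lp Dphi; have LA := domA_opA p1 Dphi.
have LTphi : L (T tau phi) by exact: (T_Lp hT).
have cmp := comparison_gen tau0 C0 hv hdv Lphi LA (domA_gen_at Dphi).
apply: le_trans (wplus_triangle LBt (LpfB p1' Lvt LTphi)) _.
have -> : (fun x => v tau x - T tau f x - (v tau x - T tau phi x)) =
    (fun x => T tau phi x - T tau f x) by apply/funext => x; ring.
have n1 : nrm (fun x => T tau phi x - T tau f x) <= M * nrm (fun x => f x - phi x).
  have LB := LpfB p1' Lphi Lf.
  rewrite -(nrm_ae p1 (T_Lp hT tau0' LB) (LpfB p1' LTphi LTf) (T_B hT tau0' Lphi Lf)).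
  by rewrite (Lpn_distC p1' Lf Lphi); exact: hM.
have n2 : wplus (fun x => v 0 x - phi x) <= nrm (fun x => f x - phi x).
  apply: le_trans (wplus_triangle (LpfB p1' Lv0 Lphi) LB0) _; rewrite w0 add0r.
  have -> : (fun x => v 0 x - phi x - (v 0 x - f x)) = (fun x => f x - phi x) by apply/funext => x; ring.
  by [].
have : (1 + M) * nrm (fun x => f x - phi x) <= e.
  by rewrite -ler_pdivlMl// mulrC ltW.
lra.
Qed.

Lemma positivity (t : R) (f : E -> R) : 0 < t -> L f -> {ae mu, forall x, 0 <= f x} ->
  {ae mu, forall x, 0 <= T t f x}.
Proof.
move=> t0 Lf f0.
have C0 : C2c (fun _ : E => 0 : R) (fun _ _ => 0) (fun _ _ _ => 0).
  have cs : cont_supported (fun _ : E => 0 : R) by split; [move=> x; apply: cst_continuous|exists 0].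
  by split => // *; exact: is_derive_cst.
have [D0 A0] := C2c_domA alpha0 beta0 p1 C0.
apply: (@comparison t 0 (fun=> fun=> 0) (fun=> fun=> 0)) => //.
  move=> s _; split => //; first exact: Lpf0.
  by apply: filterS A0 => x ->//; rewrite big1// !mulr0 subrr.
move=> s h _ _ _; rewrite mul0r (_ : (fun x => _) = (fun=> 0)) ?Lpn0//.
by apply/funext => x; rewrite mulr0 !subr0.
Qed.

End comparison.

(** * The spreading barrier *)

Section positive_part_calculus.
Context {R : realType}.

Definition pos (y : R) : R := Num.max y 0.

Lemma pos_ge0 y : 0 <= pos y.
Proof. by rewrite le_max lexx orbT. Qed.

Lemma pos_le y m : 0 <= m -> y <= m -> pos y <= m.
Proof. by move=> m0 ym; rewrite ge_max ym. Qed.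

Lemma pos_nonpos y : y <= 0 -> pos y = 0.
Proof. by move=> y0; rewrite /pos max_r. Qed.

Lemma pos_continuous : continuous pos.
Proof.
move=> y; rewrite (_ : pos = (fun y => 2^-1 * (y + `|y|))).
  apply: (@continuousM _ _ (fun=> 2^-1) (fun y : R => y + `|y|)); first exact: cst_continuous.
  by apply: (@continuousD _ _ _ id (fun y : R => `|y|)); [exact: cvg_id|exact: norm_continuous].
apply/funext => z; rewrite /pos; have [z0|z0] := leP z 0.
  by rewrite ler0_norm// subrr mulr0.
by rewrite gtr0_norm//; field.
Qed.

Lemma is_derive_pos2 (y : R) : is_derive y 1 (fun z => pos z ^+ 2) (2 * pos y).
Proof.
have [y0|y0|->] := ltgtP y 0.
- rewrite pos_nonpos ?ltW// mulr0.
  apply: (near_eq_is_derive _ (is_derive_cst (0 : R) y 1)).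
  near=> z; rewrite pos_nonpos ?expr0n//; near: z.
  by near=> z; apply: ltW; near: z; exact: lt_nbhsl.
- have d : is_derive y 1 (fun z : R => z ^+ 2) (2 * pos y).
    have h := is_deriveX 2 (is_derive_id y (1 : R)).
    rewrite (_ : (fun z => z ^+ 2) = id ^+ 2)//; apply: is_derive_eq h _.
    by rewrite /GRing.scale/= /pos max_l ?(ltW y0)//; ring.
  apply: (near_eq_is_derive _ d).
  by near=> z; rewrite /pos max_l//; apply: ltW; near: z; exact: lt_nbhsr.
- rewrite pos_nonpos// mulr0; apply: (@is_derive0_quadratic _ _ 1) => x.
  rewrite mul1r ger0_norm ?sqr_ge0//; have [z0|z0] := leP x 0.
    by rewrite pos_nonpos// expr0n sqr_ge0.
  by rewrite /pos max_l// ltW.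
Unshelve. all: by end_near. Qed.

Lemma is_derive_pos3 (y : R) : is_derive y 1 (fun z => pos z ^+ 3) (3 * pos y ^+ 2).
Proof.
have h := is_deriveM (is_derive_id y (1 : R)) (is_derive_pos2 y).
have E (z : R) : pos z ^+ 3 = z * pos z ^+ 2.
  rewrite exprS; have [z0|z0] := leP z 0; first by rewrite pos_nonpos// expr0n !mulr0.
  by rewrite /pos max_l ?ltW.
rewrite (_ : (fun z => pos z ^+ 3) = id * (fun z => pos z ^+ 2)); last exact/funext.
apply: is_derive_eq h _; rewrite /GRing.scale/=.
have [z0|z0] := leP y 0; first by rewrite pos_nonpos// expr0n !mulr0 mul0r addr0.
by rewrite /pos max_l ?ltW//; ring.
Qed.

End positive_part_calculus.

Section directional_chain_rule.
Context {R : realType} {N : nat}.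
Local Notation E := 'rV[R]_N.

Lemma is_derive_of_line (f : E -> R) (x v : E) (df : R) :
  is_derive (0 : R) 1 (fun r => f (x + r *: v)) df -> is_derive x v f df.
Proof.
have E1 : (fun h : R => h^-1 *: (((fun r => f (x + r *: v)) \o shift 0) (h *: (1 : R)) - f (x + 0 *: v))) =
    (fun h => h^-1 *: ((f \o shift x) (h *: v) - f x)).
  apply/funext => h /=; rewrite scale0r !addr0; congr (_ *: (f _ - _)).
  by rewrite ?addr0 [RHS]addrC (_ : h *: (1 : R) = h)//; exact: mulr1.
by move=> [dv dE]; apply: DeriveDef; [rewrite /derivable -E1|rewrite /derive -E1].
Qed.

(** Restriction to the line through [x] reduces this to one variable, so [f] needs a derivative only
    in the direction [v]. *)
Lemma is_derive_comp1 (f : E -> R) (g : R -> R) (x v : E) (df dg : R) :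
  is_derive x v f df -> is_derive (f x) 1 g dg -> is_derive x v (fun y => g (f y)) (dg * df).
Proof.
move=> hf hg; apply: is_derive_of_line.
have hl : is_derive (0 : R) 1 (fun r => f (x + r *: v)) df.
  by apply: is_derive_line; rewrite scale0r addr0.
apply: (@is_derive1_comp _ g (fun r => f (x + r *: v)) 0 dg df _ hl).
by rewrite scale0r addr0.
Qed.

Lemma norm_sq_le (y : E) : `|y| ^+ 2 <= \sum_(i < N) y ord0 i ^+ 2.
Proof.
set S := \sum_(i < N) _; have S0 : 0 <= S by apply: sumr_ge0 => i _; exact: sqr_ge0.
rewrite -[leRHS]sqr_sqrtr// lerXn2r ?nnegrE ?sqrtr_ge0//.
rewrite [leLHS]/Num.norm /= mx_normrE; apply/bigmax_leP; split; first exact: sqrtr_ge0.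
move=> [i j] _ /=; rewrite ord1 -sqrtr_sqr ler_sqrt//.
exact: (@ler_term_sum _ _ (fun i => y ord0 i ^+ 2) j (fun i => sqr_ge0 _)).
Qed.

End directional_chain_rule.

Section barrier.
Context {R : realType} {N : nat}.
Local Notation E := 'rV[R]_N.
Variables (k K c rho : R) (x0 : E).

Definition sqdist (x : E) : R := \sum_(i < N) (x ord0 i - x0 ord0 i) ^+ 2.

Definition front (s : R) (x : E) : R := pos (rho + c * s - sqdist x).

(** Three is the least integer power of a positive part that is of class C^2, in space and in time
    alike. The exponential factor produces the absorbing term in front^3. *)
Definition barrier (s : R) (x : E) : R := k * expR (- K * s) * front s x ^+ 3.

Definition barrier_t (s : R) (x : E) : R :=
  k * expR (- K * s) * (3 * c * front s x ^+ 2 - K * front s x ^+ 3).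

Definition barrier1 s (i : 'I_N) (x : E) : R :=
  k * expR (- K * s) * (- 6 * (x ord0 i - x0 ord0 i) * front s x ^+ 2).

Definition barrier2 s (j i : 'I_N) (x : E) : R :=
  k * expR (- K * s) * (24 * (x ord0 i - x0 ord0 i) * (x ord0 j - x0 ord0 j) * front s x
    - 6 * (i == j)%:R * front s x ^+ 2).

Lemma sqdist_ge0 x : 0 <= sqdist x.
Proof. by apply: sumr_ge0 => i _; exact: sqr_ge0. Qed.

Lemma front_ge0 s x : 0 <= front s x. Proof. exact: pos_ge0. Qed.

Lemma is_derive_coordB i (x v : E) :
  is_derive x v (fun y : E => y ord0 i - x0 ord0 i) (v ord0 i).
Proof.
have h := is_deriveB (is_derive_coord i x v) (is_derive_cst (x0 ord0 i) x v).
by apply: is_derive_eq h _; rewrite subr0.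
Qed.

Lemma is_derive_sqdist i (x : E) :
  is_derive x (unitv R i) sqdist (2 * (x ord0 i - x0 ord0 i)).
Proof.
have h := @is_derive_sum _ _ _ N (fun j (y : E) => (y ord0 j - x0 ord0 j) ^+ 2) x (unitv R i)
  (fun j => 2 * (x ord0 j - x0 ord0 j) * (unitv R i) ord0 j).
have h' : forall j : 'I_N, is_derive x (unitv R i) (fun y : E => (y ord0 j - x0 ord0 j) ^+ 2)
    (2 * (x ord0 j - x0 ord0 j) * (unitv R i) ord0 j).
  move=> j; have := is_deriveX 2 (is_derive_coordB j x (unitv R i)).
  by move=> h1; apply: is_derive_eq h1 _; rewrite /GRing.scale/= expr1.
have := h h'; rewrite (_ : \sum_(j < N) (fun y : E => _) = sqdist); last first.
  by apply/funext => y; rewrite fct_sumE.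
move=> h2; apply: is_derive_eq h2 _.
rewrite (bigD1 i)//= big1 ?addr0; first by rewrite mxE !eqxx mulr1.
by move=> j ji; rewrite mxE (negbTE ji) andbF mulr0.
Qed.

Lemma is_derive_level s i (x : E) :
  is_derive x (unitv R i) (fun y => rho + c * s - sqdist y) (- 2 * (x ord0 i - x0 ord0 i)).
Proof.
have h := is_deriveB (is_derive_cst (rho + c * s) x (unitv R i)) (is_derive_sqdist i x).
by apply: is_derive_eq h _; rewrite sub0r mulNr.
Qed.

Lemma is_derive_barrier s i (x : E) : is_derive x (unitv R i) (barrier s) (barrier1 s i x).
Proof.
have h := is_deriveZ (k * expR (- K * s))
  (is_derive_comp1 (is_derive_level s i x) (is_derive_pos3 (rho + c * s - sqdist x))).
by apply: is_derive_eq h _; rewrite /barrier1 /front /GRing.scale/=; ring.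
Qed.

Lemma is_derive_barrier1 s i j (x : E) :
  is_derive x (unitv R j) (barrier1 s i) (barrier2 s j i x).
Proof.
have h := is_deriveZ (k * expR (- K * s) * - 6) (is_deriveM (is_derive_coordB i x (unitv R j))
  (is_derive_comp1 (is_derive_level s j x) (is_derive_pos2 (rho + c * s - sqdist x)))).
rewrite (_ : barrier1 s i = (k * expR (- K * s) * - 6) \*:
   ((fun y : E => y ord0 i - x0 ord0 i) * (fun y => pos (rho + c * s - sqdist y) ^+ 2))); last first.
  apply/funext => y; have E1 : barrier1 s i y = (k * expR (- K * s) * - 6) *
    ((y ord0 i - x0 ord0 i) * pos (rho + c * s - sqdist y) ^+ 2) by rewrite /barrier1 /front; ring.
  exact: E1.
apply: is_derive_eq h _; rewrite /barrier2 /front /GRing.scale/= mxE eqxx /=.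
by rewrite eq_sym; ring.
Qed.

Lemma sqdist_continuous : continuous sqdist.
Proof.
move=> x; apply: differentiable_continuous.
rewrite (_ : sqdist = \sum_(i < N) (fun y : E => (y ord0 i - x0 ord0 i) ^+ 2)); last first.
  by apply/funext => y; rewrite fct_sumE.
apply: differentiable_sum => i.
rewrite (_ : (fun y : E => _) = (fun y : E => y ord0 i - x0 ord0 i) ^+ 2)//.
apply: differentiableX; apply: differentiableB => //; exact: differentiable_coord.
Qed.

Lemma coordB_continuous i : continuous (fun y : E => y ord0 i - x0 ord0 i).
Proof.
move=> x; apply: differentiable_continuous.
by apply: differentiableB => //; exact: differentiable_coord.
Qed.

Lemma front_continuous s : continuous (front s).
Proof.
move=> x; apply: (@continuous_comp _ _ _ (fun x => rho + c * s - sqdist x) pos).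
  apply: (@continuousB _ _ _ (fun=> rho + c * s) sqdist); first exact: cst_continuous.
  exact: sqdist_continuous.
exact: pos_continuous.
Qed.

Lemma frontX_continuous s n : continuous (fun x => front s x ^+ n).
Proof.
move=> x; apply: (@continuous_comp _ _ _ (front s) (fun y => y ^+ n)); first exact: front_continuous.
exact: exprn_continuous.
Qed.

Lemma mul_continuous (f g : E -> R) : continuous f -> continuous g ->
  continuous (fun x => f x * g x).
Proof. by move=> cf cg x; apply: continuousM; [exact: cf|exact: cg]. Qed.

Lemma sub_continuous (f g : E -> R) : continuous f -> continuous g ->
  continuous (fun x => f x - g x).
Proof. by move=> cf cg x; apply: continuousB; [exact: cf|exact: cg]. Qed.

Lemma scale_continuous (a : R) (f : E -> R) : continuous f -> continuous (fun x => a * f x).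
Proof. by move=> cf; apply: (@mul_continuous (fun=> a) f) => //; exact: cst_continuous. Qed.

Lemma front_support (tau : R) : 0 <= c -> 0 <= rho -> 0 <= tau ->
  forall s, s <= tau -> supported_in (`|x0| + (rho + c * tau + 1)) (front s).
Proof.
move=> c0 r0 tau0 s st x xM; apply: pos_nonpos; rewrite subr_le0.
set m := rho + c * tau; have m0 : 0 <= m by rewrite addr_ge0// mulr_ge0.
have sm : rho + c * s <= m by rewrite lerD2l ler_wpM2l.
apply: (le_trans sm).
have : m + 1 <= `|x - x0|.
  have := lerB_dist x x0; have := xM; rewrite -/m; lra.
have : `|x - x0| ^+ 2 <= sqdist x.
  rewrite (le_trans (norm_sq_le _))// /sqdist le_eqVlt; apply/orP; left; apply/eqP.
  by apply: eq_bigr => i _; rewrite !mxE.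
have := normr_ge0 (x - x0); nra.
Qed.

Lemma front_le s tau x : 0 <= c -> 0 <= rho -> 0 <= tau -> s <= tau -> front s x <= rho + c * tau.
Proof.
move=> c0 r0 tau0 st; apply: pos_le; first by rewrite addr_ge0// mulr_ge0.
have := sqdist_ge0 x; have := ler_wpM2l c0 st; lra.
Qed.

Lemma barrier_C2c s : 0 <= c -> 0 <= rho -> 0 <= s ->
  C2c (barrier s) (barrier1 s) (barrier2 s).
Proof.
move=> c0 r0 s0; have supp := front_support c0 r0 s0 (lexx s).
set M := _ + _ in supp; split.
- split; first by apply: scale_continuous; exact: frontX_continuous.
  by exists M => x Mx; rewrite /barrier supp// expr0n mulr0.
- move=> i; split; last by exists M => x Mx; rewrite /barrier1 supp// expr0n !mulr0.
  apply: scale_continuous; apply: mul_continuous; last exact: frontX_continuous.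
  by apply: scale_continuous; exact: coordB_continuous.
- move=> i j; split; last by exists M => x Mx; rewrite /barrier2 supp// expr0n !mulr0 subrr mulr0.
  apply: scale_continuous; apply: sub_continuous; last first.
    by apply: scale_continuous; exact: frontX_continuous.
  apply: mul_continuous; last exact: front_continuous.
  apply: mul_continuous; last exact: coordB_continuous.
  by apply: scale_continuous; exact: coordB_continuous.
- exact: is_derive_barrier.
- by move=> i j x; exact: is_derive_barrier1.
Qed.

Lemma barrier_laplacian s x : \sum_(i < N) barrier2 s i i x =
  k * expR (- K * s) * (24 * sqdist x * front s x - 6 * N%:R * front s x ^+ 2).
Proof.
rewrite -mulr_sumr; congr (_ * _); rewrite sumrB -!mulr_suml -!mulr_sumr.
congr (_ - _).
  by congr (_ * _); rewrite /sqdist mulr_sumr; apply: eq_bigr => i _; rewrite -mulrA expr2.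
by congr (_ * _ * _); rewrite (eq_bigr (fun=> 1)) ?sumr_const ?card_ord// => i _; rewrite eqxx.
Qed.

(* The discriminant of the quadratic in [front s x] left after dividing by
   [front s x] vanishes for this choice of K. *)
Lemma barrier_subsolution (A V a0 s : R) (x : E) : 0 < k -> 0 < rho -> 0 <= c ->
  0 <= s -> 1 <= A <= a0 -> 0 <= V <= a0 ->
  K = a0 + (3 * c + 6 * N%:R * a0 + 24) ^+ 2 / (96 * rho) ->
  barrier_t s x <= A * (\sum_(i < N) barrier2 s i i x) - V * barrier s x.
Proof.
move=> k0 r0 c0 s0 /andP[A1 Aa] /andP[V0 Va] KE.
rewrite barrier_laplacian /barrier_t /barrier.
set e := k * _; have e0 : 0 < e by rewrite mulr_gt0// expR_gt0.
set w := front s x; set q := sqdist x.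
suff : 0 <= e * (A * (24 * q * w - 6 * N%:R * w ^+ 2) - V * w ^+ 3 - (3 * c * w ^+ 2 - K * w ^+ 3)).
  lra.
apply: mulr_ge0; first exact: ltW.
have [y0|y0] := leP (rho + c * s - q) 0.
  by rewrite (_ : w = 0) ?expr0n /= ?mulr0 ?subrr ?mulr0 ?subrr// /w /front pos_nonpos.
have wE : w = rho + c * s - q by rewrite /w /front -/q /pos max_l// ltW.
have w0 : 0 < w by rewrite wE.
have q0 : 0 <= q by exact: sqdist_ge0.
have n0 : 0 <= N%:R :> R by [].
pose B := 3 * c + 6 * N%:R * a0 + 24.
have B0 : 0 <= B.
  have : 0 <= 6 * N%:R * a0 by rewrite !mulr_ge0// (le_trans _ Va).
  by rewrite /B; lra.
suff H : 0 <= A * (24 * q - 6 * N%:R * w) - V * w ^+ 2 - (3 * c * w - K * w ^+ 2).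
  rewrite (_ : A * _ - _ - _ = w * (A * (24 * q - 6 * N%:R * w) - V * w ^+ 2 - (3 * c * w - K * w ^+ 2))).
    exact: (mulr_ge0 (ltW w0) H).
  by ring.
have h1 : 24 * q <= A * (24 * q) by rewrite ler_peMl// mulr_ge0.
have h2 : A * (6 * N%:R * w) <= a0 * (6 * N%:R * w) by rewrite ler_wpM2r// !mulr_ge0// ltW.
have h3 : V * w ^+ 2 <= a0 * w ^+ 2 by rewrite ler_wpM2r// sqr_ge0.
(* Where [w] is small, [q] is at least nearly [rho]: this positive term pays for the speed [c]. *)
have h4 : 24 * q >= 24 * rho - 24 * w by have := mulr_ge0 c0 s0; lra.
have h5 : 0 <= 24 * rho - B * w + B ^+ 2 / (96 * rho) * w ^+ 2.
  rewrite (_ : _ + _ = 24 * rho * (1 - B * w / (48 * rho)) ^+ 2).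
    by rewrite mulr_ge0 ?sqr_ge0// mulr_ge0// ltW.
  by field; rewrite gt_eqF.
have h6 : K * w ^+ 2 = a0 * w ^+ 2 + B ^+ 2 / (96 * rho) * w ^+ 2 by rewrite KE mulrDl.
have h7 : B * w = 3 * c * w + a0 * (6 * N%:R * w) + 24 * w by rewrite /B; ring.
lra.
Qed.

End barrier.

(** * Time regularity of the barrier *)

Section barrier_in_time.
Context {R : realType} {N : nat}.
Local Notation E := 'rV[R]_N.
Local Notation mu := (lebesgue_rV R N).
Variables (k K c rho : R) (x0 : E).
Hypotheses (k0 : 0 <= k) (K0 : 0 <= K) (c0 : 0 <= c) (rho0 : 0 <= rho).
Local Notation v := (barrier k K c rho x0).
Local Notation v' := (barrier_t k K c rho x0).
Local Notation w := (front c rho x0).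

Let v'' (s : R) (x : E) : R :=
  k * expR (- K * s) * (6 * c ^+ 2 * w s x - 6 * K * c * w s x ^+ 2 + K ^+ 2 * w s x ^+ 3).

Lemma is_derive_decay (s : R) :
  is_derive s 1 (fun s => k * expR (- K * s)) (- K * (k * expR (- K * s))).
Proof.
have h := is_deriveZ k (@is_derive1_comp R expR (fun s => - K * s) s _ _ (is_derive_expR (- K * s))
  (is_deriveZ (- K) (is_derive_id s (1 : R)))).
by apply: is_derive_eq h _; rewrite /GRing.scale/=; ring.
Qed.

Lemma is_derive_time_level (x : E) (s : R) :
  is_derive s 1 (fun s => rho + c * s - sqdist x0 x) c.
Proof.
have h := is_deriveB (is_deriveD (is_derive_cst rho s (1 : R)) (is_deriveZ c (is_derive_id s (1 : R))))
  (is_derive_cst (sqdist x0 x) s (1 : R)).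
by apply: is_derive_eq h _; rewrite /GRing.scale/= subr0 add0r mulr1.
Qed.

Lemma is_derive_front2 (x : E) (s : R) :
  is_derive s 1 (fun s => w s x ^+ 2) (2 * c * w s x).
Proof.
have h := @is_derive1_comp R (fun y => pos y ^+ 2) _ s _ _ (is_derive_pos2 (rho + c * s - sqdist x0 x))
  (is_derive_time_level x s).
by apply: is_derive_eq h _; rewrite /front; ring.
Qed.

Lemma is_derive_front3 (x : E) (s : R) :
  is_derive s 1 (fun s => w s x ^+ 3) (3 * c * w s x ^+ 2).
Proof.
have h := @is_derive1_comp R (fun y => pos y ^+ 3) _ s _ _ (is_derive_pos3 (rho + c * s - sqdist x0 x))
  (is_derive_time_level x s).
by apply: is_derive_eq h _; rewrite /front; ring.
Qed.

Lemma is_derive_barrier_time (x : E) (s : R) : is_derive s 1 (v ^~ x) (v' s x).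
Proof.
have h := is_deriveM (is_derive_decay s) (is_derive_front3 x s).
by apply: is_derive_eq h _; rewrite /barrier_t /GRing.scale/=; ring.
Qed.

Lemma is_derive_barrier_time2 (x : E) (s : R) : is_derive s 1 (v' ^~ x) (v'' s x).
Proof.
have h1 : is_derive s 1 (fun s => 3 * c * w s x ^+ 2 - K * w s x ^+ 3)
    (3 * c * (2 * c * w s x) - K * (3 * c * w s x ^+ 2)).
  exact: is_deriveB (is_deriveZ (3 * c) (is_derive_front2 x s)) (is_deriveZ K (is_derive_front3 x s)).
have h := is_deriveM (is_derive_decay s) h1.
by apply: is_derive_eq h _; rewrite /v'' /GRing.scale/=; ring.
Qed.

Lemma barrier_tt_bound (tau : R) : 0 <= tau ->
  exists2 C : R, 0 <= C & forall s x, 0 <= s <= tau -> `|v'' s x| <= C.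
Proof.
move=> tau0; pose m := rho + c * tau; have m0 : 0 <= m by rewrite addr_ge0// mulr_ge0.
exists (k * (6 * c ^+ 2 * m + 6 * K * c * m ^+ 2 + K ^+ 2 * m ^+ 3)).
  by rewrite !(mulr_ge0, addr_ge0, exprn_ge0).
move=> s x /andP[s0 st]; rewrite /v''; set y := w s x.
have y0 : 0 <= y := front_ge0 c rho x0 s x.
have ym : y <= m by exact: front_le.
have e1 : expR (- K * s) <= 1 by rewrite -expR0 ler_expR mulNr oppr_le0 mulr_ge0.
rewrite normrM ger0_norm ?mulr_ge0 ?expR_ge0//.
apply: ler_pM => //; first by rewrite mulr_ge0 ?expR_ge0.
  by rewrite ler_piMr.
apply: (le_trans (ler_normD _ _)); apply: lerD.
  apply: (le_trans (ler_normB _ _)); apply: lerD.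
    by rewrite ger0_norm ?mulr_ge0 ?exprn_ge0// ler_wpM2l ?mulr_ge0 ?exprn_ge0.
  rewrite ger0_norm ?mulr_ge0 ?exprn_ge0// ler_wpM2l ?mulr_ge0//.
  by rewrite lerXn2r ?nnegrE.
rewrite ger0_norm ?mulr_ge0 ?exprn_ge0// ler_wpM2l ?exprn_ge0//.
by rewrite lerXn2r ?nnegrE.
Qed.

(** The derivative sits at the right end, as the implicit step requires: the remainder is h (v'(xi)
    - v'(s + h)), and a second mean value theorem gives the other factor h. *)
Lemma barrier_taylor (tau : R) : 0 <= tau -> exists2 C : R, 0 <= C &
  forall s h x, 0 <= s -> 0 < h -> s + h <= tau ->
    `|v (s + h) x - v s x - h * v' (s + h) x| <= C * h ^+ 2.
Proof.
move=> tau0; have [C C0 hC] := barrier_tt_bound tau0; exists C => // s h x s0 h0 sht.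
have cont (f : R -> R) (df : R -> R) (a b : R) : (forall s : R, is_derive s 1 f (df s)) ->
    {within `[a, b], continuous f}.
  by move=> d; apply: derivable_within_continuous => y _; case: (d y).
have sh : s < s + h by rewrite ltrDl.
have [xi xiI ->] := MVT sh (fun s _ => is_derive_barrier_time x s)
  (cont _ _ _ _ (is_derive_barrier_time x)).
move: xiI; rewrite in_itv/= => /andP[sxi xish].
have [eta etaI E2] := MVT xish (fun s _ => is_derive_barrier_time2 x s)
  (cont _ _ _ _ (is_derive_barrier_time2 x)).
move: etaI; rewrite in_itv/= => /andP[xieta etash].
rewrite [s + h - s]addrC addKr (_ : _ - _ = - (h * (v' (s + h) x - v' xi x))); last by ring.
rewrite normrN normrM gtr0_norm// E2 normrM [`|s + h - xi|]gtr0_norm ?subr_gt0//.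
rewrite mulrCA expr2; apply: ler_pM => //; first by rewrite mulr_ge0 ?(ltW h0)// subr_ge0 ltW.
  apply: hC; apply/andP; split; first by rewrite (le_trans s0)// ltW// (lt_trans sxi).
  by rewrite (le_trans _ sht)// ltW.
by rewrite ler_pM2l//; lra.
Qed.

Lemma barrier_t_cs (tau s : R) : 0 <= tau -> s <= tau ->
  continuous (v' s) /\ supported_in (`|x0| + (rho + c * tau + 1)) (v' s).
Proof.
move=> tau0 st; split.
  apply: scale_continuous; apply: sub_continuous; apply: scale_continuous; exact: frontX_continuous.
by move=> x Mx; rewrite /barrier_t (front_support c0 rho0 tau0 st)// !expr0n /= !mulr0 subrr mulr0.
Qed.

Lemma barrier_cs (tau s : R) : 0 <= tau -> s <= tau ->
  continuous (v s) /\ supported_in (`|x0| + (rho + c * tau + 1)) (v s).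
Proof.
move=> tau0 st; split; first by apply: scale_continuous; exact: frontX_continuous.
by move=> x Mx; rewrite /barrier (front_support c0 rho0 tau0 st)// expr0n /= mulr0.
Qed.

Lemma barrier_Lpn_taylor (p tau : R) : 1 <= p -> 0 <= tau -> exists2 C : R, 0 <= C &
  forall s h, 0 <= s -> 0 < h -> s + h <= tau ->
    Lpn mu p (fun x => v (s + h) x - v s x - h * v' (s + h) x) <= C * h ^+ 2.
Proof.
move=> p1 tau0; have [C C0 hC] := barrier_taylor tau0.
pose M : R := `|x0| + (rho + c * tau + 1).
exists (C * Lpn mu p (\1_(cube M))); first by rewrite mulr_ge0// Lpn_ge0.
move=> s h s0 h0 sht; have st : s <= tau by rewrite (le_trans _ sht)// lerDl ltW.
have [c1 m1] := barrier_cs tau0 sht; have [c2 m2] := barrier_cs tau0 st.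
have [c3 m3] := barrier_t_cs tau0 sht.
rewrite mulrAC; apply: bounded_supported_Lpn => //.
- by rewrite mulr_ge0// exprn_ge0// ltW.
- apply: continuous_measurable_rV; apply: sub_continuous; first exact: sub_continuous.
  exact: scale_continuous.
- by move=> x; exact: hC.
- by move=> x Mx; rewrite m1// m2// m3// mulr0 !subr0.
Qed.

End barrier_in_time.

(** * Strict positivity of the semigroup *)

Section irreducibility.
Context (R : realType) (N : nat) (alpha beta : R).
Hypotheses (alpha0 : 0 <= alpha) (beta0 : 0 <= beta).
Variables (p : R) (p1 : 1 < p).
Let p1' : 1 <= p := ltW p1.
Local Notation E := 'rV[R]_N.
Local Notation mu := (lebesgue_rV R N).
Local Notation L := (Lpf mu p).
Variable T : R -> (E -> R) -> (E -> R).
Hypothesis hT : C0_semigroup p T.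
Hypothesis hA : generates p (domA (N := N) alpha beta p) (opA alpha beta) T.

(** The speed [c] is given and the decay rate [K] adapts to it, so a lower bound on one ball reaches
    any prescribed point within time [tau]. *)
Lemma positivity_spreads (c rho d tau : R) (x0 : E) (f : E -> R) : 0 <= c -> 0 < rho -> 0 < d ->
  0 < tau -> L f -> {ae mu, forall x, 0 <= f x} ->
  (forall x, sqdist x0 x < rho -> d <= f x) ->
  exists k K, 0 < k /\ {ae mu, forall x, barrier k K c rho x0 tau x <= T tau f x}.
Proof.
move=> c0 rho0 d0 tau0 Lf f0 hf; have tau0' := ltW tau0; have rho0' := ltW rho0.
(* The barrier vanishes outside this cube up to time [tau]. The coefficients, possibly unbounded on
   the whole space, are bounded on it, and outside it both sides of the differential inequality are
   0. *)
pose M : R := `|x0| + (rho + c * tau + 1).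
have [a0 [a00 ha hV]] := coefficients_bounded N alpha0 beta0 M.
pose a1 := a0 + 1.
(* The front is at most [rho] at time 0, so the initial bump has height at most k rho^3 = d. [K] is
   the value required by [barrier_subsolution]. *)
pose k := d / rho ^+ 3; pose K := a1 + (3 * c + 6 * N%:R * a1 + 24) ^+ 2 / (96 * rho).
have k0 : 0 < k by rewrite divr_gt0// exprn_gt0.
have a10 : 0 <= a1 by rewrite addr_ge0.
have K0 : 0 <= K by rewrite addr_ge0// divr_ge0 ?sqr_ge0// mulr_ge0.
exists k, K; split => //.
have [C C0 hC] := barrier_Lpn_taylor x0 (ltW k0) K0 c0 rho0' p1' tau0'.
apply: (comparison alpha0 beta0 p1 hT hA tau0 C0 _ hC Lf).
- move=> s /andP[s0 st].
  have [D A] := C2c_domA alpha0 beta0 p1 (barrier_C2c k K x0 c0 rho0' s0).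
  have [ct st'] := barrier_t_cs k K x0 c0 rho0' tau0' st.
  split => //; first by apply: cs_Lpf => //; split => //; exists M.
  apply: filterS A => x ->//; have [xM|xM] := leP `|x| M.
    apply: barrier_subsolution => //.
      by rewrite diffusion_ge1/= (le_trans (ha x xM))// lerDl.
    by rewrite potential_ge0/= (le_trans (hV x xM))// lerDl.
  have w0 : front c rho x0 s x = 0 by apply: (front_support c0 rho0' tau0' st); exact: ltW.
  rewrite barrier_laplacian /barrier_t /barrier w0 !expr0n /=.
  by rewrite !mulr0 !subrr !mulr0.
- apply: filterS f0 => x fx; rewrite /barrier mulr0 expR0 mulr1.
  have [qr|qr] := ltP (sqdist x0 x) rho.
    apply: le_trans (hf x qr); rewrite -ler_pdivlMl// invf_div.
    rewrite divfK ?gt_eqF// lerXn2r ?nnegrE ?front_ge0//.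
    by have := front_le x0 x c0 rho0' (lexx 0) (lexx 0); rewrite mulr0 addr0.
  by rewrite /front mulr0 addr0 pos_nonpos ?subr_le0// expr0n mulr0.
Qed.

Lemma continuous_bounded_below_near (g : E -> R) (x0 : E) : continuous g -> 0 < g x0 ->
  exists2 rho : R, 0 < rho & forall x, sqdist x0 x < rho -> g x0 / 2 <= g x.
Proof.
move=> cg g0; have h2 : 0 < g x0 / 2 by rewrite divr_gt0.
have /cvgrPdist_lt/(_ _ h2)/nbhs_ballP[e /= e0 he] := cg x0.
exists (e ^+ 2); first by rewrite exprn_gt0.
move=> x qx; have : ball x0 e x.
  apply/rV_ballP; split => // i; rewrite distrC -(ltr_pXn2r (n := 2))// ?nnegrE ?(ltW e0)//.
  apply: le_lt_trans qx; rewrite -normrX ger0_norm ?sqr_ge0//.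
  exact: (@ler_term_sum _ _ (fun i => (x ord0 i - x0 ord0 i) ^+ 2) i (fun i => sqr_ge0 _)).
move/he; rewrite /= distrC ltr_norml => /andP[h _]; lra.
Qed.

(** If T(s) f were 0 its distance to f would be |f|, which strong continuity excludes for small
    s. *)
Lemma semigroup_nonzero (t : R) (f : E -> R) : 0 < t -> L f -> ~ (f = cst 0 %[ae mu]) ->
  exists s, 0 < s < t /\ ~ (T s f = cst 0 %[ae mu]).
Proof.
move=> t0 Lf fn0.
have nf : 0 < Lpn mu p f.
  rewrite lt_neqAle Lpn_ge0 andbT eq_sym; apply/eqP => /(Lpn_eq0 p1' Lf); exact: fn0.
have [del del0 hdel] := T_cvg0 p1 hT Lf nf.
pose s := Num.min (del / 2) (t / 2).
have s0 : 0 < s by rewrite lt_min !divr_gt0.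
have sd : s < del by rewrite gt_min; apply/orP; left; lra.
have st : s < t by rewrite gt_min; apply/orP; right; lra.
exists s; split; first by rewrite s0.
move=> T0; have LT := T_Lp hT (ltW s0) Lf.
suff : Lpn mu p (fun x => T s f x - f x) = Lpn mu p f.
  by move=> h; have := hdel s; rewrite s0 sd h ltxx => /(_ isT).
rewrite -[RHS](LpnN p1' Lf); apply: ae_eq_Lpn => //; [exact: LpfB|exact: LpfN|].
by apply: filterS T0 => x /(_ I) Tx _; rewrite Tx sub0r.
Qed.

(** A nonzero [f] may have no positive lower bound on any ball. After a short time s the continuous
    representative of T(s) f is positive at some point, hence bounded below near it, and the barrier
    is started from there. *)
Lemma irreducible_semigroup :
  (forall (t : R) (f : E -> R), 0 < t -> Lp p f -> exists g, continuous_representative (T t f) g) ->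
  irreducible p T.
Proof.
move=> hcont f Lf f0 fn0 t t0; have [s [/andP[s0 st] Tn0]] := semigroup_nonzero t0 Lf fn0.
have s0' := ltW s0; have ts0 : 0 < t - s by rewrite subr_gt0.
have ts0' := ltW ts0.
have [gs [cgs gsE]] := hcont s f s0 Lf; have [g [cg gE]] := hcont t f t0 Lf.
have LTs : L (T s f) by exact: (T_Lp hT).
have Lgs : L gs by apply: (ae_eq_Lpf p1' _ gsE LTs); exact: continuous_measurable_rV.
have gs0 x : 0 <= gs x.
  apply: (@continuous_ae_le _ _ (fun=> 0) gs) => //; first exact: cst_continuous.
  have := positivity alpha0 beta0 p1 hT hA s0 Lf f0.
  by apply: filterS2 gsE => {}x -> //.
have [x0 gx0] : exists x0, 0 < gs x0.
  apply: contrapT => H; apply: Tn0; apply: filterS gsE => x /(_ I) gx _; rewrite -gx.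
  apply/eqP; rewrite eq_le gs0 andbT leNgt; apply/negP => h; apply: H; by exists x.
have [rho rho0 hrho] := continuous_bounded_below_near cgs gx0.
have gT : g = T (t - s) gs %[ae mu].
  have A1 := T_add hT ts0' s0' Lf; rewrite subrK in A1.
  have A2 := T_ae hT ts0' Lgs LTs gsE.
  by apply: filterS2 gE (filterI A1 A2) => x h1 [h2 h3] _; rewrite h1// h2// h3.
exists g; first by split.
(* With this speed the front at [x1] at time t - s has height exactly [rho], so the barrier is
   positive there. *)
move=> x1; pose c := sqdist x0 x1 / (t - s).
have c0 : 0 <= c by rewrite divr_ge0// sqdist_ge0.
have d0 : 0 < gs x0 / 2 by rewrite divr_gt0.
have [k [K [k0 hk]]] := positivity_spreads c0 rho0 d0 ts0 Lgs (aeW _ gs0) hrho.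
apply: lt_le_trans (_ : barrier k K c rho x0 (t - s) x1 <= _).
  apply: mulr_gt0; first by rewrite mulr_gt0 ?expR_gt0.
  apply: exprn_gt0; rewrite /front /c divfK ?gt_eqF// addrK.
  by rewrite /pos max_l// ltW.
apply: (@continuous_ae_le _ _ (barrier k K c rho x0 (t - s)) g) => //.
  by have [] := barrier_cs k K x0 c0 (ltW rho0) ts0' (lexx _).
by apply: filterS2 gT hk => x h1 h2; rewrite h1.
Qed.

End irreducibility.

Theorem corollary2p8 (R : realType) (N : nat) (alpha beta : R)
    (hN : (0 < N)%N) (halpha : 0 <= alpha <= 2) (hbeta : 0 <= beta)
    (hab : alpha ^+ 2 + beta ^+ 2 != 0)
    (p : R) (hp : 1 < p)
    (T : R -> ('rV[R]_N -> R) -> ('rV[R]_N -> R))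
    (hT : C0_semigroup p T)
    (hA : generates p (domA (N := N) alpha beta p) (opA alpha beta) T)
    (hcont : forall (t : R) (f : 'rV[R]_N -> R), 0 < t -> Lp p f ->
       exists g : 'rV[R]_N -> R, continuous_representative (T t f) g) :
  irreducible p T.
Proof.
by have /andP[alpha0 _] := halpha; exact: (irreducible_semigroup alpha0 hbeta hp hT hA hcont).
Qed.
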